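(* Let $\Omega\subset\mathbb C^n$ be a bounded symmetric domain on which a finite complex reflection group $G$ acts, and let $\boldsymbol\theta:\Omega\to\boldsymbol\theta(\Omega)$ be a basic polynomial map associated to $G$. For every $\varrho\in\widehat G_1$, the reproducing kernel Hilbert space $H^2_\varrho(\boldsymbol\theta(\Omega))$ is isometrically isomorphic to $\mathbb P_\varrho(H^2(\Omega))$.
   Context: $\Omega\subset\mathbb C^n$ is a bounded symmetric domain (for all $a,b\in\Omega$ some involution in the group $\mathrm{Aut}(\Omega)$ of biholomorphic automorphisms interchanges $a,b$), in its standard circular realization centred at $0$ (so $0\in\Omega$ and $rt\in\Omega$ for $0\le r<1$, $t\in\overline\Omega$). $\partial\Omega$ denotes the Shilov boundary; $I_\Omega(0)=\{\phi\in\mathrm{Aut}(\Omega):\phi(0)=0\}$ acts transitively on it and $d\Theta$ is the unique normalized $I_\Omega(0)$-invariant measure on $\partial\Omega$. $H^2(\Omega)$ is the Hilbert space of holomorphic $f$ on $\Omega$ with $\|f\|^2=\sup_{0<r<1}\int_{\partial\Omega}|f(rt)|^2d\Theta(t)<\infty$. A complex reflection on $\mathbb C^n$ is a linear map $\sigma$ of finite order with $\mathrm{rank}(I_n-\sigma)=1$. $G$ is a finite group generated by complex reflections, with $G\subset\mathrm{Aut}(\Omega)$ (acting linearly). The ring of $G$-invariant polynomials is $\mathbb C[\theta_1,\dots,\theta_n]$ with algebraically independent homogeneous $\theta_i$; $\boldsymbol\theta=(\theta_1,\dots,\theta_n):\Omega\to\boldsymbol\theta(\Omega)$ is called a basic polynomial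 map associated to $G$. $\widehat G_1$ is the set of (equivalence classes of) one-dimensional representations of $G$, and for $\varrho\in\widehat G_1$ with character $\chi_\varrho$, $\mathbb P_\varrho f=\frac1{|G|}\sum_{\sigma\in G}\chi_\varrho(\sigma^{-1})\,f\circ\sigma$ is the orthogonal projection of $H^2(\Omega)$ onto $\mathbb P_\varrho(H^2(\Omega))=\{f\in H^2(\Omega): f\circ\sigma=\chi_\varrho(\sigma)f\ \forall\sigma\in G\}$ (here $\sigma$ acts on $\mathbb C^n$ as a matrix; the paper writes this as $(\sigma f)(z)=f(\sigma^{-1}\cdot z)$ with $\sigma\cdot z=\sigma^{-1}z$). Let $H_1,\dots,H_t$ be the distinct reflecting hyperplanes of $G$, $\ell_i$ a linear form with zero set $H_i$, and $a_i$ a generator of the cyclic subgroup of $G$ fixing $H_i$ pointwise. Let $c_i$ be the least non-negative integer with $\varrho(a_i)=\det(a_i)^{c_i}$, $\ell_\varrho=\prod_i\ell_i^{c_i}$ and $c_\varrho=\|\ell_\varrho\|_{H^2(\Omega)}$. Define $H^2_\varrho(\boldsymbol\theta(\Omega))$ as the space of holomorphic $f:\boldsymbol\theta(\Omega)\to\mathbb C$ with $$\|f\|_\varrho^2=\frac1{c_\varrho^2}\sup_{0<r<1}\int_{\partial\Omega}|(f\circ\boldsymbol\theta)(rt)|^2|\ell_\varrho(rt)|^2d\Theta(t)<\infty .$$ The natural map between the two spaces considered in the paper is $\Gamma^h_\varrho f=\frac1{c_\varrho}\ell_\varrho\cdot(f\circ\boldsymbol\theta)$. *)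

(* Defs.v *)
From HB Require Import structures.
From mathcomp Require Import all_boot all_order all_algebra all_fingroup.
From mathcomp Require Import mxrepresentation.
From mathcomp Require Import complex.
From mathcomp Require Import -(notations) mpoly.
From mathcomp Require Import all_classical all_reals all_analysis.
Set Implicit Arguments.
Unset Strict Implicit.
Unset Printing Implicit Defensive.
Import Order.TTheory GRing.Theory Num.Theory.
Import numFieldNormedType.Exports.
Local Open Scope classical_set_scope.
Local Open Scope complex_scope.
Local Open Scope ring_scope.

(* The usual topology and norm on the complex numbers: numFieldNormedType
   provides them on abstract numFieldTypes only. *)
HB.instance Definition _ (R : rcfType) := NormedModule.copy R[i] R[i]^o.

(* C^n as column vectors, on which matrices act from the left. *)
Notation Cn R n := 'cV[R[i]]_n.

(* Complex differentiability: the scalars of both normed spaces are R[i]. *)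
Definition holomorphic_on (R : realType) (V W : normedModType R[i])
    (D : set V) (f : V -> W) : Prop :=
  forall z, D z -> differentiable f z.

(* Only the values of phi on Omega matter: phi represents an element of
   Aut(Omega), with inverse represented by psi. *)
Definition is_automorphism (R : realType) (n : nat) (Omega : set (Cn R n))
    (phi : Cn R n -> Cn R n) : Prop :=
  exists psi : Cn R n -> Cn R n,
    [/\ holomorphic_on Omega phi, holomorphic_on Omega psi,
        (forall z, Omega z -> Omega (phi z)) /\
        (forall z, Omega z -> Omega (psi z)),
        forall z, Omega z -> psi (phi z) = z &
        forall z, Omega z -> phi (psi z) = z].

Record bounded_symmetric_domain (R : realType) (n : nat)
    (Omega : set (Cn R n)) : Prop := BoundedSymmetricDomain {
  bsd_open : open Omega;
  bsd_connected : connected Omega;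
  bsd_bounded : bounded_set Omega;
  bsd_symmetric : forall a b, Omega a -> Omega b ->
    exists phi : Cn R n -> Cn R n,
      [/\ is_automorphism Omega phi,
          forall z, Omega z -> phi (phi z) = z,
          phi a = b & phi b = a] }.

Record circular_realization (R : realType) (n : nat)
    (Omega : set (Cn R n)) : Prop := CircularRealization {
  cr_origin : Omega 0;
  cr_circular : forall (u : R[i]) z, `|u| = 1 -> Omega z -> Omega (u *: z);
  cr_starlike : forall (r : R) t, 0 <= r -> r < 1 -> closure Omega t ->
    Omega (r%:C *: t) }.

(* A(Omega): continuous on the closure, holomorphic inside. *)
Definition disc_algebra (R : realType) (n : nat) (Omega : set (Cn R n))
    (f : Cn R n -> R[i]) : Prop :=
  {within closure Omega, continuous f} /\ holomorphic_on Omega f.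

Definition is_boundary (R : realType) (n : nat) (Omega Sh : set (Cn R n)) :
    Prop :=
  [/\ closed Sh, Sh `<=` closure Omega &
      forall f, disc_algebra Omega f ->
      forall z, closure Omega z -> exists2 t, Sh t & `|f z| <= `|f t| ].

Definition is_shilov_boundary (R : realType) (n : nat)
    (Omega Sh : set (Cn R n)) : Prop :=
  is_boundary Omega Sh /\ forall Sh', is_boundary Omega Sh' -> Sh `<=` Sh'.

(* Elements of I_Omega(0), represented by maps that are continuous up to the
   closure so that they also act on the Shilov boundary.  No element is lost:
   by Cartan's theorem the automorphisms fixing 0 are restrictions of linear
   maps. *)
Definition isotropy0 (R : realType) (n : nat) (Omega : set (Cn R n))
    (phi : Cn R n -> Cn R n) : Prop :=
  [/\ is_automorphism Omega phi, phi 0 = 0 &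
      {within closure Omega, continuous phi}].

(* Always true when Sh is the Shilov boundary of a bounded symmetric domain;
   it is what makes the normalized invariant measure on Sh unique. *)
Definition isotropy_transitive (R : realType) (n : nat)
    (Omega Sh : set (Cn R n)) : Prop :=
  forall s t, Sh s -> Sh t -> exists2 phi, isotropy0 Omega phi & phi s = t.

(* C^n with its Borel sigma-algebra. *)
Notation borelCn R n := (g_sigma_algebraType (@open (Cn R n))).

(* A normalized invariant measure on Sh, seen as a Borel probability measure on
   C^n carried by Sh. *)
Definition invariant_measure (R : realType) (n : nat) (Omega Sh : set (Cn R n))
    (mu : probability (borelCn R n) R) : Prop :=
  mu Sh = 1%E /\
  forall phi, isotropy0 Omega phi ->
  forall B : set (borelCn R n), measurable B ->
    mu (Sh `&` phi @^-1` B) = mu (Sh `&` B).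

Definition hardy_mean (R : realType) (n : nat) (Sh : set (Cn R n))
    (mu : probability (borelCn R n) R) (f : Cn R n -> R[i]) (r : R) :
    \bar R :=
  (\int[mu]_(t in Sh) (ComplexField.Normc.normc (f (r%:C *: t)) ^+ 2)%:E)%E.

Definition hardy_normsq (R : realType) (n : nat) (Sh : set (Cn R n))
    (mu : probability (borelCn R n) R) (f : Cn R n -> R[i]) : \bar R :=
  ereal_sup [set hardy_mean Sh mu f r | r in [set r : R | 0 < r < 1]].

Definition hardy_norm (R : realType) (n : nat) (Sh : set (Cn R n))
    (mu : probability (borelCn R n) R) (f : Cn R n -> R[i]) : R :=
  Num.sqrt (fine (hardy_normsq Sh mu f)).

(* A function on a subset D of C^n is represented by its extension by zero, so
   that equality of functions on D is equality. *)
Definition function_on (R : realType) (n : nat) (D : set (Cn R n))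
    (f : Cn R n -> R[i]) : Prop :=
  forall z, ~ D z -> f z = 0.

Definition hardy_space (R : realType) (n : nat) (Omega Sh : set (Cn R n))
    (mu : probability (borelCn R n) R) : set (Cn R n -> R[i]) :=
  [set f | [/\ function_on Omega f, holomorphic_on Omega f &
               (hardy_normsq Sh mu f < +oo)%E]].

Definition complex_reflection (R : realType) (n : nat) (A : 'M[R[i]]_n) :
    Prop :=
  (exists2 m, (0 < m)%N & A ^+ m = 1) /\ \rank (1%:M - A) = 1%N.

(* A finite subgroup of GL_n(C) is given as the image of a faithful
   representation rG of an abstract finite group G. *)
Definition reflection_group (R : realType) (n : nat) (gT : finGroupType)
    (G : {group gT}) (rG : mx_representation R[i] G n) : Prop :=
  mx_faithful rG /\
  forall H : {group gT},
    (forall s, s \in G -> complex_reflection (rG s) -> s \in H) ->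
    G \subset H.

Definition acts_by_automorphisms (R : realType) (n : nat) (gT : finGroupType)
    (G : {group gT}) (rG : mx_representation R[i] G n)
    (Omega : set (Cn R n)) : Prop :=
  forall g, g \in G -> is_automorphism Omega (fun z => rG g *m z).

Definition poly_eval (R : realType) (n : nat) (p : mpoly n R[i])
    (z : Cn R n) : R[i] :=
  meval (fun j => z j 0) p.

Definition invariant_poly (R : realType) (n : nat) (gT : finGroupType)
    (G : {group gT}) (rG : mx_representation R[i] G n)
    (p : mpoly n R[i]) : Prop :=
  forall g, g \in G -> forall z, poly_eval p (rG g *m z) = poly_eval p z.

Record basic_polynomials (R : realType) (n : nat) (gT : finGroupType)
    (G : {group gT}) (rG : mx_representation R[i] G n)
    (theta : n.-tuple (mpoly n R[i])) : Prop := BasicPolynomials {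
  bp_homogeneous : forall i, exists d,
    tnth theta i \is ishomog1 d (@mdeg n);
  bp_independent : forall q : mpoly n R[i],
    comp_mpoly theta q = 0 -> q = 0;
  bp_generate : forall p : mpoly n R[i],
    invariant_poly rG p <-> exists q, p = comp_mpoly theta q }.

Definition basic_map (R : realType) (n : nat)
    (theta : n.-tuple (mpoly n R[i])) (z : Cn R n) : Cn R n :=
  \col_i poly_eval (tnth theta i) z.

Definition hyperplane (R : realType) (n : nat) (l : 'rV[R[i]]_n) :
    set (Cn R n) :=
  [set z | l *m z = 0].

(* ell lists linear forms (row vectors) defining the distinct reflecting
   hyperplanes, and a i generates the pointwise stabilizer of the i-th one. *)
Record reflecting_hyperplanes (R : realType) (n : nat) (gT : finGroupType)
    (G : {group gT}) (rG : mx_representation R[i] G n) (t : nat)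
    (ell : 'I_t -> 'rV[R[i]]_n) (a : 'I_t -> gT) : Prop :=
  ReflectingHyperplanes {
  rh_reflecting : forall i, exists s, [/\ s \in G, complex_reflection (rG s) &
    hyperplane (ell i) = [set z | rG s *m z = z]];
  rh_all : forall s, s \in G -> complex_reflection (rG s) ->
    exists i, hyperplane (ell i) = [set z | rG s *m z = z];
  rh_distinct : forall i j, hyperplane (ell i) = hyperplane (ell j) -> i = j;
  rh_generator : forall i g,
    g \in <[a i]>%g <->
    g \in G /\ forall z, hyperplane (ell i) z -> rG g *m z = z }.

Definition chi (R : realType) (gT : finGroupType) (G : {group gT})
    (rho : mx_representation R[i] G 1) (g : gT) : R[i] :=
  \tr (rho g).

Definition least_exponent (R : realType) (n : nat) (gT : finGroupType)
    (G : {group gT}) (rG : mx_representation R[i] G n)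
    (rho : mx_representation R[i] G 1) (a : gT) (c : nat) : Prop :=
  chi rho a = \det (rG a) ^+ c /\
  forall m, chi rho a = \det (rG a) ^+ m -> (c <= m)%N.

Definition ell_prod (R : realType) (n t : nat) (ell : 'I_t -> 'rV[R[i]]_n)
    (c : 'I_t -> nat) (z : Cn R n) : R[i] :=
  \prod_(i < t) ((ell i *m z) 0 0) ^+ c i.

Definition isotypic_proj (R : realType) (n : nat) (gT : finGroupType)
    (G : {group gT}) (rG : mx_representation R[i] G n)
    (rho : mx_representation R[i] G 1) (f : Cn R n -> R[i]) :
    Cn R n -> R[i] :=
  fun z => #|G|%:R^-1 * \sum_(g in G) chi rho g^-1%g * f (rG g *m z).

Definition orbit_mean (R : realType) (n : nat) (Sh : set (Cn R n))
    (mu : probability (borelCn R n) R) (theta : Cn R n -> Cn R n)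
    (l h : Cn R n -> R[i]) (r : R) : \bar R :=
  (\int[mu]_(t in Sh)
     (ComplexField.Normc.normc (h (theta (r%:C *: t))) ^+ 2 *
      ComplexField.Normc.normc (l (r%:C *: t)) ^+ 2)%:E)%E.

Definition orbit_normsq (R : realType) (n : nat) (Sh : set (Cn R n))
    (mu : probability (borelCn R n) R) (theta : Cn R n -> Cn R n)
    (l h : Cn R n -> R[i]) : \bar R :=
  (((hardy_norm Sh mu l ^+ 2)^-1)%:E *
   ereal_sup [set orbit_mean Sh mu theta l h r
             | r in [set r : R | (0 < r < 1)%R]])%E.

Definition orbit_norm (R : realType) (n : nat) (Sh : set (Cn R n))
    (mu : probability (borelCn R n) R) (theta : Cn R n -> Cn R n)
    (l h : Cn R n -> R[i]) : R :=
  Num.sqrt (fine (orbit_normsq Sh mu theta l h)).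

Definition orbit_hardy_space (R : realType) (n : nat)
    (Omega Sh : set (Cn R n)) (mu : probability (borelCn R n) R)
    (theta : Cn R n -> Cn R n) (l : Cn R n -> R[i]) :
    set (Cn R n -> R[i]) :=
  [set h | [/\ function_on (theta @` Omega) h,
               holomorphic_on (theta @` Omega) h &
               (orbit_normsq Sh mu theta l h < +oo)%E]].

Definition Gamma_hardy (R : realType) (n : nat) (Omega Sh : set (Cn R n))
    (mu : probability (borelCn R n) R) (theta : Cn R n -> Cn R n)
    (l h : Cn R n -> R[i]) : Cn R n -> R[i] :=
  fun z => if z \in Omega
           then ((hardy_norm Sh mu l)^-1)%:C * l z * h (theta z) else 0.

Definition linear_subspace (K : fieldType) (V : lmodType K) (A : set V) :
    Prop :=
  A 0 /\ forall (k : K) u v, A u -> A v -> A (k *: u + v).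

(* T is a surjective linear isometry from the subspace A of V, with norm NA,
   onto the subspace B of W, with norm NB. *)
Definition isometric_isomorphism (R : realType) (K : fieldType)
    (V W : lmodType K) (A : set V) (NA : V -> R) (B : set W) (NB : W -> R)
    (T : V -> W) : Prop :=
  [/\ linear_subspace A /\ linear_subspace B,
      forall (k : K) u v, A u -> A v -> T (k *: u + v) = k *: T u + T v,
      set_bij A B T &
      forall u, A u -> NB (T u) = NA u].

(* Main.v *)
Require Import Defs.
From HB Require Import structures.
From mathcomp Require Import all_boot all_order all_algebra all_fingroup.
From mathcomp Require Import mxrepresentation.
From mathcomp Require Import complex.
From mathcomp Require Import -(notations) mpoly.
From mathcomp Require Import all_classical all_reals all_analysis.
From mathcomp Require Import measurable_realfun.
From mathcomp Require Import ring lra.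
Set Implicit Arguments.
Unset Strict Implicit.
Unset Printing Implicit Defensive.
Import Order.TTheory GRing.Theory Num.Theory.
Import numFieldNormedType.Exports.
Local Open Scope classical_set_scope.
Local Open Scope complex_scope.
Local Open Scope ring_scope.

(** The map [Gamma h = c^-1 * ell_prod * (h o theta)] is an isometry by the
    very definition of the norm on the orbit space. The content is that it is
    well defined and bijective onto the isotypic component of the Hardy space.

    The normalizing constant, the Hardy norm of [ell_prod], is finite because
    the domain is bounded. It is positive because a polynomial of norm zero
    would vanish almost everywhere on the dilated Shilov boundary; nonempty
    relatively open subsets of the boundary have positive measure, the isotropy
    group being transitive ([null_open_disjoint]), so it would vanish
    everywhere there and then on the domain by the maximum property.

    By Stanley's theorem [ell_prod] transforms under the group by the character
    [chi rho] ([ell_prod_chi]), while [theta] is invariant, so [Gamma h] lies in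
    the isotypic component. The isotypic projection preserves the Hardy space
    because the group acts by isotropy maps, under which the measure is
    invariant ([hardy_mean_act]). Injectivity holds because the zero set of
    [ell_prod] has empty interior.

    Surjectivity is the descent theorem [holomorphic_descent]: a holomorphic
    [F] with [F o g = chi g F] is [ell_prod * (h o theta)] with [h] holomorphic
    on the image of [theta]. The domain is circular and star-shaped, so [F] is a
    locally uniform sum of homogeneous polynomials ([homogeneous_expansion]),
    each of them a relative invariant. A relatively invariant polynomial is
    divisible by [ell_prod] with an invariant quotient
    ([relative_invariant_factor]), which is a polynomial in [theta]. The
    resulting series of polynomials on the orbit space converges locally
    uniformly for two reasons: dividing by a product of linear forms costs only
    a constant factor on a slightly smaller ball ([div_bounded_ellp]), and
    [theta] is an open map ([basic_map_open]). Openness follows from the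
    surjectivity of [theta] onto the whole space ([basic_map_surj]), a form of
    the Nullstellensatz for the invariant ring, by a pigeonhole argument on the
    group elements.

    Holomorphy means complex differentiability at every point, so the expansion
    rests on Goursat's theorem in one variable ([cdiff_has_exp]). Bisection of
    triangles gives a primitive, and Cauchy's formula, with circles sampled at
    roots of unity so that no integral is needed, approximates the primitive and
    then the function by polynomials; Cauchy's estimates turn the approximation
    into a power series. In several variables the expansion is obtained on the
    lines through the origin. *)

Local Notation nc := ComplexField.Normc.normc.

(** * Modulus of complex numbers *)

Section ComplexModulus.
Variable R : realType.
Implicit Types (x y z w : R[i]).

Lemma ncD x y : nc (x + y) <= nc x + nc y.
Proof. exact: (@le_normcD R x y). Qed.

Lemma ncN x : nc (- x) = nc x.
Proof. exact: (@normcN R x). Qed.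

Lemma ncM x y : nc (x * y) = nc x * nc y.
Proof. exact: ComplexField.Normc.normcM. Qed.

Lemma nc0 : nc (0 : R[i]) = 0.
Proof. exact: ComplexField.Normc.normc0. Qed.

Lemma nc1 : nc (1 : R[i]) = 1.
Proof. exact: ComplexField.Normc.normc1. Qed.

Lemma ncV x : nc x^-1 = (nc x)^-1.
Proof. exact: ComplexField.Normc.normcV. Qed.

Lemma nc_ge0 x : 0 <= nc x.
Proof. by case: x => a b /=; exact: sqrtr_ge0. Qed.

Lemma nc_eq0 x : (nc x == 0) = (x == 0).
Proof.
apply/eqP/eqP => [/ComplexField.Normc.eq0_normc //|->]; exact: nc0.
Qed.

Lemma nc_gt0 x : (0 < nc x) = (x != 0).
Proof. by rewrite lt_def nc_ge0 andbT nc_eq0. Qed.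

Lemma nc_norm x : `|x| = (nc x)%:C.
Proof. by rewrite normc_def; case: x. Qed.

Lemma ncX x n : nc (x ^+ n) = nc x ^+ n.
Proof. by elim: n => [|n IH]; rewrite ?expr0 ?nc1 // !exprS ncM IH. Qed.

Lemma nc_real (a : R) : nc a%:C = `|a|.
Proof. by rewrite /= expr0n addr0 sqrtr_sqr. Qed.

Lemma ncB x y : nc (x - y) = nc (y - x).
Proof. by rewrite -ncN opprB. Qed.

Lemma nc_subD x y z : nc (x - z) <= nc (x - y) + nc (y - z).
Proof. by have := ncD (x - y) (y - z); rewrite addrA subrK. Qed.

Lemma nc_lowerD x y : nc x - nc y <= nc (x + y).
Proof.
have := ncD (x + y) (- y); rewrite addrK ncN; lra.
Qed.

Lemma ncMn x n : nc (x *+ n) = nc x *+ n.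
Proof. exact: (@normcMn R x). Qed.

Lemma nc_natr n : nc (n%:R : R[i]) = n%:R.
Proof. by rewrite ncMn nc1. Qed.

Lemma nc_sum (I : Type) (r : seq I) (P : pred I) (F : I -> R[i]) :
  nc (\sum_(i <- r | P i) F i) <= \sum_(i <- r | P i) nc (F i).
Proof.
elim/big_rec2: _ => [|i a b _ H]; first by rewrite nc0.
by apply: le_trans (ncD _ _) _; rewrite lerD2l.
Qed.

Lemma nc_prod (I : Type) (r : seq I) (P : pred I) (F : I -> R[i]) :
  nc (\prod_(i <- r | P i) F i) = \prod_(i <- r | P i) nc (F i).
Proof. by elim/big_rec2: _ => [|i a b _ <-]; rewrite ?nc1 ?ncM. Qed.

Lemma nc_Re x : `|complex.Re x| <= nc x.
Proof.
case: x => a b /=; rewrite -sqrtr_sqr ler_wsqrtr // lerDl; exact: sqr_ge0.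
Qed.

Lemma nc_Im x : `|complex.Im x| <= nc x.
Proof.
case: x => a b /=; rewrite -sqrtr_sqr ler_wsqrtr // lerDr; exact: sqr_ge0.
Qed.

Lemma nc_ReIm x : nc x <= `|complex.Re x| + `|complex.Im x|.
Proof.
case: x => a b /=; set u := _ + _.
have h : u <= (`|a| + `|b|) ^+ 2.
  rewrite /u sqrrD !real_normK ?num_real // -addrA lerD2l lerDr.
  by rewrite mulrn_wge0 // mulr_ge0.
by rewrite -(ger0_norm (addr_ge0 (normr_ge0 a) (normr_ge0 b))) -sqrtr_sqr ler_wsqrtr.
Qed.

Lemma le_addeps (a b : R) : (forall e : R, 0 < e -> a <= b + e) -> a <= b.
Proof.
move=> H; rewrite leNgt; apply/negP => ba.
have := H ((a - b) / 2) ltac:(lra); lra.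
Qed.

Lemma nc_eq0P x : (forall e : R, 0 < e -> nc x <= e) -> x = 0.
Proof.
move=> H; apply/eqP; rewrite -nc_eq0 eq_le nc_ge0 andbT.
by apply: le_addeps => e e0; rewrite add0r H.
Qed.

Lemma R_cauchy (u : nat -> R) :
  (forall e : R, 0 < e -> exists N, forall m n, (N <= m)%N -> (N <= n)%N ->
    `|u m - u n| <= e) ->
  exists l, forall e : R, 0 < e -> exists N, forall n, (N <= n)%N -> `|u n - l| <= e.
Proof.
move=> H.
have : cauchy (u n @[n --> \oo]).
  apply: cauchy_exP => e e0.
  have [N HN] := H (e / 2) ltac:(lra).
  exists (u N); rewrite /= ; exists N => //= n /= Nn.
  rewrite /ball /=; apply: le_lt_trans (HN _ _ (leqnn N) Nn) _; lra.
move/R_complete => /cvg_ex [l Hl]; exists l => e e0.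
move/cvgrPdist_le: Hl => /(_ e e0) [N _ HN].
by exists N => n Nn; rewrite distrC; apply: HN.
Qed.

Lemma C_cauchy (u : nat -> R[i]) :
  (forall e : R, 0 < e -> exists N, forall m n, (N <= m)%N -> (N <= n)%N ->
    nc (u m - u n) <= e) ->
  exists l, forall e : R, 0 < e -> exists N, forall n, (N <= n)%N -> nc (u n - l) <= e.
Proof.
move=> H.
have [a Ha] : exists l, forall e : R, 0 < e -> exists N, forall n, (N <= n)%N ->
    `|complex.Re (u n) - l| <= e.
  apply: R_cauchy => e /H [N HN]; exists N => m n Nm Nn.
  by apply: le_trans (HN m n Nm Nn); rewrite -raddfB nc_Re.
have [b Hb] : exists l, forall e : R, 0 < e -> exists N, forall n, (N <= n)%N ->
    `|complex.Im (u n) - l| <= e.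
  apply: R_cauchy => e /H [N HN]; exists N => m n Nm Nn.
  by apply: le_trans (HN m n Nm Nn); rewrite -raddfB nc_Im.
exists (a +i* b) => e e0.
have [N1 H1] := Ha (e / 2) ltac:(lra); have [N2 H2] := Hb (e / 2) ltac:(lra).
exists (maxn N1 N2) => n; rewrite geq_max => /andP[n1 n2].
apply: le_trans (nc_ReIm _) _.
have := H1 n n1; have := H2 n n2; case: (u n) => p q /=; lra.
Qed.

(** Compactness of a closed disc, in the form of a gauge principle for
    properties of points at a scale [d] that smaller scales inherit. *)
Lemma disc_gauge (r : R) (P : R[i] -> R -> Prop) :
  (forall x (d d' : R), P x d -> 0 < d' -> d' <= d -> P x d') ->
  (forall x, nc x <= r -> exists2 d : R, 0 < d &
     forall y, nc y <= r -> nc (y - x) < d -> P y d) ->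
  exists2 d : R, 0 < d & forall y, nc y <= r -> P y d.
Proof.
move=> mono loc.
pose Q (d : R) (p : R * R) := nc (p.1 +i* p.2) <= r -> P (p.1 +i* p.2) d.
have := compact_setX (@segment_compact R (- r) r) (@segment_compact R (- r) r).
move=> /compact_near_coveringP cov.
have := cov _ _ Q (at_right_proper_filter (0:R) : Filter _).
case=> [[a b] _|d /= d0 Hd].
- suff [d d0 Hd] : exists2 d : R, 0 < d & forall y, nc (y - (a +i* b)) < d ->
      nc y <= r -> P y d.
    exists (ball (a, b) (d / 2), [set d' : R | 0 < d' <= d]) => /=.
      split; first by apply: nbhsx_ballx; lra.
      exists d => //= d' /=; rewrite sub0r normrN => + d'0.
      by rewrite gtr0_norm // d'0 => /ltW ->.
    move=> [[p1 p2] d'] /= [[]]; rewrite /ball /= => h1 h2 /andP[d'0 d'd] inp.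
    apply: (mono _ d) => //; apply: Hd => //.
    apply: le_lt_trans (nc_ReIm _) _ => /=.
    rewrite distrC (distrC p2); lra.
  case: (leP (nc (a +i* b)) r) => [inr|outr].
    by have [d d0 Hd] := loc _ inr; exists d => // y yd yr; apply: Hd.
  exists (nc (a +i* b) - r); first lra.
  move=> y yd yr; have := nc_lowerD (a +i* b) (y - (a +i* b)).
  have -> : a +i* b + (y - (a +i* b)) = y by ring.
  lra.
- exists (d / 2); first lra.
  move=> [a b] yr; apply: (Hd (d / 2) _ _ (a, b)) => //=.
  + by rewrite sub0r normrN ger0_norm; lra.
  + lra.
  + have := nc_Re (a +i* b); have := nc_Im (a +i* b) => h1 h2.
    by rewrite /= !in_itv /= -!ler_norml (le_trans h2 yr) (le_trans h1 yr).
Qed.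
End ComplexModulus.

(** * Means over roots of unity *)

Section RootsOfUnityMeans.
Variable R : realType.
Implicit Types (z w : R[i]) (f g : R[i] -> R[i]).

Definition expi (t : R) : R[i] := cos t +i* sin t.

(** The primitive root of unity next to 1, so that consecutive powers sample
    the circle ever more finely. *)
Definition omega (N : nat) : R[i] := expi (2 * pi / N%:R).

Lemma expiX t k : expi t ^+ k = expi (t * k%:R).
Proof.
elim: k => [|k IH]; first by rewrite expr0 mulr0 /expi cos0 sin0.
rewrite exprS IH /expi -natr1 mulrDr mulr1 addrC cosD sinD.
by apply/eqP; rewrite eq_complex /= [X in _ && (_ == X)]addrC !eqxx.
Qed.

Lemma nc_expi t : nc (expi t) = 1.
Proof. by rewrite /= cos2Dsin2 sqrtr1. Qed.

Lemma nc_omega N : nc (omega N) = 1. Proof. exact: nc_expi. Qed.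

Lemma nc_omegaX N k : nc (omega N ^+ k) = 1.
Proof. by rewrite ncX nc_omega expr1n. Qed.

Lemma omega_neq0 N k : omega N ^+ k != 0.
Proof. by rewrite -nc_gt0 nc_omegaX. Qed.

Lemma omega_exprN N : (0 < N)%N -> omega N ^+ N = 1.
Proof.
move=> N0; rewrite expiX divfK ?pnatr_eq0 -?lt0n // /expi.
by rewrite mulrC mulr_natr cos2pi sin2pi.
Qed.

Lemma omega_expr_neq1 N k : (0 < k < N)%N -> omega N ^+ k != 1.
Proof.
move=> /andP[k0 kN]; apply/eqP; rewrite expiX /expi => -[+ _].
have N0 : (0 : R) < N%:R by rewrite ltr0n (leq_trans _ kN).
pose t := (pi : R) * (k%:R / N%:R).
have -> : 2 * pi / N%:R * k%:R = t *+ 2 by rewrite /t -mulr_natl; field; exact: lt0r_neq0.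
have : 0 < sin t.
  apply: sin_gt0_pi; rewrite /t mulr_gt0 ?pi_gt0 ?divr_gt0 ?(ltr0n _ k) //=.
  by rewrite gtr_pMr ?pi_gt0 // ltr_pdivrMr // mul1r ltr_nat.
rewrite cos_mulr2n cos2sin2 => s0; have := exprn_gt0 2 s0; lra.
Qed.

Lemma omega_near1 (d : R) : 0 < d ->
  exists N0, forall N, (N0 <= N)%N -> nc (omega N - 1) < d.
Proof.
move=> d0.
have /cvgrPdist_lt /(_ (d ^+ 2 / 2)) := @continuous_cos R 0.
case=> [|e /= e0 He]; first by rewrite divr_gt0 ?exprn_gt0.
exists (Num.truncn (2 * pi / e)).+1 => N NN.
have N0 : (0 : R) < N%:R by rewrite ltr0n (leq_trans _ NN).
have := He (2 * pi / N%:R); rewrite cos0 /=.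
have p0 := pi_gt0 R.
have tpos : (0 : R) < 2 * pi / N%:R by rewrite divr_gt0 // mulr_gt0.
rewrite sub0r normrN gtr0_norm // => /(_ _).
have -> : (2 : R) * pi / N%:R < e.
  rewrite ltr_pdivrMr // [e * _]mulrC -ltr_pdivrMr //.
  apply: lt_le_trans (truncnS_gt _) _; by rewrite ler_nat.
move=> /(_ isT); set t := 2 * pi / _ => Hc.
have h : cos t <= 1 := cos_le1 t.
rewrite ger0_norm in Hc; last lra.
rewrite /omega /expi -/t /= oppr0 addr0.
rewrite -(ger0_norm (ltW d0)) -sqrtr_sqr ltr_sqrt ?exprn_gt0 //.
have := cos2Dsin2 t; nra.
Qed.

Definition mean (N : nat) (g : R[i] -> R[i]) : R[i] :=
  N%:R^-1 * \sum_(j < N) g (omega N ^+ j).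

Lemma natC_neq0 N : (0 < N)%N -> (N%:R : R[i]) != 0.
Proof. by rewrite pnatr_eq0 -lt0n. Qed.

Lemma eq_mean N f g : (forall w, nc w = 1 -> f w = g w) -> mean N f = mean N g.
Proof.
by move=> H; congr (_ * _); apply: eq_bigr => j _; apply: H; exact: nc_omegaX.
Qed.

Lemma meanD N f g : mean N (fun w => f w + g w) = mean N f + mean N g.
Proof. by rewrite /mean big_split mulrDr. Qed.

Lemma meanZ N c f : mean N (fun w => c * f w) = c * mean N f.
Proof. by rewrite /mean -mulr_sumr mulrCA. Qed.

Lemma mean_sum N (I : Type) (r : seq I) (F : I -> R[i] -> R[i]) :
  mean N (fun w => \sum_(i <- r) F i w) = \sum_(i <- r) mean N (F i).
Proof. by rewrite /mean exchange_big /= mulr_sumr. Qed.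

Lemma mean_le N f (M : R) : (0 < N)%N ->
  (forall w, nc w = 1 -> nc (f w) <= M) -> nc (mean N f) <= M.
Proof.
move=> N0 H; rewrite /mean ncM ncV nc_natr mulrC ler_pdivrMr ?ltr0n //.
apply: le_trans (nc_sum _ _ _) _.
rewrite mulr_natr -[in leRHS](card_ord N) -sumr_const.
by apply: ler_sum => j _; apply: H; exact: nc_omegaX.
Qed.

Lemma mean_geom N (q : R[i]) : (0 < N)%N -> q ^+ N = 1 ->
  \sum_(j < N) q ^+ j = if q == 1 then N%:R else 0.
Proof.
move=> N0 qN; case: eqVneq => [->|q1].
  by rewrite (eq_bigr (fun=> 1)) ?sumr_const ?card_ord // => i _; rewrite expr1n.
have /eqP := subrX1 q N; rewrite qN subrr eq_sym mulf_eq0 subr_eq0 (negbTE q1).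
by move/eqP.
Qed.

(** Orthogonality of the characters of a finite cyclic group. *)
Lemma mean_monomial N l k : (l < N)%N -> (k < N)%N ->
  mean N (fun w => w ^+ l * w ^- k) = (l == k)%:R.
Proof.
move=> lN kN; have N0 : (0 < N)%N by apply: leq_trans lN.
pose q := omega N ^+ l / omega N ^+ k.
have -> : mean N (fun w => w ^+ l * w ^- k) = N%:R^-1 * \sum_(j < N) q ^+ j.
  congr (_ * _); apply: eq_bigr => j _.
  by rewrite /q expr_div_n -!exprM mulnC (mulnC j k).
rewrite mean_geom //; last first.
  by rewrite expr_div_n -!exprM ![(_ * N)%N]mulnC !exprM omega_exprN // !expr1n divr1.
have -> : (q == 1) = (l == k).
  rewrite /q; case: (ltngtP l k) => [lk|kl|->]; last by rewrite divff ?eqxx ?omega_neq0.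
    apply/negbTE/eqP => /(congr1 (fun x => x^-1)).
    rewrite invf_div invr1 -{1}(subnK (ltnW lk)) exprD mulfK ?omega_neq0 //.
    by apply/eqP/omega_expr_neq1; rewrite subn_gt0 lk /= (leq_ltn_trans (leq_subr _ _)).
  rewrite -{1}(subnK (ltnW kl)) exprD mulfK ?omega_neq0 //.
  apply/negbTE/omega_expr_neq1; by rewrite subn_gt0 kl /= (leq_ltn_trans (leq_subr _ _)).
by case: eqP => _; rewrite ?mulVf ?mulr0 ?natC_neq0.
Qed.

Lemma mean_coef N k (t : R[i]) (c : nat -> R[i]) : (k < N)%N ->
  mean N (fun w => (\sum_(l < N) c l * (t * w) ^+ l) * w ^- k) = c k * t ^+ k.
Proof.
move=> kN.
rewrite (@eq_mean _ _ (fun w => \sum_(l < N) (c l * t ^+ l) * (w ^+ l * w ^- k))).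
  rewrite mean_sum (bigD1 (Ordinal kN)) //= big1 ?addr0.
    by rewrite meanZ mean_monomial // eqxx mulr1.
  move=> l lk; rewrite meanZ mean_monomial //.
  by rewrite (_ : (_ == _ :> nat) = false) ?mulr0 //; apply/negbTE.
move=> w _; rewrite mulr_suml; apply: eq_bigr => l _.
by rewrite exprMn; ring.
Qed.

Lemma poly_coef_mean (p : {poly R[i]}) N k t : (size p <= N)%N -> (k < N)%N ->
  mean N (fun w => p.[t * w] * w ^- k) = p`_k * t ^+ k.
Proof.
move=> sp kN; rewrite -(mean_coef t (fun l => p`_l) kN).
by apply: eq_mean => w _; rewrite (horner_coef_wide _ sp).
Qed.

(** Cauchy's estimate: a coefficient is a mean of values over the circle. *)
Lemma poly_coef_bound (p : {poly R[i]}) (r M : R) k : 0 < r ->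
  (forall w, nc w = r -> nc p.[w] <= M) -> nc p`_k <= M / r ^+ k.
Proof.
move=> r0 H; rewrite ler_pdivlMr ?exprn_gt0 //.
pose N := maxn (size p) k.+1.
have -> : nc p`_k * r ^+ k = nc (p`_k * r%:C ^+ k).
  by rewrite ncM ncX nc_real gtr0_norm.
rewrite -(@poly_coef_mean p N k) ?leq_maxl ?leq_maxr //.
apply: mean_le => [|w w1]; first by rewrite (leq_trans _ (leq_maxr _ _)).
rewrite ncM ncV ncX w1 expr1n invr1 mulr1; apply: H.
by rewrite ncM w1 nc_real gtr0_norm ?mulr1.
Qed.

Lemma geom_tail (s : R) K n : 0 <= s -> s < 1 ->
  \sum_(K <= k < n) s ^+ k <= s ^+ K / (1 - s).
Proof.
move=> s0 s1; have s1' : 0 < 1 - s by lra.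
case: (leqP n K) => [nK|Kn].
  by rewrite big_geq // divr_ge0 ?exprn_ge0 // ltW.
rewrite -[K]add0n big_addn.
have -> : \sum_(0 <= i < n - K) s ^+ (i + K) = s ^+ K * \sum_(i < n - K) s ^+ i.
  by rewrite big_mkord mulr_sumr; apply: eq_bigr => i _; rewrite exprD mulrC.
rewrite add0n ler_wpM2l ?exprn_ge0 // -[leRHS]mul1r ler_pdivlMr // mulrC.
have := subrX1 s (n - K); have := exprn_ge0 (n - K) s0; set S := \sum_(_ < _) _.
lra.
Qed.

Lemma poly_remainder (p : {poly R[i]}) (r M : R) K w : 0 < r ->
  (forall w, nc w = r -> nc p.[w] <= M) -> nc w < r ->
  nc (p.[w] - \sum_(k < K) p`_k * w ^+ k) <= M * (nc w / r) ^+ K / (1 - nc w / r).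
Proof.
move=> r0 H wr.
have M0 : 0 <= M.
  apply: le_trans (H r%:C _); rewrite ?nc_ge0 //; by rewrite nc_real gtr0_norm.
pose n := maxn K (size p).
rewrite (@horner_coef_wide _ n) ?leq_maxr //.
rewrite -(big_mkord predT (fun k => p`_k * w ^+ k)).
rewrite -(big_mkord predT (fun k => p`_k * w ^+ k)).
rewrite [X in nc (X - _)](big_cat_nat (n := K)) ?leq_maxl //= [X in nc X]addrC addKr.
apply: le_trans (nc_sum _ _ _) _.
apply: le_trans (_ : _ <= \sum_(K <= k < n) M * (nc w / r) ^+ k) _.
  apply: ler_sum => k _; rewrite ncM ncX expr_div_n mulrA.
  rewrite -mulrAC ler_wpM2r ?exprn_ge0 ?nc_ge0 //; exact: poly_coef_bound.
rewrite -mulr_sumr -mulrA ler_wpM2l // geom_tail ?divr_ge0 ?nc_ge0 ?ltW //.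
by rewrite ltr_pdivrMr // mul1r.
Qed.

End RootsOfUnityMeans.

(** * Limits and power series *)

Section PowerSeries.
Variable R : realType.
Implicit Types (z w : R[i]) (f g : R[i] -> R[i]).

Definition climit (u : nat -> R[i]) (l : R[i]) : Prop :=
  forall e : R, 0 < e -> exists N, forall n, (N <= n)%N -> nc (u n - l) <= e.

Lemma climit_cst l : climit (fun=> l) l.
Proof. by move=> e e0; exists 0%N => n _; rewrite subrr nc0 ltW. Qed.

Lemma climitD u v l m : climit u l -> climit v m ->
  climit (fun n => u n + v n) (l + m).
Proof.
move=> Hu Hv e e0.
have [N1 H1] := Hu (e / 2) ltac:(lra); have [N2 H2] := Hv (e / 2) ltac:(lra).
exists (maxn N1 N2) => n; rewrite geq_max => /andP[/H1 h1 /H2 h2].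
have -> : u n + v n - (l + m) = (u n - l) + (v n - m) by ring.
apply: le_trans (ncD _ _) _; lra.
Qed.

Lemma climitZ c u l : climit u l -> climit (fun n => c * u n) (c * l).
Proof.
move=> Hu e e0; have c0 : 0 < nc c + 1 by have := nc_ge0 c; lra.
have [N H] := Hu (e / (nc c + 1)) ltac:(by rewrite divr_gt0).
exists N => n /H; rewrite -mulrBr ncM ler_pdivlMr // => h.
apply: le_trans h; rewrite mulrC ler_wpM2l ?nc_ge0 //; lra.
Qed.

Lemma climitB u v l m : climit u l -> climit v m ->
  climit (fun n => u n - v n) (l - m).
Proof.
move=> Hu Hv; have := climitD Hu (climitZ (-1) Hv).
rewrite mulN1r => H e /H [N HN]; exists N => n /HN; by rewrite mulN1r.
Qed.

Lemma climit_sum K (u : nat -> nat -> R[i]) (l : nat -> R[i]) :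
  (forall k, climit (u k) (l k)) ->
  climit (fun n => \sum_(k < K) u k n) (\sum_(k < K) l k).
Proof.
move=> H; elim: K => [|K IH].
  rewrite big_ord0 => e e0; exists 0%N => n _.
  by rewrite big_ord0 subrr nc0 ltW.
have H1 := climitD IH (H K); rewrite big_ord_recr /= => e /H1 [N HN].
by exists N => n /HN; rewrite big_ord_recr.
Qed.

Lemma climit_le u l (B : R) : climit u l ->
  (forall e : R, 0 < e -> exists N, forall n, (N <= n)%N -> nc (u n) <= B + e) ->
  nc l <= B.
Proof.
move=> Hu HB; apply: le_addeps => e e0.
have [N1 H1] := Hu (e / 2) ltac:(lra); have [N2 H2] := HB (e / 2) ltac:(lra).
have h1 := H1 _ (leq_maxl N1 N2); have h2 := H2 _ (leq_maxr N1 N2).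
move: h1 h2; set v := u _ => h1 h2.
have -> : l = v + (l - v) by ring.
apply: le_trans (ncD _ _) _; move: h1; rewrite ncB; lra.
Qed.

Lemma climit_uniq u l m : climit u l -> climit u m -> l = m.
Proof.
move=> Hl Hm; apply/eqP; rewrite -subr_eq0; apply/eqP; apply: nc_eq0P => e e0.
apply: (climit_le (climitB (climit_cst l) Hm)) => e' e'0.
have [N H] := Hl (e + e') ltac:(lra); exists N => n /H; by rewrite ncB.
Qed.

Lemma inv_nat_small (e : R) : 0 < e ->
  exists N, forall n, (N <= n)%N -> n.+1%:R^-1 <= e.
Proof.
move=> e0; exists (Num.truncn e^-1).+1 => n Hn.
rewrite invf_ple ?posrE ?ltr0n //; apply: le_trans (ltW (truncnS_gt _)) _.
by rewrite ler_nat ltnW // ltnS.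
Qed.

Lemma expr_small (s e : R) : 0 <= s -> s < 1 -> 0 < e ->
  exists N, forall n, (N <= n)%N -> s ^+ n <= e.
Proof.
move=> s0 s1 e0.
have : s ^+ n @[n --> \oo] --> 0 by apply: cvg_expr; rewrite ger0_norm.
move/cvgrPdist_le => /(_ e e0) [N _ H]; exists N => n /H /=.
by rewrite sub0r normrN ger0_norm ?exprn_ge0.
Qed.

(** [a] is the coefficient sequence of [f] on the disc of radius [r]. The rate
    of convergence is that of a geometric series, so that every later passage
    to the limit is uniform. *)
Definition has_exp f (a : nat -> R[i]) (M r : R) : Prop :=
  (forall k, nc (a k) <= M / r ^+ k) /\
  forall K w, nc w < r ->
    nc (f w - \sum_(k < K) a k * w ^+ k) <= M * (nc w / r) ^+ K / (1 - nc w / r).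

(** By Cauchy's estimates the coefficients of the approximating polynomials
    form Cauchy sequences; the remainder estimates for polynomials pass to the
    limit. *)
Lemma exp_of_approx f (M r : R) : 0 < r ->
  (forall w, nc w <= r -> nc (f w) <= M) ->
  (forall e : R, 0 < e -> exists p : {poly R[i]}, forall w, nc w <= r ->
     nc (f w - p.[w]) <= e) ->
  exists a, has_exp f a M r.
Proof.
move=> r0 fM app.
have /choice[p Hp] : forall m : nat, exists p : {poly R[i]}, forall w,
    nc w <= r -> nc (f w - p.[w]) <= m.+1%:R^-1.
  by move=> m; apply: app; rewrite invr_gt0 ltr0n.
have pM m w : nc w <= r -> nc (p m).[w] <= M + m.+1%:R^-1.
  move=> wr; have -> : (p m).[w] = f w + - (f w - (p m).[w]) by ring.
  by apply: le_trans (ncD _ _) _; rewrite ncN lerD ?fM ?Hp.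
have /choice[a Ha] : forall k, exists l, climit (fun m => (p m)`_k) l.
  move=> k; apply: C_cauchy => e e0.
  have [N HN] := inv_nat_small (e := e * r ^+ k / 2)
    ltac:(by rewrite divr_gt0 // mulr_gt0 // exprn_gt0).
  exists N => m n Nm Nn; rewrite -coefB.
  apply: le_trans (@poly_coef_bound _ (p m - p n) r (e * r ^+ k) k r0 _) _.
    move=> w wr; rewrite hornerD hornerN.
    apply: le_trans (nc_subD _ (f w) _) _; rewrite ncB.
    have := Hp m w; have := Hp n w; rewrite wr lexx => /(_ isT) h1 /(_ isT) h2.
    apply: le_trans (lerD h2 h1) _; rewrite [leRHS]splitr.
    by rewrite lerD ?HN.
  by rewrite mulfK // expf_neq0 // gt_eqF.
exists a; split=> [k|K w wr].
  apply: (climit_le (Ha k)) => e e0.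
  have [N HN] := inv_nat_small (e := e * r ^+ k) ltac:(by rewrite mulr_gt0 // exprn_gt0).
  exists N => n /HN Nn.
  apply: le_trans (@poly_coef_bound _ (p n) r (M + n.+1%:R^-1) k r0 _) _.
    by move=> z zr; apply: pM; rewrite zr.
  by rewrite mulrDl lerD2l ler_pdivrMr // exprn_gt0.
set q := nc w / r.
have q0 : 0 <= q by rewrite divr_ge0 ?nc_ge0 // ltW.
have q1 : 0 < 1 - q by rewrite subr_gt0 ltr_pdivrMr // mul1r.
have Q0 : 0 <= q ^+ K / (1 - q) by rewrite divr_ge0 ?exprn_ge0 // ltW.
set Q := q ^+ K / (1 - q) in Q0.
have HS : climit (fun m => f w - \sum_(k < K) (p m)`_k * w ^+ k)
                 (f w - \sum_(k < K) a k * w ^+ k).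
  apply: climitB (climit_cst _) _; apply: (@climit_sum K (fun k m => (p m)`_k * w ^+ k) (fun k => a k * w ^+ k)) => k.
  have := climitZ (w ^+ k) (Ha k) => H e /H [N HN]; exists N => n /HN.
  by rewrite ![w ^+ k * _]mulrC.
apply: (climit_le HS) => e e0; rewrite -mulrA -/Q.
have [N HN] := inv_nat_small (e := e / (1 + Q)) ltac:(by rewrite divr_gt0 //; lra).
exists N => n /HN; rewrite ler_pdivlMr; last lra.
move=> Nn; apply: le_trans (nc_subD _ (p n).[w] _) _.
have h1 := Hp n w (ltW wr).
have h2 := @poly_remainder _ (p n) r (M + n.+1%:R^-1) K w r0
  (fun z zr => pM n z ltac:(by rewrite zr)) wr.
rewrite -mulrA -/q -/Q in h2.
move: h1 h2 Nn; set E := n.+1%:R^-1; lra.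
Qed.

Lemma exp_coef_mean f a M r (t : R) N k : has_exp f a M r -> 0 < t -> t < r ->
  0 <= M -> (k < N)%N ->
  nc (mean N (fun w => f (t%:C * w) * w ^- k) - a k * t%:C ^+ k)
    <= M * (t / r) ^+ N / (1 - t / r).
Proof.
move=> [_ H] t0 tr M0 kN; rewrite -(mean_coef t%:C a kN).
have N0 : (0 < N)%N by apply: leq_trans kN.
have -> : forall u v : R[i], u - v = u + (-1) * v by move=> u v; rewrite mulN1r.
rewrite -meanZ -meanD; apply: mean_le => // w w1.
have := H N (t%:C * w); rewrite ncM nc_real w1 mulr1 gtr0_norm // => /(_ tr).
by rewrite mulN1r -mulrBl ncM ncV ncX w1 expr1n invr1 mulr1.
Qed.

Lemma climit_geom (u : nat -> R[i]) l (C s : R) N0 : 0 <= C -> 0 <= s -> s < 1 ->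
  (forall N, (N0 <= N)%N -> nc (u N - l) <= C * s ^+ N) -> climit u l.
Proof.
move=> C0 s0 s1 H e e0.
have [N HN] := expr_small s0 s1 (e := e / (C + 1)) ltac:(by rewrite divr_gt0 //; lra).
exists (maxn N0 N) => n; rewrite geq_max => /andP[/H h /HN].
rewrite ler_pdivlMr; last lra.
move=> h2; have := exprn_ge0 n s0; lra.
Qed.

Lemma has_exp_M f a M r : 0 < r -> has_exp f a M r -> 0 <= M.
Proof.
by move=> r0 [H _]; have := H 0%N; rewrite expr0 divr1; apply: le_trans; rewrite nc_ge0.
Qed.

Lemma exp_climit f a M r (t : R) k : has_exp f a M r -> 0 < t -> t < r ->
  climit (fun N => mean N (fun w => f (t%:C * w) * w ^- k)) (a k * t%:C ^+ k).
Proof.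
move=> H t0 tr; have r0 := lt_trans t0 tr; have M0 := has_exp_M r0 H.
have s1 : t / r < 1 by rewrite ltr_pdivrMr // mul1r.
apply: (@climit_geom _ _ (M / (1 - t / r)) (t / r) k.+1) => //.
- by rewrite divr_ge0 // subr_ge0 ltW.
- by rewrite divr_ge0 // ltW.
move=> N kN; apply: le_trans (exp_coef_mean H t0 tr M0 kN) _.
by rewrite mulrAC.
Qed.

(** A coefficient is the limit of means over a single circle. *)
Lemma has_exp_uniq f g a b M r M' r' (t : R) : has_exp f a M r -> has_exp g b M' r' ->
  0 < t -> t < r -> t < r' -> (forall w, nc w = t -> f w = g w) -> a = b.
Proof.
move=> Ha Hb t0 tr tr' fg; apply/funext => k.
have t1 : t%:C ^+ k != 0 :> R[i].
  by rewrite expf_neq0 // -nc_gt0 nc_real gtr0_norm.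
apply: (mulIf t1); apply: climit_uniq (exp_climit k Ha t0 tr) _.
move=> e /(exp_climit k Hb t0 tr') [N HN]; exists N => n /HN.
rewrite (@eq_mean _ n (fun w => f (t%:C * w) * w ^- k) (fun w => g (t%:C * w) * w ^- k)) //.
by move=> w w1; rewrite fg // ncM nc_real w1 mulr1 gtr0_norm.
Qed.

Lemma has_exp0 f a M r : 0 < r -> has_exp f a M r -> a 0%N = f 0.
Proof.
move=> r0 H; have [_ /(_ 1%N 0)] := H; rewrite nc0 => /(_ r0).
rewrite mul0r expr1 mulr0 mul0r big_ord_recl big_ord0 expr0 mulr1 addr0 => h.
by apply/eqP; rewrite eq_sym -subr_eq0 -nc_eq0 eq_le h nc_ge0.
Qed.

End PowerSeries.

(** * Goursat's lemma *)

Section Goursat.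
Variable R : realType.
Implicit Types (a b c z w : R[i]) (f g : R[i] -> R[i]) (D : R[i] -> Prop).

Definition cdiff_with f z (d : R[i]) : Prop :=
  forall e : R, 0 < e -> exists2 del : R, 0 < del &
    forall h, nc h < del -> nc (f (z + h) - f z - d * h) <= e * nc h.

Definition mid a b : R[i] := (a + b) / 2.

(** Midpoint sums of the integral of [f] along the segment from [a] to [b] with
    [2 ^ m] steps; the recursion makes them exactly additive under bisection. *)
Fixpoint segsum f (m : nat) a b : R[i] :=
  if m is m'.+1 then segsum f m' a (mid a b) + segsum f m' (mid a b) b
  else (b - a) * f (mid a b).

Definition midconvex D := forall a b, D a -> D b -> D (mid a b).

Lemma midC a b : mid a b = mid b a. Proof. by rewrite /mid addrC. Qed.

Lemma nc_half z : nc (z / 2) = nc z / 2.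
Proof. by rewrite ncM ncV (nc_natr _ 2). Qed.

Lemma mid_subl a b : mid a b - a = (b - a) / 2.
Proof. by rewrite /mid; field. Qed.

Lemma mid_subr a b : b - mid a b = (b - a) / 2.
Proof. by rewrite /mid; field. Qed.

Lemma midconvex_disc c (r : R) : midconvex (fun z => nc (z - c) <= r).
Proof.
move=> a b ha hb; have -> : mid a b - c = (a - c) / 2 + (b - c) / 2.
  by rewrite /mid; field.
apply: le_trans (ncD _ _) _; rewrite !nc_half; lra.
Qed.

Lemma midconvexI D D' : midconvex D -> midconvex D' ->
  midconvex (fun z => D z /\ D' z).
Proof. by move=> h h' a b [] ? ? [] ? ?; split; [apply: h|apply: h']. Qed.

Lemma segsum_anti f m a b : segsum f m b a = - segsum f m a b.
Proof.
elim: m a b => [|m IH] a b /=; first by rewrite midC -mulNr opprB.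
by rewrite (midC b a) (IH a) (IH _ b) -opprD addrC.
Qed.

Lemma segsum_bound D f m a b (B : R) : midconvex D -> D a -> D b ->
  (forall z, D z -> nc (f z) <= B) -> nc (segsum f m a b) <= B * nc (b - a).
Proof.
move=> mD Da Db fB; elim: m a b Da Db => [|m IH] a b Da Db /=.
  by rewrite ncM mulrC ler_wpM2r ?nc_ge0 // fB //; exact: mD.
apply: le_trans (ncD _ _) _.
have Dm : D (mid a b) by exact: mD.
have := IH _ _ Da Dm; have := IH _ _ Dm Db.
rewrite mid_subl mid_subr nc_half; lra.
Qed.

Lemma segsum_sub f g m a b :
  segsum (fun z => f z - g z) m a b = segsum f m a b - segsum g m a b.
Proof.
elim: m a b => [|m IH] a b /=; first by rewrite mulrBr.
by rewrite !IH; ring.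
Qed.

Lemma segsum_affine (al be : R[i]) m a b :
  segsum (fun z => al + be * z) m a b = al * (b - a) + be * (b ^+ 2 - a ^+ 2) / 2.
Proof.
elim: m a b => [|m IH] a b /=; last first.
  by rewrite !IH; field.
by rewrite /mid; field.
Qed.

Definition trisum f m a b c := segsum f m a b + segsum f m b c + segsum f m c a.

Lemma trisum_split f m a b c : trisum f m.+1 a b c =
  trisum f m a (mid a b) (mid c a) + trisum f m (mid a b) b (mid b c)
  + trisum f m (mid c a) (mid b c) c + trisum f m (mid b c) (mid c a) (mid a b).
Proof.
rewrite /trisum /= (segsum_anti f m (mid a b) (mid c a)).
rewrite (segsum_anti f m (mid b c) (mid a b)) (segsum_anti f m (mid c a) (mid b c)).
by ring.
Qed.

Lemma trisum_affine (al be : R[i]) m a b c :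
  trisum (fun z => al + be * z) m a b c = 0.
Proof. by rewrite /trisum !segsum_affine; field. Qed.

Lemma trisum_sub f g m a b c :
  trisum (fun z => f z - g z) m a b c = trisum f m a b c - trisum g m a b c.
Proof. by rewrite /trisum !segsum_sub; ring. Qed.

Definition per a b c : R := nc (b - a) + nc (c - b) + nc (a - c).

Lemma trisum_bound D f m a b c (B : R) : midconvex D -> D a -> D b -> D c ->
  (forall z, D z -> nc (f z) <= B) -> nc (trisum f m a b c) <= B * per a b c.
Proof.
move=> mD Da Db Dc fB; rewrite /trisum /per.
apply: le_trans (ncD _ _) _; rewrite mulrDr; apply: lerD.
  apply: le_trans (ncD _ _) _; rewrite mulrDr.
  by apply: lerD; apply: (segsum_bound (D := D)).
by apply: (segsum_bound (D := D)).
Qed.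

Definition child (t t' : R[i] * R[i] * R[i]) : Prop :=
  let: (a, b, c) := t in
  [\/ t' = (a, mid a b, mid c a), t' = (mid a b, b, mid b c),
      t' = (mid c a, mid b c, c) | t' = (mid b c, mid c a, mid a b)].

Definition per3 t := let: (a, b, c) := t in per a b c.
Definition tri3 f m t := let: (a, b, c) := t in trisum f m a b c.
Definition in3 D t : Prop := let: (a, b, c) := t in [/\ D a, D b & D c].

Lemma per_ge0 a b c : 0 <= per a b c.
Proof. by rewrite !addr_ge0 ?nc_ge0. Qed.

Lemma child_per t t' : child t t' -> per3 t' = per3 t / 2.
Proof.
case: t => [[a b] c] /= H.
have h1 x y : nc (mid x y - x) = nc (y - x) / 2 by rewrite mid_subl nc_half.
have h2 x y : nc (y - mid x y) = nc (y - x) / 2 by rewrite mid_subr nc_half.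
have h1' x y : nc (x - mid x y) = nc (y - x) / 2 by rewrite ncB.
have h2' x y : nc (mid x y - y) = nc (y - x) / 2 by rewrite ncB.
have h3 x y z : nc (mid x y - mid y z) = nc (x - z) / 2.
  by rewrite -nc_half; congr nc; rewrite /mid; field.
have h4 x y z : nc (mid y z - mid x y) = nc (x - z) / 2 by rewrite ncB.
by case: H => ->; rewrite /= /per ?(h1, h2, h1', h2', h3, h4) //; field.
Qed.

Lemma child_in D t t' : midconvex D -> child t t' -> in3 D t -> in3 D t'.
Proof.
by case: t => [[a b] c] mD /= + [Da Db Dc]; case=> ->; split=> //; exact: mD.
Qed.

Lemma child_fst t t' : child t t' -> nc (t'.1.1 - t.1.1) <= per3 t.
Proof.
case: t => [[a b] c] /= H; have p0 := per_ge0 a b c.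
have := nc_ge0 (b - a); have := nc_ge0 (c - b); have := nc_ge0 (a - c).
case: H => -> /=; rewrite ?subrr ?nc0 // ?mid_subl ?nc_half ?mid_subr.
- rewrite /per; lra.
- by rewrite midC mid_subl nc_half (ncB c a) /per; lra.
have -> : mid b c - a = (b - a) / 2 - (a - c) / 2.
  by rewrite /mid; field.
move=> h1 h2 h3; apply: le_trans (ncD _ _) _; rewrite ncN !nc_half /per; lra.
Qed.

(** Goursat's lemma: if the sums over the boundary stayed large compared with
    the squared perimeter, bisection would produce shrinking triangles with the
    same defect around a point where [f] is affine up to first order. *)
Lemma goursat f (r : R) a b c : (forall z, nc z <= r -> exists d, cdiff_with f z d) ->
  nc a <= r -> nc b <= r -> nc c <= r ->
  climit (fun m => trisum f m a b c) 0.
Proof.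
move=> df ar br cr; apply: contrapT => ncl.
have [e0 e00 H0] : exists2 e : R, 0 < e &
    forall N, exists2 m, (N <= m)%N & e < nc (trisum f m a b c).
  apply: contrapT => nex; apply: ncl => e epos; apply: contrapT => nN.
  apply: nex; exists e => // N; apply: contrapT => nm; apply: nN.
  exists N => m Nm; rewrite subr0 leNgt; apply/negP => lt; apply: nm.
  by exists m.
pose bad (e : R) t := forall N, exists2 m, (N <= m)%N & e * per3 t ^+ 2 < nc (tri3 f m t).
pose D z := nc (z - 0) <= r.
have mD : midconvex D by exact: midconvex_disc.
have Dabc : in3 D (a, b, c) by rewrite /= /D !subr0.
have p0 := per_ge0 a b c.
(* Bisection divides the squared perimeter by four, and the defect is shared
   among four triangles. *)
pose e := e0 / (per a b c ^+ 2 + 1).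
have q0 : 0 < per a b c ^+ 2 + 1 by have := sqr_ge0 (per a b c); lra.
have e_gt0 : 0 < e by rewrite divr_gt0.
have bad0 : bad e (a, b, c).
  move=> N; have [m Nm Hm] := H0 N; exists m => //=; apply: le_lt_trans Hm.
  by rewrite /e mulrAC ler_pdivrMr // ler_wpM2l ?(ltW e00) // lerDl ler01.
have step t : bad e t -> exists t', child t t' /\ bad e t'.
  case: t => [[x y] z] Hb; apply: contrapT => nex.
  have good t' : child (x, y, z) t' -> exists N, forall m, (N <= m)%N ->
      nc (tri3 f m t') <= e * (per x y z / 2) ^+ 2.
    move=> ct; apply: contrapT => nN; apply: nex; exists t'; split=> // N.
    apply: contrapT => nm; apply: nN; exists N => m Nm; rewrite leNgt; apply/negP => lt.
    by apply: nm; exists m => //; rewrite (child_per ct).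
  have [N1 H1] := good _ (Or41 _ _ _ (erefl _)).
  have [N2 H2] := good _ (Or42 _ _ _ (erefl _)).
  have [N3 H3] := good _ (Or43 _ _ _ (erefl _)).
  have [N4 H4] := good _ (Or44 _ _ _ (erefl _)).
  have [[//|m]] := Hb (maxn (maxn N1 N2) (maxn N3 N4)).+1.
  rewrite ltnS !geq_max => /andP[/andP[/H1 h1 /H2 h2] /andP[/H3 h3 /H4 h4]].
  rewrite ltNge => /negP; apply; move: h1 h2 h3 h4 => /=.
  rewrite trisum_split => h1 h2 h3 h4.
  apply: le_trans (ncD _ _) _; move: h4; set E := e * (_ / 2) ^+ 2 => h4.
  have -> : e * per x y z ^+ 2 = E + E + E + E by rewrite /E; field.
  apply: lerD => //; apply: le_trans (ncD _ _) _; apply: lerD => //.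
  by apply: le_trans (ncD _ _) _; apply: lerD.
have /choice[nxt Hn] : forall t, exists t', bad e t -> child t t' /\ bad e t'.
  move=> t; case: (pselect (bad e t)) => [/step [t' ?]|nb]; last by exists t.
  by exists t'.
pose s n := iter n nxt (a, b, c).
have sbad n : bad e (s n) by elim: n => //= n /Hn [].
have schild n : child (s n) (s n.+1) by have [] := Hn _ (sbad n).
have sin n : in3 D (s n) by elim: n => // n; exact: child_in (schild n).
pose P := per a b c.
have sper n : per3 (s n) = P * 2^-1 ^+ n.
  elim: n => [|n IH]; first by rewrite expr0 mulr1.
  by rewrite (child_per (schild n)) IH exprS; field.
pose v n := (s n).1.1.
have vstep n k : nc (v (n + k)%N - v n) <= 2 * P * 2^-1 ^+ n * (1 - 2^-1 ^+ k).
  elim: k => [|k IH]; first by rewrite addn0 subrr nc0 expr0 subrr mulr0.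
  apply: le_trans (nc_subD _ (v (n + k)%N) _) _; rewrite addnS.
  have := child_fst (schild (n + k)%N); rewrite sper exprD => h.
  apply: le_trans (lerD h IH) _.
  rewrite le_eqVlt; apply/orP; left; apply/eqP; rewrite exprS; by field.
have v2 n k : nc (v (n + k)%N - v n) <= 2 * P * 2^-1 ^+ n.
  apply: le_trans (vstep n k) _; rewrite ler_piMr //.
    by rewrite !mulr_ge0 // exprn_ge0.
have vgeom (x : R) : 0 < x -> exists N, forall n, (N <= n)%N -> P * 2^-1 ^+ n <= x.
  move=> x0; have P1 : 0 < P + 1 by rewrite /P; lra.
  have [//||//|N HN] := @expr_small _ 2^-1 (x / (P + 1)); rewrite ?divr_gt0 //; first lra.
  exists N => n /HN; rewrite ler_pdivlMr // => h.
  have := exprn_ge0 n (x := 2^-1 : R) ltac:(by []); lra.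
have [p Hp] : exists p, climit v p.
  apply: C_cauchy => x x0; have [N HN] := vgeom (x / 4) ltac:(lra).
  exists N => m n Nm Nn; apply: le_trans (nc_subD _ (v N) _) _.
  have := v2 N (m - N)%N; have := v2 N (n - N)%N; rewrite !subnKC //.
  have := HN N (leqnn N); rewrite (ncB (v N)); lra.
have vp n : nc (p - v n) <= 2 * P * 2^-1 ^+ n.
  apply: (climit_le (climitB Hp (climit_cst (v n)))) => x x0; exists n => m nm.
  have := v2 n (m - n)%N; rewrite subnKC //; lra.
have pr : nc p <= r.
  apply: (climit_le Hp) => x x0; exists 0%N => n _.
  have : D (v n) by have := sin n; rewrite /v; case: (s n) => [[? ?] ?] /= [].
  rewrite /D subr0; lra.
have [d Hd] := df p pr.
have [del del0 Hdel] := Hd (e / 3) ltac:(by rewrite divr_gt0).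
have [N HN] := vgeom (del / 6) ltac:(by rewrite divr_gt0).
have [m _] := sbad N 0%N; rewrite ltNge => /negP; apply.
have := HN N (leqnn N); have := vp N; have := sper N; rewrite /v.
case: (s N) => [[x y] z] /= sp pv Pd.
pose al := f p - d * p.
have -> : trisum f m x y z = trisum (fun w => f w - (al + d * w)) m x y z.
  by rewrite trisum_sub trisum_affine subr0.
set q := per x y z in sp *.
have -> : e * q ^+ 2 = e / 3 * (3 * q) * q by field.
apply: (@trisum_bound (fun w => nc (w - p) <= 3 * q)).
- exact: midconvex_disc.
- rewrite ncB; rewrite -mulrA -sp in pv; have := per_ge0 x y z; rewrite -/q; lra.
- apply: le_trans (nc_subD _ x _) _; rewrite (ncB x).
  move: pv; rewrite -mulrA -sp /q /per.
  have := nc_ge0 (z - y); have := nc_ge0 (x - z); lra.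
- apply: le_trans (nc_subD _ x _) _.
  move: pv; rewrite -mulrA -sp /q /per (ncB z x) (ncB p).
  have := nc_ge0 (y - x); have := nc_ge0 (z - y); lra.
move=> w wp; have := Hdel (w - p).
rewrite (_ : nc (w - p) < del); last by apply: le_lt_trans wp _; rewrite sp; lra.
have -> : p + (w - p) = w by ring.
move=> /(_ isT); rewrite /al.
have -> : f w - f p - d * (w - p) = f w - (f p - d * p + d * w) by ring.
by move=> h; apply: le_trans h _; rewrite ler_wpM2l // ltW // divr_gt0.
Qed.
End Goursat.

(** * Approximation by polynomials on a disc *)

Section Runge.
Variable R : realType.
Implicit Types (a b c z w : R[i]) (f g F : R[i] -> R[i]) (D : R[i] -> Prop).

Lemma cdiff_continuous f z d : cdiff_with f z d -> forall e : R, 0 < e ->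
  exists2 del : R, 0 < del & forall y, nc (y - z) < del -> nc (f y - f z) <= e.
Proof.
move=> Hd e e0; have [del del0 H] := Hd 1 ltr01.
have d1 : 0 < nc d + 1 by have := nc_ge0 d; lra.
exists (Num.min del (e / (nc d + 1))); first by rewrite lt_min del0 divr_gt0.
move=> y; rewrite lt_min ltr_pdivlMr // => /andP[/H h1 h2].
have e1 : z + (y - z) = y by ring.
rewrite e1 mul1r in h1.
have -> : f y - f z = (f y - f z - d * (y - z)) + d * (y - z) by ring.
apply: le_trans (ncD _ _) _; rewrite ncM; lra.
Qed.

Lemma disc_unif_cont f (r : R) : (forall z, nc z <= r -> exists d, cdiff_with f z d) ->
  forall e : R, 0 < e -> exists2 del : R, 0 < del &
    forall z y, nc z <= r -> nc y <= r -> nc (y - z) < del -> nc (f y - f z) <= e.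
Proof.
move=> df e e0.
have [||del del0 H] := @disc_gauge R r
  (fun z d => forall y, nc y <= r -> nc (y - z) < d -> nc (f y - f z) <= e).
- move=> x d d' H d'0 d'd y yr yx; apply: H => //; exact: lt_le_trans d'd.
- move=> x xr; have [d Hd] := df x xr.
  have [del del0 H] := cdiff_continuous Hd (e := e / 2) ltac:(lra).
  exists (del / 2) => [|z zr zx y yr yz]; first lra.
  have h1 : nc (f z - f x) <= e / 2 by apply: H; lra.
  have h2 : nc (f y - f x) <= e / 2.
    by apply: H; apply: le_lt_trans (nc_subD _ z _) _; lra.
  apply: le_trans (nc_subD _ (f x) _) _; rewrite (ncB (f x)); lra.
by exists del => // z y zr; apply: H.
Qed.

Lemma segsum_near_cst D f m a b c (eta : R) : midconvex D -> D a -> D b ->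
  (forall z, D z -> nc (f z - f c) <= eta) ->
  nc (segsum f m a b - f c * (b - a)) <= eta * nc (b - a).
Proof.
move=> mD Da Db H.
have -> : segsum f m a b - f c * (b - a) = segsum (fun z => f z - (f c + 0 * z)) m a b.
  by rewrite segsum_sub segsum_affine !mul0r addr0.
by apply: (segsum_bound (D := D)) => // z /H; rewrite mul0r addr0.
Qed.

(** Uniform continuity of [f] makes its midpoint sums a Cauchy sequence. *)
Lemma segsum_refine D f (del eta : R) k m a b : midconvex D -> D a -> D b ->
  (forall z y, D z -> D y -> nc (y - z) < del -> nc (f y - f z) <= eta) ->
  nc (b - a) < del * 2 ^+ m ->
  nc (segsum f (m + k) a b - segsum f m a b) <= eta * nc (b - a).
Proof.
move=> mD Da Db H; elim: m a b Da Db => [|m IH] a b Da Db ab.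
  rewrite add0n /= [X in _ - X]mulrC; rewrite expr0 mulr1 in ab.
  apply: (@segsum_near_cst (fun z => D z /\ nc (z - mid a b) <= nc (b - a) / 2)).
  - by apply: midconvexI => //; exact: midconvex_disc.
  - by split=> //; rewrite ncB mid_subl nc_half.
  - by split=> //; rewrite mid_subr nc_half.
  move=> z [Dz hz]; apply: H => //; first exact: mD.
  by apply: le_lt_trans hz _; have := nc_ge0 (b - a); lra.
rewrite addSn /=.
have Dm : D (mid a b) by exact: mD.
have h1 : nc (mid a b - a) < del * 2 ^+ m.
  by rewrite mid_subl nc_half; move: ab; rewrite exprS; lra.
have h2 : nc (b - mid a b) < del * 2 ^+ m.
  by rewrite mid_subr nc_half; move: ab; rewrite exprS; lra.
have := IH _ _ Da Dm h1; have := IH _ _ Dm Db h2.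
rewrite mid_subl mid_subr nc_half.
set A := segsum _ _ _ _; set B := segsum _ _ _ _; set A' := segsum _ _ _ _.
set B' := segsum _ _ _ _ => k1 k2.
have -> : A' + A - (B' + B) = (A' - B') + (A - B) by ring.
apply: le_trans (ncD _ _) _; lra.
Qed.

(** The primitive is the limit of the midpoint sums along radii: by Goursat's
    lemma its increments are limits of sums along segments, which are
    uniformly close to [f z * (y - z)]. *)
Lemma primitive f (r : R) : 0 < r ->
  (forall z, nc z <= r -> exists d, cdiff_with f z d) ->
  exists F, forall eta : R, 0 < eta -> exists2 del : R, 0 < del &
    forall z y, nc z <= r -> nc y <= r -> nc (y - z) < del ->
      nc (F y - F z - f z * (y - z)) <= eta * nc (y - z).
Proof.
move=> r0 df; pose D z := nc (z - 0) <= r.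
have mD : midconvex D by exact: midconvex_disc.
have D0 : D 0 by rewrite /D subrr nc0 ltW.
have uc := disc_unif_cont df.
have /choice[F HF] : forall z, exists l, nc z <= r -> climit (fun m => segsum f m 0 z) l.
  move=> z; case: (leP (nc z) r) => zr; last by exists 0.
  have [l Hl] : exists l, climit (fun m => segsum f m 0 z) l; last by exists l.
  apply: C_cauchy => e e0.
  have [|del del0 Hdel] := uc (e / (2 * r)); first by rewrite divr_gt0 ?mulr_gt0.
  have [N HN] := expr_small (s := 2^-1) (e := del / (2 * r)) ltac:(by []) ltac:(lra)
    ltac:(by rewrite divr_gt0 ?mulr_gt0).
  have key k : nc (segsum f (N + k) 0 z - segsum f N 0 z) <= e / 2.
    apply: le_trans (segsum_refine (D := D) (eta := e / (2 * r)) (del := del) k mD D0 _ _ _) _.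
    - by rewrite /D subr0.
    - by move=> x y; rewrite /D !subr0; exact: Hdel.
    - rewrite subr0; have := HN N (leqnn N); rewrite exprVn ler_pdivlMr ?mulr_gt0 //.
      rewrite mulrC ler_pdivrMr ?exprn_gt0 // => h; lra.
    rewrite subr0 mulrAC ler_pdivrMr ?mulr_gt0 //.
    have -> : e / 2 * (2 * r) = e * r by field.
    by rewrite ler_wpM2l // ltW.
  exists N => m n Nm Nn; apply: le_trans (nc_subD _ (segsum f N 0 z) _) _.
  rewrite (ncB (segsum f N 0 z)).
  have := key (m - N)%N; have := key (n - N)%N; rewrite !subnKC //; lra.
exists F => eta eta0; have [del del0 Hdel] := uc eta eta0.
exists del => // z y zr yr yz.
have lim : climit (fun m => segsum f m z y) (F y - F z).
  have h := climitD (goursat df (_ : nc 0 <= r) zr yr) (climitB (HF y yr) (HF z zr)).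
  rewrite add0r in h; have {}h := h ltac:(by rewrite nc0 ltW).
  move=> e /h [N HN]; exists N => n /HN; congr (nc (_ - _) <= e).
  by rewrite /trisum (segsum_anti f n 0 y); by ring.
apply: (climit_le (climitB lim (climit_cst (f z * (y - z))))) => e e0.
exists 0%N => m _; apply: ler_wpDr; first exact: ltW.
apply: (@segsum_near_cst (fun x => D x /\ nc (x - z) <= nc (y - z))).
- by apply: midconvexI => //; exact: midconvex_disc.
- by rewrite /D subr0 subrr nc0 nc_ge0.
- by rewrite /D subr0.
move=> x [Dx xz]; apply: Hdel => //; last exact: le_lt_trans xz _.
by move: Dx; rewrite /D subr0.
Qed.

Lemma eq_mean_root N f g : (forall w, nc w = 1 -> w ^+ N = 1 -> f w = g w) ->
  mean N f = mean N g.
Proof.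
move=> H; congr (_ * _); apply: eq_bigr => -[j jN] _ /=; apply: H; first exact: nc_omegaX.
by rewrite -exprM mulnC exprM omega_exprN ?expr1n // (leq_trans _ jN).
Qed.

(** At an [N]-th root of unity [w] the Cauchy kernel becomes a polynomial in
    [b] after multiplication by the small perturbation [1 - b ^+ N] of [1]. *)
Lemma cauchy_kernel N b w : nc b < 1 -> nc w = 1 -> w ^+ N = 1 ->
  (w / (w - b)) * (1 - b ^+ N) = \sum_(k < N) b ^+ k * w ^- k.
Proof.
move=> b1 w1 wN.
have w0 : w != 0 by rewrite -nc_gt0 w1.
have wb : w - b != 0.
  rewrite -nc_gt0; have := nc_lowerD w (- b); rewrite ncN w1; lra.
have h : 1 - b ^+ N = (1 - b / w) * \sum_(k < N) (b / w) ^+ k.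
  have := subrX1 (b / w) N; rewrite expr_div_n wN divr1 => h.
  by rewrite -opprB h -mulNr opprB.
rewrite h mulrA; have -> : w / (w - b) * (1 - b / w) = 1 by field; rewrite w0.
by rewrite mul1r; apply: eq_bigr => k _; rewrite expr_div_n.
Qed.

(** Cauchy's theorem for a circle, in finite form: the differences of [F] over
    consecutive sample points telescope around the circle, and each is the
    derivative [f] times the step, up to a uniformly small relative error. *)
Lemma circle_mean_small F f (r del eta : R) N c (s : R) :
  (forall z y, nc z <= r -> nc y <= r -> nc (y - z) < del ->
      nc (F y - F z - f z * (y - z)) <= eta * nc (y - z)) ->
  (forall w, nc w = 1 -> nc (c + s%:C * w) <= r) -> 0 < s -> (1 < N)%N ->
  s * nc (omega R N - 1) < del ->
  nc (mean N (fun w => f (c + s%:C * w) * w)) <= eta.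
Proof.
move=> HF cr s0 N1 sd; have N0 : (0 < N)%N by exact: ltnW.
set om := omega R N in sd.
have om1 : om - 1 != 0 by rewrite subr_eq0 -[om]expr1 omega_expr_neq1.
pose zz j := c + s%:C * om ^+ j.
have zr j : nc (zz j) <= r by apply: cr; exact: nc_omegaX.
have zstep j : zz j.+1 - zz j = s%:C * om ^+ j * (om - 1) by rewrite /zz exprS; by ring.
have ncs : nc s%:C = s by rewrite nc_real gtr0_norm.
have nst j : nc (zz j.+1 - zz j) = s * nc (om - 1).
  by rewrite zstep !ncM ncs nc_omegaX mulr1.
have tel : \sum_(j < N) (F (zz j.+1) - F (zz j)) = 0.
  rewrite -(big_mkord predT (fun j => F (zz j.+1) - F (zz j))) telescope_sumr //.
  by rewrite /zz omega_exprN // expr0 subrr.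
have key : nc (\sum_(j < N) f (zz j) * (zz j.+1 - zz j)) <= N%:R * (eta * (s * nc (om - 1))).
  rewrite -ncN; set S := \sum_(j < N) _; rewrite -[- S]add0r -tel -sumrB.
  apply: le_trans (nc_sum _ _ _) _.
  rewrite mulr_natl -[in leRHS](card_ord N) -sumr_const; apply: ler_sum => j _.
  by rewrite -(nst j); apply: HF; rewrite ?nst.
have e1 : \sum_(j < N) f (zz j) * (zz j.+1 - zz j) =
          (s%:C * (om - 1)) * \sum_(j < N) f (zz j) * om ^+ j.
  by rewrite mulr_sumr; apply: eq_bigr => j _; rewrite zstep; by ring.
rewrite e1 !ncM ncs in key.
rewrite /mean ncM ncV nc_natr mulrC ler_pdivrMr ?ltr0n //.
have p0 : 0 < s * nc (om - 1) by rewrite mulr_gt0 // nc_gt0.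
by rewrite -(ler_pM2l p0); apply: le_trans key _; rewrite le_eqVlt; apply/orP; left; apply/eqP; by ring.
Qed.

(** Cauchy's formula: the weighted mean of [F] over the segments from [a] to
    the circle varies little as the segments are traversed. *)
Lemma cauchy_formula_approx F f (r eta : R) : 0 < r -> 0 < eta ->
  (forall e : R, 0 < e -> exists2 del : R, 0 < del &
    forall z y, nc z <= r -> nc y <= r -> nc (y - z) < del ->
      nc (F y - F z - f z * (y - z)) <= e * nc (y - z)) ->
  exists2 N, (0 < N)%N & forall a, nc a < r ->
    nc (mean N (fun w => F (r%:C * w) * (w / (w - a / r%:C)))
        - mean N (fun w => F a * (w / (w - a / r%:C)))) <= eta.
Proof.
move=> r0 eta0 HF.
have [|del del0 Hdel] := HF (eta / (2 * r)); first by rewrite divr_gt0 // mulr_gt0.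
set h := eta / (2 * r) in Hdel.
have hr : h * r = eta / 2 by rewrite /h; field; rewrite gt_eqF.
have [N1 HN1] := @omega_near1 R (del / r) ltac:(by rewrite divr_gt0).
pose N := maxn N1 2; have N0 : (1 < N)%N by rewrite leq_max orbT.
exists N; first exact: ltnW.
move=> a ar.
have [L0 HL0] := @inv_nat_small R (del / (4 * r)) ltac:(by rewrite divr_gt0 ?mulr_gt0).
pose L := L0.+1; have Lgt : (0 : R) < L%:R by rewrite ltr0n.
have HL : L%:R^-1 * (2 * r) < del.
  have := HL0 L0 (leqnn _); rewrite -/L ler_pdivlMr ?mulr_gt0 //; lra.
have rC : r%:C != 0 :> R[i] by rewrite -nc_gt0 nc_real gtr0_norm.
have ncr : nc r%:C = r by rewrite nc_real gtr0_norm.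
pose k w := w / (w - a / r%:C).
have kE w : nc w = 1 -> k w * (r%:C * w - a) = r%:C * w.
  move=> w1; rewrite /k; field; rewrite rC /=.
  rewrite -nc_gt0; have := nc_lowerD (w * r%:C) (- a); rewrite ncN ncM ncr w1; lra.
(* As [s] grows from 0 to 1 the sampled circle grows from the point [a] to the
   circle of radius [r]. *)
pose E (s : R) := mean N (fun w => F (a + s%:C * (r%:C * w - a)) * k w).
have inr (s : R) w : 0 <= s -> s <= 1 -> nc w = 1 -> nc (a + s%:C * (r%:C * w - a)) <= r.
  move=> s0 s1 w1.
  have -> : a + s%:C * (r%:C * w - a) = (1 - s)%:C * a + s%:C * (r%:C * w).
    by rewrite rmorphB rmorph1; by ring.
  apply: le_trans (ncD _ _) _; rewrite !ncM ncr w1 !nc_real !ger0_norm ?subr_ge0 //.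
  nra.
have step l : (l < L)%N -> nc (E (l.+1%:R / L%:R) - E (l%:R / L%:R)) <= eta / L%:R.
  move=> lL; set s := l%:R / L%:R; set s' := l.+1%:R / L%:R.
  have ss : s' - s = L%:R^-1 by rewrite /s /s' -natr1; field; rewrite gt_eqF.
  have s0 : 0 <= s by rewrite divr_ge0.
  have s'0 : 0 < s' by rewrite divr_gt0 // ltr0n.
  have s1 : s' <= 1 by rewrite ler_pdivrMr // mul1r ler_nat.
  have sle : s <= 1 by have : (0 : R) < L%:R^-1 by [rewrite invr_gt0]; lra.
  have Linv : (0 : R) < L%:R^-1 by rewrite invr_gt0.
  clearbody s s'.
  pose g w := a + s'%:C * (r%:C * w - a).
  pose err w := (F (a + s%:C * (r%:C * w - a)) - F (g w)
    - f (g w) * (a + s%:C * (r%:C * w - a) - g w)) * k w.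
  (* A mean of the derivative over a circle, which is small, and the error of
     linearization. *)
  have dec : E s' - E s = (L%:R^-1 * r)%:C * mean N (fun w => f (g w) * w) + (-1) * mean N err.
    rewrite -!meanZ /E.
    have -> : forall u v : R[i], u - v = u + (-1) * v by move=> u v; rewrite mulN1r.
    rewrite -meanZ -!meanD; apply: eq_mean => w w1.
    rewrite /err -/(g w).
    have -> : a + s%:C * (r%:C * w - a) - g w = - (L%:R^-1)%:C * (r%:C * w - a).
      by rewrite /g -ss rmorphB; by ring.
    have e2 := kE w w1.
    have -> : (L%:R^-1 * r)%:C = (L%:R^-1)%:C * r%:C by rewrite rmorphM.
    transitivity (F (g w) * k w - F (a + s%:C * (r%:C * w - a)) * k w); first by ring.
    transitivity ((L%:R^-1)%:C * (f (g w) * (k w * (r%:C * w - a))) + -1 *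
       ((F (a + s%:C * (r%:C * w - a)) - F (g w)) * k w
        + (L%:R^-1)%:C * f (g w) * (k w * (r%:C * w - a)))); first by ring.
    have -> : (L%:R^-1)%:C * r%:C * (f (g w) * w) =
        (L%:R^-1)%:C * (f (g w) * (k w * (r%:C * w - a))) by rewrite e2; by ring.
    by ring.
  have m1 : nc (mean N (fun w => f (g w) * w)) <= h.
    rewrite (@eq_mean _ N _ (fun w => f ((1 - s')%:C * a + (s' * r)%:C * w) * w)); last first.
      move=> w _; congr (f _ * w); rewrite /g rmorphB rmorph1 rmorphM; by ring.
    apply: (circle_mean_small Hdel) => //.
    - move=> w w1; suff -> : (1 - s')%:C * a + (s' * r)%:C * w = a + s'%:C * (r%:C * w - a).
        exact: inr (ltW s'0) s1 w1.
      by rewrite rmorphB rmorph1 rmorphM; by ring.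
    - by rewrite mulr_gt0.
    have := HN1 N (leq_maxl _ _); rewrite ltr_pdivlMr // => q.
    apply: le_lt_trans q; rewrite -mulrA [r * _]mulrC ler_piMl // mulr_ge0 ?nc_ge0 ?(ltW r0) //.
  have m2 : nc (mean N err) <= h * (L%:R^-1 * r).
    apply: mean_le; first exact: ltnW.
    move=> w w1; rewrite /err ncM.
    have hd : a + s%:C * (r%:C * w - a) - g w = - (L%:R^-1)%:C * (r%:C * w - a).
      by rewrite /g -ss rmorphB; by ring.
    have nhd : nc (a + s%:C * (r%:C * w - a) - g w) = L%:R^-1 * nc (r%:C * w - a).
      by rewrite hd mulNr ncN ncM nc_real gtr0_norm.
    have := Hdel (g w) (a + s%:C * (r%:C * w - a)).
    move=> /(_ (inr s' w (ltW s'0) s1 w1) (inr s w s0 sle w1)).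
    rewrite nhd => H.
    have {}H : nc (F (a + s%:C * (r%:C * w - a)) - F (g w)
        - f (g w) * (a + s%:C * (r%:C * w - a) - g w)) <= h * (L%:R^-1 * nc (r%:C * w - a)).
      apply: H; apply: le_lt_trans HL; rewrite ler_wpM2l ?(ltW Linv) //.
      by apply: le_trans (ncD _ _) _; rewrite ncN ncM ncr w1; lra.
    apply: le_trans (ler_wpM2r (nc_ge0 _) H) _.
    have := congr1 (@ComplexField.Normc.normc R) (kE w w1); rewrite !ncM ncr w1 mulr1 => e3.
    rewrite -[X in _ <= _ * (_ * X)]e3 le_eqVlt; apply/orP; left; apply/eqP; by ring.
  rewrite dec; apply: le_trans (ncD _ _) _; rewrite mulN1r ncN ncM nc_real gtr0_norm ?mulr_gt0 //.
  apply: le_trans (lerD (ler_wpM2l (ltW (mulr_gt0 Linv r0)) m1) m2) _.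
  have -> : eta / L%:R = L%:R^-1 * (2 * (h * r)) by rewrite hr; field; rewrite gt_eqF.
  by rewrite le_eqVlt; apply/orP; left; apply/eqP; by ring.
have tot l : (l <= L)%N -> nc (E (l%:R / L%:R) - E 0) <= l%:R * (eta / L%:R).
  elim: l => [|l IH] lL; first by rewrite !mul0r subrr nc0.
  apply: le_trans (nc_subD _ (E (l%:R / L%:R)) _) _.
  have -> : l.+1%:R * (eta / L%:R) = eta / L%:R + l%:R * (eta / L%:R).
    by rewrite -natr1 mulrDl mul1r addrC.
  by apply: lerD; [exact: step|exact: (IH (ltnW lL))].
have := tot L (leqnn L); rewrite divff ?gt_eqF // mulrC divfK ?gt_eqF //.
congr (nc (_ - _) <= eta).
  by apply: eq_mean => w _; rewrite mul1r addrC subrK.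
by apply: eq_mean => w _; rewrite mul0r addr0.
Qed.

(** With the samples taken at roots of unity, the right-hand side of Cauchy's
    formula is a polynomial in [a] up to the factor [1 - (a / r) ^+ N]. *)
Lemma primitive_approx F f (r e : R) : 0 < r -> 0 < e ->
  (forall eta : R, 0 < eta -> exists2 del : R, 0 < del &
    forall z y, nc z <= r -> nc y <= r -> nc (y - z) < del ->
      nc (F y - F z - f z * (y - z)) <= eta * nc (y - z)) ->
  exists p : {poly R[i]}, forall a, nc a < r -> nc (F a - p.[a]) <= e.
Proof.
move=> r0 e0 HF.
have [|N N0 H] := cauchy_formula_approx r0 (eta := e / 2) _ HF; first lra.
have rC : r%:C != 0 :> R[i] by rewrite -nc_gt0 nc_real gtr0_norm.
have ncr : nc r%:C = r by rewrite nc_real gtr0_norm.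
exists (\poly_(k < N) (mean N (fun w => F (r%:C * w) * w ^- k) / r%:C ^+ k)) => a ar.
set b := a / r%:C.
have b1 : nc b < 1 by rewrite /b ncM ncV ncr ltr_pdivrMr // mul1r.
have ker (G : R[i] -> R[i]) : (1 - b ^+ N) * mean N (fun w => G w * (w / (w - b))) =
    \sum_(k < N) b ^+ k * mean N (fun w => G w * w ^- k).
  rewrite -meanZ (@eq_mean_root N _ (fun w => \sum_(k < N) b ^+ k * (G w * w ^- k))).
    by rewrite mean_sum; apply: eq_bigr => k _; rewrite meanZ.
  move=> w w1 wN; transitivity (G w * (w / (w - b) * (1 - b ^+ N))); first by ring.
  by rewrite cauchy_kernel // mulr_sumr; apply: eq_bigr => k _; by ring.
have k1 : \sum_(k < N) b ^+ k * mean N (fun w => F a * w ^- k) = F a.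
  rewrite (bigD1 (Ordinal N0)) //= big1 => [|k k0].
    rewrite addr0 expr0 mul1r meanZ.
    rewrite (@eq_mean _ N _ (fun w => w ^+ 0 * w ^- 0)) ?mean_monomial ?mulr1 //.
    by move=> w _; rewrite mul1r.
  rewrite meanZ (@eq_mean _ N _ (fun w => w ^+ 0 * w ^- k)); last by move=> w _; rewrite mul1r.
  rewrite mean_monomial // (_ : (_ == _) = false) ?mulr0 //.
  by apply: contraNF k0 => /eqP k0; apply/eqP/val_inj.
have := H a ar; rewrite -/b => {}H.
rewrite horner_poly.
have -> : \sum_(k < N) mean N (fun w => F (r%:C * w) * w ^- k) / r%:C ^+ k * a ^+ k =
   (1 - b ^+ N) * mean N (fun w => F (r%:C * w) * (w / (w - b))).
  rewrite ker; apply: eq_bigr => k _; rewrite /b expr_div_n; by ring.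
rewrite -{1}k1 -(ker (fun=> F a)) -mulrBr ncM (ncB (mean _ _)).
have : nc (1 - b ^+ N) <= 2.
  apply: le_trans (ncD _ _) _; rewrite nc1 ncN ncX.
  have : nc b ^+ N <= 1 by rewrite exprn_ile1 ?nc_ge0 // ltW.
  lra.
move=> h2; apply: le_trans (ler_pM (nc_ge0 _) (nc_ge0 _) h2 H) _.
by rewrite mulrC divfK ?pnatr_eq0.
Qed.

(** Difference quotients of polynomials approximating a primitive approximate
    the function, because those of the primitive converge to it uniformly. *)
Lemma runge_disc f (r rho : R) : 0 < r -> r < rho ->
  (forall z, nc z <= rho -> exists d, cdiff_with f z d) ->
  forall e : R, 0 < e ->
    exists p : {poly R[i]}, forall w, nc w <= r -> nc (f w - p.[w]) <= e.
Proof.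
move=> r0 rrho df e e0; have rho0 : 0 < rho by lra.
have [F HF] := primitive rho0 df.
have [|del del0 Hdel] := HF (e / 2); first lra.
pose t := Num.min del (rho - r) / 2.
have t0 : 0 < t by rewrite divr_gt0 // lt_min del0 subr_gt0.
have td : t < del by have := ge_min del del (rho - r); rewrite lexx /= /t => h; move: t0; rewrite /t; lra.
have tr : r + t < rho.
  have := ge_min (rho - r) del (rho - r); rewrite lexx orbT /= => h; move: t0; rewrite /t; lra.
have [p Hp] := primitive_approx rho0 (e := e * t / 4) ltac:(by rewrite divr_gt0 // mulr_gt0) HF.
have tC : t%:C != 0 :> R[i] by rewrite -nc_gt0 nc_real gtr0_norm.
have nct : nc t%:C = t by rewrite nc_real gtr0_norm.
exists (t%:C^-1 *: (p \Po ('X + t%:C%:P) - p)) => w wr.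
rewrite hornerZ hornerD hornerN horner_comp !hornerE.
have w' : nc (w + t%:C) <= r + t by apply: le_trans (ncD _ _) _; rewrite nct; lra.
have h1 := Hp w ltac:(lra); have h2 := Hp (w + t%:C) ltac:(lra).
have := Hdel w (w + t%:C); have -> : w + t%:C - w = t%:C by ring.
rewrite nct.
move=> /(_ ltac:(lra) ltac:(lra) td) h3.
have -> : f w - t%:C^-1 * (p.[w + t%:C] - p.[w]) =
  t%:C^-1 * ((F (w + t%:C) - p.[w + t%:C]) - (F w - p.[w])
    - (F (w + t%:C) - F w - f w * t%:C)) by field; exact: tC.
rewrite ncM ncV nct mulrC ler_pdivrMr //.
apply: le_trans (ncD _ _) _; rewrite ncN; apply: le_trans (lerD (ncD _ _) h3) _.
rewrite ncN; lra.
Qed.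

(** Goursat's theorem: pointwise differentiability suffices for a power
    series. *)
Lemma cdiff_has_exp f (r rho M : R) : 0 < r -> r < rho ->
  (forall z, nc z <= rho -> exists d, cdiff_with f z d) ->
  (forall w, nc w <= r -> nc (f w) <= M) ->
  exists s, has_exp f s M r.
Proof.
move=> r0 rr df fM; apply: exp_of_approx => //; exact: runge_disc rr df.
Qed.
End Runge.

(** * Holomorphic functions of several variables *)

Section SeveralVariables.
Variables (R : realType) (n : nat).
Local Notation V := 'cV[R[i]]_n.
Implicit Types (z h v : V) (F G : V -> R[i]) (L : 'rV[R[i]]_n).

(** The l1-norm, against which a linear form is bounded by the sum of the
    moduli of its coefficients. *)
Definition vn z : R := \sum_j nc (z j 0).

Lemma vn_ge0 z : 0 <= vn z.
Proof. by apply: sumr_ge0 => j _; exact: nc_ge0. Qed.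

Lemma vnD z h : vn (z + h) <= vn z + vn h.
Proof.
by rewrite /vn -big_split /=; apply: ler_sum => j _; rewrite mxE; exact: ncD.
Qed.

Lemma vnZ (c : R[i]) z : vn (c *: z) = nc c * vn z.
Proof. by rewrite /vn mulr_sumr; apply: eq_bigr => j _; rewrite mxE ncM. Qed.

Lemma vnN z : vn (- z) = vn z.
Proof. by rewrite -scaleN1r vnZ ncN nc1 mul1r. Qed.

Lemma vnB z h : vn (z - h) = vn (h - z).
Proof. by rewrite -vnN opprB. Qed.

Lemma vn0 : vn 0 = 0.
Proof. by rewrite -(scale0r 0) vnZ nc0 mul0r. Qed.

Lemma vn_subD x y z : vn (x - z) <= vn (x - y) + vn (y - z).
Proof. by have := vnD (x - y) (y - z); rewrite addrA subrK. Qed.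

Lemma vn_coord z j : nc (z j 0) <= vn z.
Proof.
by rewrite /vn (bigD1 j) //= lerDl; apply: sumr_ge0 => i _; exact: nc_ge0.
Qed.

Lemma vn_eq0 z : vn z = 0 -> z = 0.
Proof.
move=> z0; apply/colP => j; rewrite mxE; apply/eqP; rewrite -nc_eq0 eq_le nc_ge0 andbT.
by rewrite -z0 vn_coord.
Qed.

Definition lin L z : R[i] := (L *m z) 0 0.

Lemma linE L z : lin L z = \sum_j L 0 j * z j 0.
Proof. by rewrite /lin mxE. Qed.

Lemma linD L z h : lin L (z + h) = lin L z + lin L h.
Proof. by rewrite /lin mulmxDr mxE. Qed.

Lemma linZ L c z : lin L (c *: z) = c * lin L z.
Proof. by rewrite /lin -scalemxAr mxE. Qed.

Lemma linDl L L' z : lin (L + L') z = lin L z + lin L' z.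
Proof. by rewrite /lin mulmxDl mxE. Qed.

Lemma linZl c L z : lin (c *: L) z = c * lin L z.
Proof. by rewrite /lin -scalemxAl mxE. Qed.

Lemma lin0 L : lin L 0 = 0.
Proof. by rewrite /lin mulmx0 mxE. Qed.

Definition en j : V := delta_mx j 0.

Lemma lin_en L j : lin L (en j) = L 0 j.
Proof. by rewrite /lin /en -colE mxE. Qed.

Lemma vn_en j : vn (en j) = 1.
Proof.
rewrite /vn (bigD1 j) //= big1 => [|i ij]; rewrite mxE ?eqxx ?nc1 ?addr0 //.
by rewrite (negbTE ij) nc0.
Qed.

Definition rn L : R := \sum_j nc (L 0 j).

Lemma rn_ge0 L : 0 <= rn L.
Proof. by apply: sumr_ge0 => j _; exact: nc_ge0. Qed.

Lemma lin_bound L z : nc (lin L z) <= rn L * vn z.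
Proof.
rewrite linE; apply: le_trans (nc_sum _ _ _) _; rewrite mulr_suml.
by apply: ler_sum => j _; rewrite ncM ler_wpM2l ?nc_ge0 // vn_coord.
Qed.

(** Fréchet differentiability, the differential being the row vector [L]. *)
Definition hol_with F z L : Prop :=
  forall e : R, 0 < e -> exists2 d : R, 0 < d &
    forall h, vn h < d -> nc (F (z + h) - F z - lin L h) <= e * vn h.

Definition hol F z : Prop := exists L, hol_with F z L.

Lemma hol_cont F z : hol F z -> forall e : R, 0 < e -> exists2 d : R, 0 < d &
  forall y, vn (y - z) < d -> nc (F y - F z) <= e.
Proof.
move=> [L HL] e e0; have [d d0 H] := HL 1 ltr01.
have L1 : 0 < rn L + 1 by have := rn_ge0 L; lra.
exists (Num.min d (e / (rn L + 1))); first by rewrite lt_min d0 divr_gt0.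
move=> y; rewrite lt_min ltr_pdivlMr // => /andP[/H h1 h2].
have e1 : z + (y - z) = y by rewrite addrC subrK.
rewrite e1 mul1r in h1.
have -> : F y - F z = (F y - F z - lin L (y - z)) + lin L (y - z) by ring.
apply: le_trans (ncD _ _) _; have := lin_bound L (y - z); lra.
Qed.

Lemma hol_near F G z : hol F z -> (exists2 d : R, 0 < d & forall h, vn h < d -> F (z + h) = G (z + h)) ->
  hol G z.
Proof.
move=> [L HL] [d d0 FG]; exists L => e e0; have [d' d'0 H] := HL e e0.
exists (Num.min d d') => [|h]; first by rewrite lt_min d0.
rewrite lt_min => /andP[hd /H]; rewrite FG //.
by have := FG 0; rewrite vn0 addr0 => ->.
Qed.

Lemma hol_cst c z : hol (fun=> c) z.
Proof.
exists 0 => e e0; exists 1 => // h _.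
by rewrite subrr /lin mul0mx mxE subrr nc0 mulr_ge0 ?vn_ge0 // ltW.
Qed.

Lemma hol_lin L z : hol (lin L) z.
Proof.
exists L => e e0; exists 1 => // h _.
have -> : lin L (z + h) - lin L z - lin L h = 0 by rewrite linD; ring.
by rewrite nc0 mulr_ge0 ?vn_ge0 // ltW.
Qed.

Lemma hol_with_comb F G z L M c : hol_with F z L -> hol_with G z M ->
  hol_with (fun y => c * F y + G y) z (c *: L + M).
Proof.
move=> HF HG e e0; have c0 : 0 < nc c + 1 by have := nc_ge0 c; lra.
have [|d d0 Hd] := HF (e / 2 / (nc c + 1)); first by rewrite !divr_gt0.
have [|d' d'0 Hd'] := HG (e / 2); first lra.
exists (Num.min d d') => [|h]; first by rewrite lt_min d0.
rewrite lt_min => /andP[/Hd h1 /Hd' h2]; rewrite linDl linZl.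
have -> : c * F (z + h) + G (z + h) - (c * F z + G z) - (c * lin L h + lin M h) =
  c * (F (z + h) - F z - lin L h) + (G (z + h) - G z - lin M h) by ring.
apply: le_trans (ncD _ _) _; rewrite ncM.
rewrite mulrAC ler_pdivlMr // in h1.
have := nc_ge0 (F (z + h) - F z - lin L h).
move: h1 h2; set A := nc (F _ - _ - _); nra.
Qed.

Lemma hol_comb F G z c : hol F z -> hol G z -> hol (fun y => c * F y + G y) z.
Proof. by move=> [L HL] [M HM]; exists (c *: L + M); exact: hol_with_comb. Qed.

Lemma holZ F z c : hol F z -> hol (fun y => c * F y) z.
Proof.
move=> HF; apply: hol_near (hol_comb c HF (hol_cst 0 z)) _.
by exists 1 => // h _; rewrite addr0.
Qed.

Lemma holD F G z : hol F z -> hol G z -> hol (fun y => F y + G y) z.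
Proof.
move=> HF HG; apply: hol_near (hol_comb 1 HF HG) _.
by exists 1 => // h _; rewrite mul1r.
Qed.

Lemma hol_sum (I : Type) (r : seq I) (F : I -> V -> R[i]) z :
  (forall i, hol (F i) z) -> hol (fun y => \sum_(i <- r) F i y) z.
Proof.
move=> H; elim: r => [|i r IH].
  by apply: hol_near (hol_cst 0 z) _; exists 1 => // h _; rewrite big_nil.
apply: hol_near (holD (H i) IH) _.
by exists 1 => // h _; rewrite big_cons.
Qed.

Lemma holM F G z : hol F z -> hol G z -> hol (fun y => F y * G y) z.
Proof.
move=> HF HG; have [L HL] := HF; have [M HM] := HG.
exists (F z *: M + G z *: L) => e e0.
pose A := nc (F z) + 1; pose B := nc (G z) + 1; pose C := rn L + 1.
have A0 : 0 < A by rewrite /A; have := nc_ge0 (F z); lra.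
have B0 : 0 < B by rewrite /B; have := nc_ge0 (G z); lra.
have C0 : 0 < C by rewrite /C; have := rn_ge0 L; lra.
have [|d1 d10 H1] := HL (e / 3 / B); first by rewrite !divr_gt0.
have [|d2 d20 H2] := HM (e / 3 / A); first by rewrite !divr_gt0.
have [d3 d30 H3] := hol_cont HG ltr01.
have [|d4 d40 H4] := hol_cont HG (e := e / 3 / C); first by rewrite !divr_gt0.
exists (Num.min (Num.min d1 d2) (Num.min d3 d4)) => [|h].
  by rewrite !lt_min d10 d20 d30.
rewrite !lt_min => /andP[/andP[h1 h2] /andP[h3 h4]].
have e1 : z + h - z = h by rewrite addrC addKr.
have k1 := H1 _ h1; have k2 := H2 _ h2.
have k3 := H3 (z + h); rewrite e1 in k3; have {}k3 := k3 h3.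
have k4 := H4 (z + h); rewrite e1 in k4; have {}k4 := k4 h4.
rewrite linDl !linZl.
have -> : F (z + h) * G (z + h) - F z * G z - (F z * lin M h + G z * lin L h) =
  (F (z + h) - F z - lin L h) * G (z + h) + lin L h * (G (z + h) - G z)
  + F z * (G (z + h) - G z - lin M h) by ring.
have v0 := vn_ge0 h.
have gB : nc (G (z + h)) <= B.
  have -> : G (z + h) = (G (z + h) - G z) + G z by ring.
  by apply: le_trans (ncD _ _) _; rewrite /B; lra.
have -> : e * vn h = e / 3 / B * vn h * B + C * vn h * (e / 3 / C) + A * (e / 3 / A * vn h).
  by field; rewrite !gt_eqF.
apply: le_trans (ncD _ _) _; apply: lerD; last first.
  by rewrite ncM ler_pM ?nc_ge0 // /A; lra.
apply: le_trans (ncD _ _) _; apply: lerD; rewrite ncM ler_pM ?nc_ge0 //.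
apply: le_trans (lin_bound L h) _; rewrite ler_wpM2r // /C; lra.
Qed.

Lemma hol_scale F (c : R[i]) z : hol F (c *: z) -> hol (fun y => F (c *: y)) z.
Proof.
move=> [L HL]; exists (c *: L) => e e0; have c0 : 0 < nc c + 1 by have := nc_ge0 c; lra.
have [|d d0 Hd] := HL (e / (nc c + 1)); first by rewrite divr_gt0.
exists (d / (nc c + 1)) => [|h]; first by rewrite divr_gt0.
rewrite ltr_pdivlMr // => hd; rewrite scalerDr linZl -linZ.
have v0 := vn_ge0 h.
apply: le_trans (Hd _ _) _; rewrite vnZ; first nra.
by rewrite mulrAC ler_pdivrMr // -mulrA ler_wpM2l ?(ltW e0) //; nra.
Qed.

Lemma hol_shift F a z : hol F (z + a) -> hol (fun y => F (y + a)) z.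
Proof.
move=> [L HL]; exists L => e e0; have [d d0 Hd] := HL e e0; exists d => // h hd.
by rewrite (addrAC z h a); exact: Hd.
Qed.

Lemma hol_line F a b w L : hol_with F (a + w *: b) L ->
  cdiff_with (fun x => F (a + x *: b)) w (lin L b).
Proof.
move=> HL e e0; have b0 : 0 < vn b + 1 by have := vn_ge0 b; lra.
have [|d d0 Hd] := HL (e / (vn b + 1)); first by rewrite divr_gt0.
exists (d / (vn b + 1)) => [|h]; first by rewrite divr_gt0.
rewrite ltr_pdivlMr // => hd; rewrite scalerDl addrA mulrC -linZ.
have n0 := nc_ge0 h; have v0 := vn_ge0 b.
apply: le_trans (Hd _ _) _; rewrite vnZ; first nra.
by rewrite mulrAC ler_pdivrMr // -mulrA ler_wpM2l ?(ltW e0) //; nra.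
Qed.

Lemma cdiff_uniq (f : R[i] -> R[i]) w d d' : cdiff_with f w d -> cdiff_with f w d' -> d = d'.
Proof.
move=> Hd Hd'; apply/eqP; rewrite -subr_eq0; apply/eqP/nc_eq0P => e e0.
have [x x0 Hx] := Hd (e / 2) ltac:(lra); have [y y0 Hy] := Hd' (e / 2) ltac:(lra).
pose t := Num.min x y / 2.
have m0 : 0 < Num.min x y by rewrite lt_min x0.
have t0 : 0 < t by rewrite /t; lra.
have nct : nc t%:C = t by rewrite nc_real gtr0_norm.
have tx : t < x by have := ge_min x x y; rewrite lexx /= /t; lra.
have ty : t < y by have := ge_min y x y; rewrite lexx orbT /= /t; lra.
have := Hx t%:C; have := Hy t%:C; rewrite nct => /(_ ty) h2 /(_ tx) h1.
rewrite -(ler_pM2r t0) -{1}nct -ncM.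
have -> : (d - d') * t%:C = (f (w + t%:C) - f w - d' * t%:C) - (f (w + t%:C) - f w - d * t%:C) by ring.
apply: le_trans (ncD _ _) _; rewrite ncN; lra.
Qed.

Lemma has_exp_cdiff (f : R[i] -> R[i]) a M r : 0 < r -> has_exp f a M r ->
  cdiff_with f 0 (a 1%N).
Proof.
move=> r0 H; have a0 := has_exp0 r0 H; have M0 := has_exp_M r0 H; have [_ H2] := H.
move=> e e0; have M1 : 0 < M + 1 by lra.
have q0 : 0 < e * r ^+ 2 / 2 / (M + 1) by rewrite !divr_gt0 // mulr_gt0 // exprn_gt0.
exists (Num.min (r / 2) (e * r ^+ 2 / 2 / (M + 1))); first by rewrite lt_min q0 divr_gt0.
move=> h; rewrite lt_min => /andP[h1 h2]; rewrite add0r.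
have := H2 2%N h ltac:(lra); rewrite !big_ord_recl big_ord0 /= /bump /= expr0 mulr1 addr0 a0 expr1.
have -> : f h - (f 0 + a 1%N * h) = f h - f 0 - a 1%N * h by ring.
move=> h3; apply: le_trans h3 _.
have n0 := nc_ge0 h; set x := nc h in h1 h2 n0 *.
have xr : x / r <= 2^-1 by rewrite ler_pdivrMr //; lra.
rewrite ler_pdivrMr; last lra.
rewrite ltr_pdivlMr // in h2.
rewrite expr_div_n mulrA ler_pdivrMr ?exprn_gt0 //.
apply: le_trans (_ : e * x * 2^-1 * r ^+ 2 <= _); last first.
  by rewrite ler_wpM2r ?exprn_ge0 ?(ltW r0) // ler_wpM2l ?mulr_ge0 ?(ltW e0) //; lra.
rewrite expr2; nra.
Qed.

(** Second order Taylor bound, by Cauchy's estimates along complex lines. *)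
Lemma hol_taylor F z (r M : R) L : 0 < r ->
  (forall y, vn (y - z) <= r -> hol F y /\ nc (F y) <= M) -> hol_with F z L ->
  forall h, nc (lin L h) <= 2 * M / r * vn h /\
    (vn h <= r / 4 -> nc (F (z + h) - F z - lin L h) <= 8 * M / r ^+ 2 * vn h ^+ 2).
Proof.
move=> r0 HF HL h.
have M0 : 0 <= M.
  have [//|_] := HF z; first by rewrite subrr vn0 ltW.
  exact: le_trans (nc_ge0 _).
have [hv|hv] := eqVneq (vn h) 0.
  rewrite (vn_eq0 hv) lin0 nc0 vn0 addr0 !mulr0 lexx; split=> // _.
  by rewrite !subrr nc0 expr0n mulr0.
have h0 : 0 < vn h by rewrite lt_def hv vn_ge0.
pose f w := F (z + w *: h); pose rho := r / vn h.
have rho0 : 0 < rho by rewrite divr_gt0.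
have inb w : nc w <= rho -> vn (z + w *: h - z) <= r.
  by rewrite addrC addKr vnZ /rho ler_pdivlMr.
have df w : nc w <= rho -> exists d, cdiff_with f w d.
  by move=> /inb /HF [[L' HL'] _]; exists (lin L' h); exact: hol_line.
have [|||w wr|a Ha] := @cdiff_has_exp R f (rho / 2) rho M.
- by rewrite divr_gt0.
- lra.
- exact: df.
- by have [//|//] := HF (z + w *: h); apply: inb; lra.
have r2 : 0 < rho / 2 by lra.
have a1 : a 1%N = lin L h.
  apply: cdiff_uniq (has_exp_cdiff r2 Ha) _; apply: hol_line.
  by rewrite scale0r addr0.
have a0 := has_exp0 r2 Ha.
have [Hb Hr] := Ha; split.
  rewrite -a1; apply: le_trans (Hb 1%N) _; rewrite expr1 /rho le_eqVlt; apply/orP; left.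
  by apply/eqP; field; rewrite !gt_eqF.
move=> hr; have rho4 : 4 <= rho by rewrite ler_pdivlMr //; lra.
have := Hr 2%N 1; rewrite nc1 => /(_ ltac:(lra)).
rewrite !big_ord_recl big_ord0 /= !expr1n !mulr1 addr0 a0 a1.
rewrite /f scale1r scale0r addr0.
have -> : F (z + h) - (F z + lin L h) = F (z + h) - F z - lin L h by ring.
move=> H; apply: le_trans H _.
have u : 1 / (rho / 2) <= 2^-1 by rewrite ler_pdivrMr //; lra.
have -> : 8 * M / r ^+ 2 * vn h ^+ 2 = M * (1 / (rho / 2)) ^+ 2 * 2.
  by rewrite /rho; field; rewrite !gt_eqF.
have u0 : 0 <= 1 / (rho / 2) by rewrite divr_ge0 // ltW.
have u1 : 0 <= M * (1 / (rho / 2)) ^+ 2 by apply: mulr_ge0 => //; exact: exprn_ge0.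
rewrite ler_wpM2l //.
by rewrite -[leRHS]invrK lef_pV2 ?posrE //; lra.
Qed.

(** Weierstrass: the first order part of the Taylor bound makes the
    differentials converge, and the second order part passes to the limit. *)
Lemma hol_unif_limit F z (r : R) : 0 < r ->
  (forall e : R, 0 < e -> exists H, forall y, vn (y - z) <= r ->
     hol H y /\ nc (F y - H y) <= e) ->
  hol F z.
Proof.
move=> r0 app.
have /choice[H HH] : forall m : nat, exists H, forall y, vn (y - z) <= r ->
    hol H y /\ nc (F y - H y) <= m.+1%:R^-1.
  by move=> m; apply: app; rewrite invr_gt0 ltr0n.
have zz : vn (z - z) <= r by rewrite subrr vn0 ltW.
have [d0 d00 Hd0] := hol_cont (HH 0%N z zz).1 ltr01.
pose r1 := Num.min r (d0 / 2).
have r10 : 0 < r1 by rewrite lt_min r0 divr_gt0.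
have r1r : r1 <= r by rewrite ge_min lexx.
have r1d : r1 < d0 by have := ge_min (d0 / 2) r (d0 / 2); rewrite lexx orbT -/r1 => h; lra.
pose M := nc (H 0%N z) + 3.
have HM m y : vn (y - z) <= r1 -> nc (H m y) <= M.
  move=> yr; have yr' : vn (y - z) <= r by lra.
  have h0 := Hd0 y (le_lt_trans yr r1d).
  have h1 := (HH 0%N y yr').2; have h2 := (HH m y yr').2.
  have m1 : m.+1%:R^-1 <= (1 : R) by rewrite invf_le1 ?ltr0n // ler1n.
  have m0 : (1%:R^-1 : R) = 1 by rewrite invr1.
  rewrite m0 in h1.
  have -> : H m y = (F y - H 0%N y) - (F y - H m y) + (H 0%N y - H 0%N z) + H 0%N z by ring.
  apply: le_trans (ncD _ _) _; rewrite /M.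
  have := ncD (F y - H 0%N y - (F y - H m y)) (H 0%N y - H 0%N z).
  have := ncD (F y - H 0%N y) (- (F y - H m y)); rewrite ncN.
  have := le_trans h2 m1; clear h2 m1 m0 => h2 k1 k2; lra.
have /choice[L HL] : forall m, exists L, hol_with (H m) z L by move=> m; exact: (HH m z zz).1.
have /choice[l Hl] : forall j, exists l, climit (fun m => L m 0 j) l.
  move=> j; apply: C_cauchy => e e0.
  have [N HN] := @inv_nat_small R (e * r / 4) ltac:(by rewrite divr_gt0 // mulr_gt0).
  exists N => m k Nm Nk.
  pose D y := (-1) * H k y + H m y.
  have DL : hol_with D z ((-1) *: L k + L m) by apply: hol_with_comb.
  have Db y : vn (y - z) <= r -> hol D y /\ nc (D y) <= e * r / 2.
    move=> yr; split; first by apply: hol_comb; [exact: (HH k y yr).1|exact: (HH m y yr).1].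
    have -> : D y = (F y - H k y) - (F y - H m y) by rewrite /D; ring.
    apply: le_trans (ncD _ _) _; rewrite ncN.
    apply: le_trans (lerD (HH k y yr).2 (HH m y yr).2) _.
    by apply: le_trans (lerD (HN k Nk) (HN m Nm)) _; lra.
  have [+ _] := hol_taylor r0 Db DL (en j).
  rewrite linDl linZl !lin_en vn_en mulr1 mulN1r addrC => h; apply: le_trans h _.
  rewrite le_eqVlt; apply/orP; left; apply/eqP; field; by rewrite gt_eqF.
exists (\row_j l j) => e e0.
have M0 : 0 < M by rewrite /M; have := nc_ge0 (H 0%N z); lra.
have q0 : 0 < 8 * M / r1 ^+ 2 by rewrite !divr_gt0 ?mulr_gt0 ?exprn_gt0.
exists (Num.min (r1 / 4) (e / (8 * M / r1 ^+ 2))).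
  by rewrite lt_min !divr_gt0 ?mulr_gt0 ?exprn_gt0.
move=> h; rewrite lt_min (ltr_pdivlMr _ _ q0) => /andP[h1 h2].
have hr : vn h <= r by have := vn_ge0 h; lra.
have Hlim y : vn (y - z) <= r -> climit (fun m => H m y) (F y).
  move=> yr x x0; have [N HN] := inv_nat_small x0; exists N => m /HN.
  by rewrite ncB; apply: le_trans; exact: (HH m y yr).2.
have lim : climit (fun m => H m (z + h) - H m z - lin (L m) h) (F (z + h) - F z - lin (\row_j l j) h).
  apply: climitB; first apply: climitB; first by apply: Hlim; rewrite addrC addKr.
    exact: Hlim.
  rewrite linE; have hs : climit (fun m => \sum_(k < n) L m 0 k * h k 0) (\sum_(k < n) l k * h k 0).
    have gen (I : Type) (r' : seq I) (u : I -> nat -> R[i]) (v : I -> R[i]) :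
        (forall i, climit (u i) (v i)) -> climit (fun m => \sum_(i <- r') u i m) (\sum_(i <- r') v i).
      move=> Huv; elim: r' => [|i r' IH].
        by move=> x x0; exists 0%N => m _; rewrite !big_nil subrr nc0 ltW.
      move=> x /(climitD (Huv i) IH) [N HN]; exists N => m /HN; by rewrite !big_cons.
    apply: gen => k x /(climitZ (h k 0) (Hl k)) [N HN]; exists N => m /HN.
    by rewrite ![h k 0 * _]mulrC.
  have -> : \sum_j (\row_j l j) 0 j * h j 0 = \sum_j l j * h j 0.
    by apply: eq_bigr => k _; rewrite mxE.
  by move=> x /hs [N HN]; exists N => m /HN; rewrite linE.
apply: le_trans (_ : 8 * M / r1 ^+ 2 * vn h ^+ 2 <= _); last first.
  by rewrite expr2 mulrA ler_wpM2r ?vn_ge0 // mulrC ltW.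
apply: (climit_le lim) => x x0; exists 0%N => m _; apply: ler_wpDr; first exact: ltW.
have Hb y : vn (y - z) <= r1 -> hol (H m) y /\ nc (H m y) <= M.
  by move=> yr; split; [apply: (HH m y _).1; lra|exact: HM].
by have [_] := hol_taylor r10 Hb (HL m) h; apply; exact: ltW.
Qed.

Lemma hol_bounded F z : hol F z -> exists M, exists2 d : R, 0 < d &
  forall y, vn (y - z) < d -> nc (F y) <= M.
Proof.
move=> HF; have [d d0 Hd] := hol_cont HF ltr01; exists (nc (F z) + 1); exists d => // y /Hd h.
have -> : F y = (F y - F z) + F z by ring.
apply: le_trans (ncD _ _) _; lra.
Qed.

(** On a small ball the partial derivatives are uniform limits of difference
    quotients. *)
Lemma hol_partial F (D : V -> 'rV[R[i]]_n) z (r : R) j : 0 < r ->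
  (forall y, vn (y - z) < r -> hol_with F y (D y)) -> hol (fun y => D y 0 j) z.
Proof.
move=> r0 HD.
have [M [d d0 HM]] := hol_bounded (ex_intro _ _ (HD z ltac:(by rewrite subrr vn0))).
pose s := Num.min r d / 2.
have s0 : 0 < s by rewrite divr_gt0 // lt_min r0.
have sr : s < r by have := ge_min r r d; rewrite lexx /= => h; move: s0; rewrite /s; lra.
have sd : s < d by have := ge_min d r d; rewrite lexx orbT /= => h; move: s0; rewrite /s; lra.
have M0 : 0 <= M by apply: le_trans (nc_ge0 (F z)) _; apply: HM; rewrite subrr vn0.
apply: (@hol_unif_limit _ _ (s / 2)) => [|e e0]; first lra.
pose q := 8 * M / (s / 2) ^+ 2.
have s2 : 0 < s / 2 by lra.
have q0 : 0 <= q by apply: divr_ge0; [exact: mulr_ge0|exact: exprn_ge0 (ltW s2)].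
pose t := Num.min (s / 8) (e / (q + 1)).
have q1 : 0 < q + 1 by lra.
have t0 : 0 < t by rewrite lt_min (divr_gt0 e0 q1) andbT; lra.
have ts : t <= s / 8 by rewrite ge_min lexx.
have te : q * t <= e.
  have : t <= e / (q + 1) by rewrite ge_min lexx orbT.
  rewrite ler_pdivlMr; [nra|lra].
have tC : t%:C != 0 :> R[i] by rewrite -nc_gt0 nc_real gtr0_norm.
have nct : nc t%:C = t by rewrite nc_real gtr0_norm.
exists (fun y => t%:C^-1 * (F (y + t%:C *: en j) + (-1) * F y)) => y yz; split.
  apply: holZ; apply: holD; last by apply: holZ; exists (D y); apply: HD; lra.
  apply: hol_shift; exists (D (y + t%:C *: en j)); apply: HD.
  have -> : y + t%:C *: en j - z = (y - z) + t%:C *: en j by rewrite addrAC.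
  by apply: le_lt_trans (vnD _ _) _; rewrite vnZ vn_en nct; lra.
have yb x : vn (x - y) <= s / 2 -> hol F x /\ nc (F x) <= M.
  move=> xy; have xz : vn (x - z) <= s by apply: le_trans (vn_subD _ y _) _; lra.
  by split; [exists (D x); apply: HD|apply: HM]; lra.
have [_] := hol_taylor s2 yb (HD y ltac:(lra)) (t%:C *: en j).
rewrite vnZ vn_en mulr1 nct linZ lin_en => /(_ ltac:(lra)) h.
have -> : D y 0 j - t%:C^-1 * (F (y + t%:C *: en j) + -1 * F y) =
   - (t%:C^-1 * (F (y + t%:C *: en j) - F y - t%:C * D y 0 j)) by field; exact: tC.
rewrite ncN ncM ncV nct mulrC ler_pdivrMr //; apply: le_trans h _.
by rewrite expr2 mulrA ler_wpM2r // ltW.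
Qed.
End SeveralVariables.

(** * Polynomial functions *)

Section PolynomialFunctions.
Variables (R : realType) (n : nat).
Local Notation V := 'cV[R[i]]_n.
Implicit Types (z h v a b : V) (p q : mpoly n R[i]).

Lemma mpoly_ring_ind (P : mpoly n R[i] -> Prop) :
  (forall c, P (mpolyC n c)) -> (forall j, P (mpolyX R[i] (mnm1 j))) ->
  (forall p q, P p -> P q -> P (p + q)) -> (forall p q, P p -> P q -> P (p * q)) ->
  forall p, P p.
Proof.
move=> PC PX PD PM; apply: mpolyind => [|c m p _ _ Pp]; first by rewrite -mpolyC0.
apply: (PD) => //; rewrite -mul_mpolyC; apply: (PM) => //.
rewrite mpolyXE_id; elim/big_rec: _ => [|j q _ Pq]; first by rewrite -mpolyC1.
apply: (PM) => //; elim: (m j) => [|k IH]; first by rewrite expr0 -mpolyC1.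
by rewrite exprS; apply: PM.
Qed.

Lemma poly_evalC c z : poly_eval (mpolyC n c) z = c.
Proof. exact: mevalC. Qed.

Lemma poly_evalX j z : poly_eval (mpolyX R[i] (mnm1 j)) z = z j 0.
Proof. exact: mevalXU. Qed.

Lemma poly_evalD p q z : poly_eval (p + q) z = poly_eval p z + poly_eval q z.
Proof. exact: mevalD. Qed.

Lemma poly_evalN p z : poly_eval (- p) z = - poly_eval p z.
Proof. exact: mevalN. Qed.

Lemma poly_evalM p q z : poly_eval (p * q) z = poly_eval p z * poly_eval q z.
Proof. exact: mevalM. Qed.

Lemma poly_evalZ c p z : poly_eval (c *: p) z = c * poly_eval p z.
Proof. exact: mevalZ. Qed.

Lemma poly_eval_sum (I : Type) (r : seq I) (P : pred I) (F : I -> mpoly n R[i]) z :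
  poly_eval (\sum_(i <- r | P i) F i) z = \sum_(i <- r | P i) poly_eval (F i) z.
Proof. by elim/big_rec2: _ => [|i x y _ <-]; [exact: meval0|rewrite poly_evalD]. Qed.

Lemma poly_eval_prod (I : Type) (r : seq I) (P : pred I) (F : I -> mpoly n R[i]) z :
  poly_eval (\prod_(i <- r | P i) F i) z = \prod_(i <- r | P i) poly_eval (F i) z.
Proof. by elim/big_rec2: _ => [|i x y _ <-]; [exact: meval1|rewrite poly_evalM]. Qed.

Lemma poly_evalXn p k z : poly_eval (p ^+ k) z = poly_eval p z ^+ k.
Proof.
by elim: k => [|k IH]; [exact: meval1|rewrite !exprS poly_evalM IH].
Qed.

Definition linp (L : 'rV[R[i]]_n) : mpoly n R[i] :=
  \sum_j L 0 j *: mpolyX R[i] (mnm1 j).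

Lemma linpE L z : poly_eval (linp L) z = lin L z.
Proof.
by rewrite poly_eval_sum linE; apply: eq_bigr => j _; rewrite poly_evalZ poly_evalX.
Qed.

Lemma poly_comp_mx p (A : 'M[R[i]]_n) : exists q, forall z, poly_eval q z = poly_eval p (A *m z).
Proof.
elim/mpoly_ring_ind: p => [b|j|p q [P HP] [Q HQ]|p q [P HP] [Q HQ]].
- by exists (mpolyC n b) => z; rewrite !poly_evalC.
- by exists (linp (row j A)) => z; rewrite linpE poly_evalX /lin -row_mul mxE.
- by exists (P + Q) => z; rewrite !poly_evalD HP HQ.
- by exists (P * Q) => z; rewrite !poly_evalM HP HQ.
Qed.

Lemma hol_poly p z : hol (poly_eval p) z.
Proof.
have ext (F G : V -> R[i]) : hol F z -> (forall y, G y = F y) -> hol G z.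
  by move=> HF FG; apply: hol_near HF _; exists 1 => // h _.
elim/mpoly_ring_ind: p => [c|j|p q Hp Hq|p q Hp Hq].
- by apply: ext (hol_cst c z) _ => y; rewrite poly_evalC.
- apply: ext (hol_lin (delta_mx 0 j) z) _ => y.
  by rewrite poly_evalX /lin -rowE mxE.
- by apply: ext (holD Hp Hq) _ => y; rewrite poly_evalD.
- by apply: ext (holM Hp Hq) _ => y; rewrite poly_evalM.
Qed.

Lemma poly_line p a b : exists P : {poly R[i]}, forall t, poly_eval p (a + t *: b) = P.[t].
Proof.
elim/mpoly_ring_ind: p => [c|j|p q [P HP] [Q HQ]|p q [P HP] [Q HQ]].
- by exists c%:P => t; rewrite poly_evalC hornerC.
- exists ((a j 0)%:P + (b j 0) *: 'X) => t.
  by rewrite poly_evalX !mxE hornerD hornerC hornerZ hornerX mulrC.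
- by exists (P + Q) => t; rewrite poly_evalD HP HQ hornerD.
- by exists (P * Q) => t; rewrite poly_evalM HP HQ hornerM.
Qed.

Lemma poly1_eq0 (P : {poly R[i]}) (d : R) : 0 < d ->
  (forall t, t != 0 -> nc t < d -> P.[t] = 0) -> P = 0.
Proof.
move=> d0 H; apply/eqP/negPn/negP => P0.
pose u (k : nat) : R[i] := (d / k.+2%:R)%:C.
have := @max_poly_roots _ P [seq u k | k <- iota 0 (size P)] P0.
rewrite size_map size_iota ltnn => F; apply/negP: isT; rewrite -[X in ~~ X]F //.
- apply/allP => x /mapP[k _ ->]; apply/rootP; have dk : 0 < d / k.+2%:R by rewrite divr_gt0.
  apply: H; first by rewrite -nc_gt0 nc_real gtr0_norm.
  by rewrite nc_real gtr0_norm // ltr_pdivrMr // ltr_pMr // ltr1n.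
rewrite map_inj_uniq ?iota_uniq // => i j /(congr1 (@complex.Re R)) /=.
move/(mulfI (lt0r_neq0 d0))/invr_inj/eqP; rewrite eqr_nat => /eqP; by case.
Qed.

(** Along a complex line through [z] the polynomial has infinitely many zeros. *)
Lemma poly_eval_near p z (d : R) : 0 < d ->
  (forall h, vn h < d -> poly_eval p (z + h) = 0) -> forall y, poly_eval p y = 0.
Proof.
move=> d0 H y; have [P HP] := poly_line p z (y - z).
suff P0 : P = 0 by have := HP 1; rewrite P0 horner0 scale1r addrC subrK.
have z1 : 0 < vn (y - z) + 1 by have := vn_ge0 (y - z); lra.
apply: (@poly1_eq0 P (d / (vn (y - z) + 1))) => [|t _]; first by rewrite divr_gt0.
rewrite ltr_pdivlMr // => tz; rewrite -HP; apply: H; rewrite vnZ.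
by have := nc_ge0 t; have := vn_ge0 (y - z); nra.
Qed.

Lemma poly_bounded p (M : R) : exists K : R, forall z, vn z <= M -> nc (poly_eval p z) <= K.
Proof.
elim/mpoly_ring_ind: p => [b|j|p q [K HK] [L HL]|p q [K HK] [L HL]].
- by exists (nc b) => z _; rewrite poly_evalC.
- by exists M => z zM; rewrite poly_evalX; apply: le_trans zM; exact: vn_coord.
- exists (K + L) => z zM; rewrite poly_evalD; apply: le_trans (ncD _ _) _.
  by apply: lerD; [exact: HK|exact: HL].
- exists (K * L) => z zM; rewrite poly_evalM ncM.
  by apply: ler_pM; rewrite ?nc_ge0 //; [exact: HK|exact: HL].
Qed.
Lemma digits_inj k (d : nat) (f g : 'I_k -> nat) :
  (forall j, f j < d)%N -> (forall j, g j < d)%N ->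
  (\sum_j f j * d ^ j = \sum_j g j * d ^ j)%N -> f =1 g.
Proof.
elim: k f g => [|k IH] f g fd gd; first by move=> _ [].
have d0 : (0 < d)%N by apply: leq_trans (fd ord0).
have dec (u : 'I_k.+1 -> nat) : (\sum_j u j * d ^ j =
    u ord0 + (\sum_(j < k) u (lift ord0 j) * d ^ j) * d)%N.
  rewrite big_ord_recl expn0 muln1 big_distrl /=; congr addn.
  by apply: eq_bigr => j _; rewrite /bump /= add1n expnSr mulnA.
rewrite !dec => E.
have E0 : f ord0 = g ord0.
  have := congr1 (modn ^~ d) E.
  by rewrite /= ![(_ + _ * d)%N]addnC !modnMDl !modn_small.
move: E; rewrite E0 => /addnI /eqP; rewrite eqn_pmul2r // => /eqP E.
have {IH} H := IH (f \o lift ord0) (g \o lift ord0) (fun j => fd _) (fun j => gd _) E.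
move=> j; have [i ->|->] := unliftP ord0 j; last exact: E0.
exact: H.
Qed.

(** Kronecker's substitution of rapidly increasing powers of one variable
    separates the monomials. *)
Lemma poly_eval_inj p : (forall z, poly_eval p z = 0) -> p = 0.
Proof.
move=> H; pose d := msize p.
pose e (m : multinom n) := (\sum_j m j * d ^ j)%N.
pose P : {poly R[i]} := \sum_(m <- msupp p) mcoeff m p *: 'X^(e m).
have P0 : P = 0.
  apply: (@poly1_eq0 P 1) => // t _ _.
  rewrite -(H (\col_j t ^+ (d ^ j)%N)) /poly_eval mevalE /P horner_sum.
  apply: eq_bigr => m _; rewrite hornerZ hornerXn; congr (_ * _).
  rewrite /e expr_sum; apply: eq_bigr => j _; by rewrite mxE -exprM mulnC.
have dm m j : m \in msupp p -> (m j < d)%N.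
  move=> mp; apply: leq_ltn_trans (msize_mdeg_lt mp).
  by rewrite mdegE (bigD1 j) //= leq_addr.
apply/mpolyP => m; rewrite mcoeff0; have [mp|/memN_msupp_eq0 //] := boolP (m \in msupp p).
have := congr1 (fun Q : {poly R[i]} => Q`_(e m)) P0; rewrite coef0 /P coef_sum.
rewrite (bigD1_seq m) ?msupp_uniq //= coefZ coefXn eqxx mulr1 big1_seq ?addr0 // => m' /andP[m'm m'p].
rewrite coefZ coefXn; case: eqP => [E|]; rewrite ?mulr0 //.
case/eqP: m'm; apply/mnmP => j; apply: (@digits_inj n d m' m) => // i; exact: dm.
Qed.

End PolynomialFunctions.

(** * Expansion into homogeneous polynomials *)

Section HomogeneousExpansion.
Variables (R : realType) (n : nat).
Local Notation V := 'cV[R[i]]_n.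
Variable Om : V -> Prop.
Hypothesis Om_open : forall z, Om z -> exists2 d : R, 0 < d & forall h, vn h < d -> Om (z + h).
Hypothesis Om_star : forall (c : R[i]) z, nc c <= 1 -> Om z -> Om (c *: z).
Hypothesis Om0 : Om 0.

Lemma cdiff_pow k (c : R[i]) : cdiff_with (fun x => x ^+ k * c) 1 (k%:R * c).
Proof.
have horner_cdiff (P : {poly R[i]}) w : cdiff_with (fun x => P.[x]) w P^`().[w].
  elim/poly_ind: P => [|P b IH] e e0.
    by exists 1 => // h _; rewrite deriv0 !horner0 mul0r !subr0 nc0 mulr_ge0 ?nc_ge0 // ltW.
  have w0 : 0 < nc w + 1 by have := nc_ge0 w; lra.
  have [|d d0 Hd] := IH (e / 2 / (nc w + 1)); first by rewrite !divr_gt0.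
  have [|d' d'0 Hd'] := cdiff_continuous (IH) (e := e / 2); first lra.
  exists (Num.min d d') => [|h]; first by rewrite lt_min d0.
  rewrite lt_min => /andP[/Hd h1 hd'].
  have := Hd' (w + h); rewrite [w + h - w]addrC addKr => /(_ hd') h2.
  rewrite derivD derivM derivX derivC !hornerE.
  have -> : P.[w + h] * (w + h) + b - (P.[w] * w + b) - (P^`().[w] * w + P.[w]) * h =
    (P.[w + h] - P.[w] - P^`().[w] * h) * w + (P.[w + h] - P.[w]) * h by ring.
  apply: le_trans (ncD _ _) _; rewrite !ncM.
  have n0 := nc_ge0 h; have n1 := nc_ge0 w.
  rewrite mulrAC ler_pdivlMr // in h1.
  have n2 := nc_ge0 (P.[w + h] - P.[w] - P^`().[w] * h).
  have -> : e * nc h = e / 2 * nc h + e / 2 * nc h by field.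
  apply: lerD; last by rewrite ler_wpM2r.
  apply: le_trans h1; rewrite ler_wpM2l //; lra.
have := horner_cdiff (c *: 'X^k) 1.
rewrite derivZ derivXn !hornerE hornerMn hornerXn expr1n mulr_natl mulr_natr.
move=> H e /H [d d0 Hd]; exists d => // h /Hd; by rewrite !hornerZ !hornerXn ![c * _]mulrC.
Qed.

(** Euler's identity: by induction on the degree the partial derivatives are
    polynomials, and they recover the function. *)
Lemma hol_homog_poly k (G : V -> R[i]) : (forall z, Om z -> hol G z) ->
  (forall c z, c != 0 -> Om z -> Om (c *: z) -> G (c *: z) = c ^+ k * G z) ->
  exists p, forall z, Om z -> G z = poly_eval p z.
Proof.
elim: k G => [|k IH] G HG Hom.
  exists (mpolyC n (G 0)) => z Oz; rewrite poly_evalC.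
  apply/eqP; rewrite -subr_eq0; apply/eqP/nc_eq0P => e e0.
  have [d d0 Hd] := hol_cont (HG 0 Om0) e0.
  have z1 : 0 < vn z + 1 by have := vn_ge0 z; lra.
  pose t := Num.min 1 (d / (vn z + 1) / 2).
  have t0 : 0 < t by rewrite lt_min ltr01 !divr_gt0.
  have t1 : t <= 1 by rewrite ge_min lexx.
  have td : t * vn z < d.
    have : t <= d / (vn z + 1) / 2 by rewrite ge_min lexx orbT.
    rewrite -mulrA -invfM ler_pdivlMr ?mulr_gt0 // => h; have := vn_ge0 z; nra.
  have nct : nc t%:C = t by rewrite nc_real gtr0_norm.
  have := Hd (t%:C *: z); rewrite subr0 vnZ nct => /(_ td).
  rewrite Hom ?expr0 ?mul1r //; first by rewrite -nc_gt0 nct.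
  by apply: Om_star; rewrite ?nct.
have /choice[D HD] : forall z, exists L, Om z -> hol_with G z L.
  move=> z; have [/HG[L HL]|nz] := pselect (Om z); first by exists L.
  by exists 0.
have Dhol j z : Om z -> hol (fun y => D y 0 j) z.
  move=> Oz; have [d d0 Hd] := Om_open Oz.
  apply: (hol_partial (F := G) j d0) => y yz; apply: HD.
  by rewrite -(subrK z y) addrC; exact: Hd.
have Dhom c z : c != 0 -> Om z -> Om (c *: z) -> D (c *: z) = c ^+ k *: D z.
  move=> c0 Oz Ocz; apply/rowP => j; rewrite mxE.
  have [d1 d10 H1] := Om_open Oz; have [d2 d20 H2] := Om_open Ocz.
  have e1 : cdiff_with (fun t => G (c *: z + t *: (c *: en R j))) 0 (lin (D (c *: z)) (c *: en R j)).
    by apply: hol_line; rewrite scale0r addr0; exact: HD.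
  have e2 : cdiff_with (fun t => G (z + t *: en R j)) 0 (lin (D z) (en R j)).
    by apply: hol_line; rewrite scale0r addr0; exact: HD.
  (* Homogeneity of [G] computes the derivative of the first line from that of
     the second. *)
  have e3 : cdiff_with (fun t => G (c *: z + t *: (c *: en R j))) 0 (c ^+ k.+1 * lin (D z) (en R j)).
    move=> e e0.
    have ck0 : 0 < nc (c ^+ k.+1) + 1 by have := nc_ge0 (c ^+ k.+1); lra.
    have cc0 : 0 < nc c + 1 by have := nc_ge0 c; lra.
    have [|d d0 Hd] := e2 (e / (nc (c ^+ k.+1) + 1)); first by rewrite divr_gt0.
    exists (Num.min (Num.min d d1) (d2 / (nc c + 1))).
      by rewrite !lt_min d0 d10 divr_gt0.
    move=> h; rewrite !lt_min => /andP[/andP[hd h1]]; rewrite ltr_pdivlMr // => h2.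
    have O1 : Om (z + h *: en R j) by apply: H1; rewrite vnZ vn_en mulr1.
    have O2 : Om (c *: (z + h *: en R j)).
      rewrite scalerDr; apply: H2; rewrite !vnZ vn_en mulr1.
      by apply: le_lt_trans h2; rewrite mulrC ler_wpM2l ?nc_ge0 //; lra.
    have E h' : c *: z + h' *: (c *: en R j) = c *: (z + h' *: en R j).
      by rewrite scalerDr !scalerA mulrC.
    rewrite !E add0r scale0r addr0 !Hom // -mulrA -!mulrBr ncM.
    have := Hd h hd; rewrite add0r scale0r addr0 mulrAC ler_pdivlMr // => H.
    by apply: le_trans H; rewrite mulrC ler_wpM2l ?nc_ge0 //; lra.
  have := cdiff_uniq e1 e3; rewrite linZ !lin_en exprS -mulrA => /(mulfI c0) ->.
  by [].
have /choice[q Hq] : forall j, exists p, forall z, Om z -> D z 0 j = poly_eval p z.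
  move=> j; apply: IH => [z Oz|c z c0 Oz Ocz]; first exact: Dhol.
  by rewrite Dhom // mxE.
exists (k.+1%:R^-1 *: \sum_j mpolyX R[i] (mnm1 j) * q j) => z Oz.
rewrite poly_evalZ poly_eval_sum.
have -> : \sum_j poly_eval (mpolyX R[i] (mnm1 j) * q j) z = lin (D z) z.
  by rewrite linE; apply: eq_bigr => j _; rewrite poly_evalM poly_evalX Hq // mulrC.
have e1 : cdiff_with (fun t => G (0 + t *: z)) 1 (lin (D z) z).
  by apply: hol_line; rewrite scale1r add0r; exact: HD.
have e2 : cdiff_with (fun t => G (0 + t *: z)) 1 (k.+1%:R * G z).
  move=> e e0; have [d d0 Hd] := cdiff_pow k.+1 (G z) e0.
  have [d1 d10 H1] := Om_open Oz; have z1 : 0 < vn z + 1 by have := vn_ge0 z; lra.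
  exists (Num.min (Num.min d (d1 / (vn z + 1))) (1 / 2)).
    by rewrite !lt_min d0 !divr_gt0.
  move=> h; rewrite !lt_min => /andP[/andP[/Hd hd]]; rewrite ltr_pdivlMr // => h1 h2.
  have O1 : Om ((1 + h) *: z).
    rewrite scalerDl scale1r; apply: H1; rewrite vnZ.
    by apply: le_lt_trans h1; rewrite ler_wpM2l ?nc_ge0 //; lra.
  have h0 : 1 + h != 0.
    by rewrite -nc_gt0; have := nc_lowerD 1 h; rewrite nc1; lra.
  by rewrite !add0r Hom // scale1r; move: hd; rewrite expr1n mul1r.
by rewrite (cdiff_uniq e1 e2) mulKf // pnatr_eq0.
Qed.

(** The closed disc [{w *: z0 | nc w <= 1}] is compact in [Om]; local bounds
    around its points give a bound for all nearby discs, even slightly larger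
    ones. *)
Lemma hol_tube (F : V -> R[i]) z0 : (forall z, Om z -> hol F z) -> Om z0 ->
  exists r M : R, [/\ 1 < r, 0 < M & exists2 d : R, 0 < d &
    forall z, vn (z - z0) < d -> forall w, nc w <= r -> Om (w *: z) /\ nc (F (w *: z)) <= M].
Proof.
move=> HF O0.
have [||d d0 H] := @disc_gauge R 1 (fun w d => forall z, vn (z - z0) < d ->
  forall w', nc (w' - w) < d -> Om (w' *: z) /\ nc (F (w' *: z)) <= d^-1).
- move=> x d d' H d'0 d'd z zd w wd.
  have [||h1 h2] := H z _ w; try exact: lt_le_trans d'd.
  split=> //; apply: le_trans h2 _; rewrite lef_pV2 ?posrE //; exact: lt_le_trans d'd.
- move=> x x1; have Ox : Om (x *: z0) by exact: Om_star.
  have [M [d1 d10 H1]] := hol_bounded (HF _ Ox); have [d2 d20 H2] := Om_open Ox.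
  have M0 : 0 <= M by apply: le_trans (nc_ge0 (F (x *: z0))) _; apply: H1; rewrite subrr vn0.
  have v0 := vn_ge0 z0.
  pose m := Num.min d1 d2; have m0 : 0 < m by rewrite lt_min d10.
  pose d := Num.min (Num.min 1 (m / (4 + 2 * vn z0))) (M + 1)^-1.
  have q0 : 0 < 4 + 2 * vn z0 by lra.
  have M1 : 0 < M + 1 by lra.
  have d0 : 0 < d by rewrite !lt_min ltr01 divr_gt0 ?invr_gt0.
  have dl1 : d <= 1 by rewrite !ge_min lexx.
  have dm : d * (4 + 2 * vn z0) <= m by rewrite -ler_pdivlMr // !ge_min lexx orbT.
  have dM : d <= (M + 1)^-1 by rewrite !ge_min lexx orbT.
  exists d => // w w1 wx z zd w' w'd.
  have close : vn (w' *: z - x *: z0) < m.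
    have -> : w' *: z - x *: z0 = w' *: (z - z0) + (w' - x) *: z0.
      by rewrite scalerBr scalerBl addrA subrK.
    have k1 : nc (w' - x) < 2 * d by apply: le_lt_trans (nc_subD _ w _) _; lra.
    have k2 : nc w' <= 2.
      have -> : w' = (w' - w) + w by ring.
      by apply: le_trans (ncD _ _) _; lra.
    apply: le_lt_trans (vnD _ _) _; rewrite !vnZ; apply: lt_le_trans dm.
    have := vn_ge0 (z - z0); have := nc_ge0 w'; have := nc_ge0 (w' - x); nra.
  have m1 : m <= d1 by rewrite ge_min lexx.
  have m2 : m <= d2 by rewrite ge_min lexx orbT.
  split; first by have := H2 _ (lt_le_trans close m2); rewrite addrC subrK.
  apply: le_trans (H1 _ (lt_le_trans close m1)) _.
  apply: le_trans (_ : M + 1 <= _); first lra.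
  by rewrite -[leLHS]invrK lef_pV2 ?posrE ?invr_gt0.
exists (1 + d / 2), d^-1; split; [lra|by rewrite invr_gt0|exists d => // z zd w wd].
have r0 : 0 < 1 + d / 2 by lra.
have ncr : nc (1 + d / 2)%:C = 1 + d / 2 by rewrite nc_real gtr0_norm.
have rC : (1 + d / 2)%:C != 0 :> R[i] by rewrite -nc_gt0 ncr.
apply: (H (w / (1 + d / 2)%:C)) => //; rewrite ?ncM ?ncV ?ncr.
  by rewrite ler_pdivrMr // mul1r.
have -> : w - w / (1 + d / 2)%:C = (d / 2)%:C * (w / (1 + d / 2)%:C).
  have : (d / 2)%:C = (1 + d / 2)%:C - 1 :> R[i] by rewrite rmorphD rmorph1 addrC addKr.
  move: rC => + ->; move: (1 + d / 2)%:C => x x0; by field.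
rewrite !ncM ncV ncr nc_real gtr0_norm ?divr_gt0 //.
have : nc w / (1 + d / 2) <= 1 by rewrite ler_pdivrMr // mul1r.
have : 0 <= nc w / (1 + d / 2) by rewrite divr_ge0 ?nc_ge0 // ltW.
nra.
Qed.

Lemma hol_mean (F : V -> R[i]) (c : nat) N z :
  (forall w, nc w = 1 -> hol F (w *: z)) ->
  hol (fun y => mean N (fun w => F (w *: y) * w ^- c)) z.
Proof.
move=> HF; apply: holZ; rewrite /mean.
have : forall j : 'I_N, hol (fun y => F (omega R N ^+ j *: y) * omega R N ^+ j ^- c) z.
  move=> j; have := holZ (omega R N ^+ j ^- c) (hol_scale (HF _ (nc_omegaX R N j))).
  by move=> H; apply: hol_near H _; exists 1 => // h _; rewrite mulrC.
by move=> H; apply: hol_sum.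
Qed.

(** The coefficients of the expansion of [fun w => F (w *: z)] in powers of
    [w] are holomorphic in [z], being locally uniform limits of means over
    rotations, and homogeneous, by uniqueness of the expansion; so they are
    polynomials. Discs slightly larger than the unit disc provide the
    geometric rate. *)
Lemma homogeneous_expansion (F : V -> R[i]) : (forall z, Om z -> hol F z) ->
  exists Fk : nat -> mpoly n R[i],
  [/\ forall z0, Om z0 -> exists M s : R, [/\ 0 <= M, 0 <= s, s < 1 &
        exists2 d : R, 0 < d & forall z, vn (z - z0) < d ->
          Om z /\ forall k, nc (poly_eval (Fk k) z) <= M * s ^+ k],
      forall z, Om z -> climit (fun K => \sum_(k < K) poly_eval (Fk k) z) (F z) &
      forall z k, Om z ->
        climit (fun N => mean N (fun w => F (w *: z) * w ^- k)) (poly_eval (Fk k) z)].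
Proof.
move=> HF.
have slice z w : Om (w *: z) -> exists d, cdiff_with (fun x => F (x *: z)) w d.
  move=> /HF [L HL]; exists (lin L z).
  have := @hol_line R n F 0 z w L; rewrite add0r => /(_ HL) H e /H [d d0 Hd].
  by exists d => // h /Hd; rewrite !add0r.
have tube z0 : Om z0 -> exists r M : R, [/\ 1 < r, 0 < M & exists2 d : R, 0 < d &
    forall z, vn (z - z0) < d -> Om z /\ exists a, has_exp (fun w => F (w *: z)) a M r].
  move=> O0; have [r [M [r1 M0 [d d0 H]]]] := hol_tube HF O0.
  exists ((1 + r) / 2), M; split=> //; first lra.
  exists d => // z zd; split; first by have [|] := H z zd 1; rewrite ?nc1 ?scale1r // ltW.
  apply: (@cdiff_has_exp _ _ _ r) => [||w wr|w wr]; try lra.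
    by apply: slice; have [] := H z zd w wr.
  by have [|_ ->] := H z zd w; lra.
have /choice[a Ha] : forall z, exists a, Om z ->
    exists M r, 1 < r /\ has_exp (fun w => F (w *: z)) a M r.
  move=> z; have [Oz|nz] := pselect (Om z); last by exists (fun=> 0).
  have [r [M [r1 M0 [d d0 H]]]] := tube z Oz.
  have [|_ [a Ha]] := H z; first by rewrite subrr vn0.
  by exists a => _; exists M, r.
have aE z b M r : Om z -> 1 < r -> has_exp (fun w => F (w *: z)) b M r -> b = a z.
  move=> Oz r1 Hb; have [M' [r' [r'1 Ha']]] := Ha z Oz.
  by apply: has_exp_uniq Hb Ha' ltr01 r1 r'1 _.
have tube2 z0 : Om z0 -> exists r M : R, [/\ 1 < r, 0 < M & exists2 d : R, 0 < d &
    forall z, vn (z - z0) < d -> Om z /\ has_exp (fun w => F (w *: z)) (a z) M r].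
  move=> /tube[r [M [r1 M0 [d d0 H]]]]; exists r, M; split=> //; exists d => // z /H[Oz [b Hb]].
  by split=> //; rewrite -(aE z b M r).
have mean1 z k : Om z ->
    climit (fun N => mean N (fun w => F (w *: z) * w ^- k)) (a z k).
  move=> Oz; have [M [r [r1 Hz]]] := Ha z Oz.
  have := exp_climit k Hz ltr01 r1; rewrite expr1n mulr1 => H e /H [N HN]; exists N => m /HN.
  by rewrite (@eq_mean _ m _ (fun w => F (w *: z) * w ^- k)) // => w _; rewrite mul1r.
have hola k z0 : Om z0 -> hol (fun z => a z k) z0.
  move=> O0; have [r [M [r1 M0 [d d0 H]]]] := tube2 z0 O0.
  apply: (@hol_unif_limit _ _ _ _ (d / 2)) => [|e e0]; first lra.
  have r0 : 0 < r by lra.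
  have s1 : r^-1 < 1 by rewrite invf_lt1.
  have s0 : 0 <= r^-1 by rewrite invr_ge0 ltW.
  have q0 : 0 < e * (1 - r^-1) / M by rewrite divr_gt0 // mulr_gt0 // subr_gt0.
  have [N0 HN0] := expr_small s0 s1 q0.
  pose N := maxn N0 k.+1.
  exists (fun z => mean N (fun w => F (w *: z) * w ^- k)) => y yz.
  have [|Oy Hy] := H y; first lra.
  split; first by apply: hol_mean => w w1; apply: HF; apply: Om_star; rewrite ?w1.
  have := exp_coef_mean Hy ltr01 r1 (ltW M0) (leq_maxr N0 k.+1).
  rewrite expr1n mulr1 ncB -/N div1r => h.
  rewrite (@eq_mean _ N _ (fun w => F (1 * w *: y) * w ^- k)); last by move=> w _; rewrite mul1r.
  apply: le_trans h _; rewrite ler_pdivrMr ?subr_gt0 // mulrC.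
  by rewrite -ler_pdivlMr //; apply: HN0; exact: leq_maxl.
have homa k c z : c != 0 -> Om z -> Om (c *: z) -> a (c *: z) k = c ^+ k * a z k.
  move=> c0 Oz Ocz; have [M [r [r1 Hz]]] := Ha z Oz; have [M' [r' [r'1 Hcz]]] := Ha _ Ocz.
  have nc0' : 0 < nc c by rewrite nc_gt0.
  have Hs : has_exp (fun w => F (w *: (c *: z))) (fun k => c ^+ k * a z k) M (r / nc c).
    have [h1 h2] := Hz; split=> [j|K w].
      have -> : M / (r / nc c) ^+ j = nc c ^+ j * (M / r ^+ j).
        by rewrite expr_div_n invf_div mulrCA.
      by rewrite ncM ncX ler_wpM2l ?exprn_ge0 ?nc_ge0 //; exact: h1.
    rewrite ltr_pdivlMr // => wr; have := h2 K (w * c); rewrite ncM => /(_ wr).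
    rewrite scalerA invf_div mulrA.
    rewrite (eq_bigr (fun j : 'I_K => c ^+ j * a z j * w ^+ j)) // => j _.
    by rewrite exprMn; by ring.
  have r0 : 0 < r by lra.
  pose t := Num.min 1 (r / nc c) / 2.
  have m0 : 0 < Num.min 1 (r / nc c) by rewrite lt_min ltr01 divr_gt0.
  have t0 : 0 < t by rewrite divr_gt0.
  have t1 : t < r'.
    have : Num.min 1 (r / nc c) <= 1 by rewrite ge_min lexx.
    by rewrite /t; lra.
  have t2 : t < r / nc c.
    have : Num.min 1 (r / nc c) <= r / nc c by rewrite ge_min lexx orbT.
    by rewrite /t; lra.
  by rewrite (has_exp_uniq Hcz Hs t0 t1 t2 (fun w _ => erefl)).
have /choice[Fk HFk] : forall k, exists p, forall z, Om z -> a z k = poly_eval p z.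
  move=> k; apply: (hol_homog_poly (k := k)) => [z|c z]; first exact: hola.
  exact: homa.
exists Fk; split=> [z0 /tube2[r [M [r1 M0 [d d0 H]]]]|z Oz|z k Oz].
- exists M, r^-1; split; rewrite ?invr_ge0 ?invf_lt1 //; try lra.
  exists d => // z /H[Oz [h _]]; split=> // k.
  by rewrite -HFk // exprVn; exact: h.
- have [M [r [r1 Hz]]] := Ha z Oz; have [_ h] := Hz.
  have r0 : 0 < r by lra.
  have M0 : 0 <= M by apply: has_exp_M Hz.
  have s1 : r^-1 < 1 by rewrite invf_lt1.
  apply: (@climit_geom R _ _ (M / (1 - r^-1)) r^-1 0%N) => //.
  + by rewrite divr_ge0 // subr_ge0 ltW.
  + by rewrite invr_ge0 ltW.
  move=> K _; have := h K 1; rewrite nc1 scale1r => /(_ r1).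
  rewrite ncB div1r mulrAC; congr (nc (_ - _) <= _).
  by apply: eq_bigr => j _; rewrite expr1n mulr1 HFk.
- rewrite -HFk //; exact: mean1.
Qed.
End HomogeneousExpansion.

(** * Divisibility by linear forms *)

Section LinearFactors.
Variables (R : realType) (n : nat).
Local Notation V := 'cV[R[i]]_n.
Implicit Types (z h v u : V) (p q : mpoly n R[i]) (L : 'rV[R[i]]_n).

(** Along the projection of [z] to the hyperplane in the direction [v] the
    value changes by a multiple of [lin L z]. *)
Lemma poly_div_lin p L v : lin L v = 1 ->
  (forall z, lin L z = 0 -> poly_eval p z = 0) ->
  exists q, forall z, poly_eval p z = lin L z * poly_eval q z.
Proof.
move=> Lv H.
suff gen : exists q, forall z,
    poly_eval p z - poly_eval p (z - lin L z *: v) = lin L z * poly_eval q z.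
  have [q Hq] := gen; exists q => z; rewrite -Hq [X in _ - X]H ?subr0 //.
  by rewrite -scaleN1r linD !linZ Lv; by ring.
elim/mpoly_ring_ind: {H} p => [c|j|p q [P HP] [Q HQ]|p q [P HP] [Q HQ]].
- by exists (mpolyC n 0) => z; rewrite !poly_evalC subrr mulr0.
- exists (mpolyC n (v j 0)) => z; rewrite !poly_evalX poly_evalC !mxE; by ring.
- exists (P + Q) => z; rewrite !poly_evalD mulrDr -HP -HQ; by ring.
- exists (P * q + (p - linp L * P) * Q) => z.
  rewrite !(poly_evalD, poly_evalM, poly_evalN) linpE.
  transitivity ((lin L z * poly_eval P z) * poly_eval q z
    + (poly_eval p z - lin L z * poly_eval P z) * (lin L z * poly_eval Q z)); last by ring.
  by rewrite -HP -HQ; by ring.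
Qed.

Definition subspace_pred (W : V -> Prop) : Prop :=
  forall z v t, W z -> W v -> W (z + t *: v).

Lemma subspace_ker L : subspace_pred (fun z => lin L z = 0).
Proof. by move=> z v t Hz Hv; rewrite linD linZ Hz Hv mulr0 addr0. Qed.

(** On a line in direction [v] the form is a polynomial of degree one, hence
    not a zero divisor. *)
Lemma lin_cancel (W : V -> Prop) L v p : subspace_pred W -> W v -> lin L v != 0 ->
  (forall z, W z -> lin L z * poly_eval p z = 0) -> forall z, W z -> poly_eval p z = 0.
Proof.
move=> Wlin Wv Lv H z Wz; have [P HP] := poly_line p z v.
have := HP 0; rewrite scale0r addr0 => ->.
suff -> : P = 0 by rewrite horner0.
have : ((lin L z)%:P + lin L v *: 'X) * P = 0.
  apply: (@poly1_eq0 R _ 1) => // t _ _; rewrite hornerM -HP !hornerE.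
  by have := H _ (Wlin z v t Wz Wv); rewrite linD linZ [t * _]mulrC.
move/eqP; rewrite mulf_eq0 => /orP[|/eqP //] /eqP /(congr1 (fun Q : {poly _} => Q`_1)).
by rewrite coefD coefC coefZ coefX coef0 /= add0r mulr1 => /eqP; rewrite (negbTE Lv).
Qed.

Lemma lin_exp_cancel (W : V -> Prop) L v p k : subspace_pred W -> W v -> lin L v != 0 ->
  (forall z, W z -> lin L z ^+ k * poly_eval p z = 0) -> forall z, W z -> poly_eval p z = 0.
Proof.
move=> Wlin Wv Lv; elim: k p => [|k IH] p H z Wz; first by rewrite -[LHS]mul1r -(expr0 (lin L z)) H.
apply: (lin_cancel Wlin Wv Lv) Wz => {}z Wz.
have := IH (linp L * p) _ z Wz; rewrite poly_evalM linpE; apply=> {Wz}z Wz.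
by rewrite poly_evalM linpE mulrA -exprSr H.
Qed.

Lemma prod_cancel (W : V -> Prop) (I : eqType) (s : seq I) (ell : I -> 'rV[R[i]]_n) (c : I -> nat) p :
  subspace_pred W -> (forall i, i \in s -> exists2 v, W v & lin (ell i) v != 0) ->
  (forall z, W z -> (\prod_(i <- s) lin (ell i) z ^+ c i) * poly_eval p z = 0) ->
  forall z, W z -> poly_eval p z = 0.
Proof.
move=> Wlin; elim: s p => [|i s IH] p Hs H z Wz.
  by have := H z Wz; rewrite big_nil mul1r.
apply: IH z Wz => [j js|z Wz]; first by apply: Hs; rewrite inE js orbT.
have [v Wv Lv] := Hs i (mem_head _ _).
pose q := (\prod_(j <- s) linp (ell j) ^+ c j) * p.
have qE y : poly_eval q y = (\prod_(j <- s) lin (ell j) y ^+ c j) * poly_eval p y.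
  rewrite poly_evalM poly_eval_prod; congr (_ * _); apply: eq_bigr => j _.
  by rewrite poly_evalXn linpE.
rewrite -qE; apply: (@lin_exp_cancel W (ell i) v q (c i)) Wz => // {}z Wz.
by rewrite qE mulrA; have := H z Wz; rewrite big_cons.
Qed.

(** The hypothesis on [A] says that it is not a zero divisor modulo the linear
    form; the powers of the form are then cancelled one at a time. *)
Lemma coprime_div (A g e : mpoly n R[i]) L v k : lin L v = 1 ->
  (forall p, (forall z, lin L z = 0 -> poly_eval A z * poly_eval p z = 0) ->
     forall z, lin L z = 0 -> poly_eval p z = 0) ->
  (forall z, poly_eval A z * poly_eval g z = lin L z ^+ k * poly_eval e z) ->
  exists q, forall z, poly_eval g z = lin L z ^+ k * poly_eval q z.
Proof.
move=> Lv cop; elim: k g => [|k IH] g H; first by exists g => z; rewrite expr0 mul1r.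
have [|q Hq] := poly_div_lin (p := g) Lv.
  by apply: cop => z Lz; rewrite H Lz expr0n mul0r.
have [|q' Hq'] := IH q.
  move=> z; apply/eqP; rewrite -subr_eq0; apply/eqP.
  have E y : poly_eval (A * q - linp L ^+ k * e) y =
      poly_eval A y * poly_eval q y - lin L y ^+ k * poly_eval e y.
    by rewrite !(poly_evalD, poly_evalN, poly_evalM, poly_evalXn) linpE.
  rewrite -E; apply: (@lin_cancel (fun=> True) L v) => //; first by rewrite Lv oner_eq0.
  move=> y _; rewrite E; have := H y; rewrite Hq exprS => Hy.
  transitivity (poly_eval A y * (lin L y * poly_eval q y)
    - lin L y * lin L y ^+ k * poly_eval e y); first by ring.
  by rewrite Hy subrr.
by exists q' => z; rewrite Hq Hq' exprS mulrA.
Qed.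

Lemma det_rank1 (u : V) L : \det (1%:M + u *m L) = 1 + lin L u.
Proof.
have h : block_mx 1%:M 0 (- u) 1%:M *m block_mx 1%:M L 0 (1%:M + u *m L) =
         block_mx (1%:M + L *m u) L 0 1%:M *m block_mx 1%:M 0 (- u) 1%:M :> 'M[R[i]]_(1 + n).
  rewrite !mulmx_block !(mul1mx, mulmx1, mul0mx, mulmx0, addr0, add0r).
  by rewrite mulmxN mulNmx addrK [- _ + _]addrC addrK.
have := congr1 determinant h.
rewrite !det_mulmx !det_ublock !det_lblock !det1 !mul1r !mulr1 => ->.
by rewrite det_mx11 !mxE eqxx /lin !mxE.
Qed.

Lemma rank1_form (A : 'M[R[i]]_n) L v : lin L v = 1 ->
  (forall z, lin L z = 0 -> A *m z = z) ->
  exists u, A = 1%:M + u *m L /\ forall z, A *m z = z + lin L z *: u.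
Proof.
move=> Lv H; exists (A *m v - v).
have key z : A *m z = z + lin L z *: (A *m v - v).
  have {1}-> : z = (z - lin L z *: v) + lin L z *: v by rewrite subrK.
  rewrite mulmxDr H; last by rewrite -scaleN1r linD !linZ Lv; by ring.
  by rewrite -scalemxAr scalerBr [in RHS]addrCA addrC; congr (_ + _); rewrite addrC.
split=> //; apply/matrixP => i j; have := congr1 (fun y : V => y i 0) (key (en R j)).
rewrite lin_en /en -colE mxE => ->; rewrite mxE [in RHS]mxE; congr (_ + _).
  by rewrite !mxE andbT.
by rewrite [in RHS]mxE big_ord1 [in LHS]mxE mulrC.
Qed.

(** One factor at a time: after [k < c] factors the quotient is multiplied by
    [zeta ^+ (c - k)] under the reflection, which is not [1] by minimality, so
    the quotient vanishes on the mirror. *)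
Lemma reflection_div (f : mpoly n R[i]) (A : 'M[R[i]]_n) L v u (c : nat) :
  lin L v = 1 -> (forall z, A *m z = z + lin L z *: u) ->
  let zeta := 1 + lin L u in
  (forall z, poly_eval f (A *m z) = zeta ^+ c * poly_eval f z) -> zeta != 0 ->
  (forall m, zeta ^+ c = zeta ^+ m -> (c <= m)%N) ->
  exists g, forall z, poly_eval f z = lin L z ^+ c * poly_eval g z.
Proof.
move=> Lv HA zeta Hf z0 Hc.
suff gen k : (k <= c)%N -> exists g, forall z, poly_eval f z = lin L z ^+ k * poly_eval g z.
  exact: gen.
elim: k => [|k IH] kc; first by exists f => z; rewrite expr0 mul1r.
have [g Hg] := IH (ltnW kc).
have LA z : lin L (A *m z) = zeta * lin L z by rewrite HA linD linZ /zeta; by ring.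
have cancel (p : mpoly n R[i]) : (forall z, lin L z ^+ k * poly_eval p z = 0) -> forall z, poly_eval p z = 0.
  move=> H z; apply: (@lin_exp_cancel (fun=> True) L v p k) => //.
  by rewrite Lv oner_eq0.
have [gA HgA] := poly_comp_mx g A.
have gE z : poly_eval g (A *m z) = zeta ^+ (c - k) * poly_eval g z.
  apply/eqP; rewrite -subr_eq0 -HgA; apply/eqP.
  have E y : poly_eval (gA - zeta ^+ (c - k) *: g) y =
      poly_eval g (A *m y) - zeta ^+ (c - k) * poly_eval g y.
    by rewrite poly_evalD poly_evalN poly_evalZ HgA.
  rewrite HgA -E; apply: cancel => {}z; rewrite E.
  apply: (mulfI (expf_neq0 k z0)); rewrite mulr0.
  transitivity ((zeta * lin L z) ^+ k * poly_eval g (A *m z)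
     - (zeta ^+ (c - k) * zeta ^+ k) * (lin L z ^+ k * poly_eval g z)).
    by rewrite exprMn; by ring.
  by rewrite -LA -Hg -exprD subnK ?(ltnW kc) // -Hg Hf subrr.
have [|q Hq] := poly_div_lin (p := g) Lv.
  move=> z Lz; have := gE z; rewrite HA Lz scale0r addr0 => /eqP.
  rewrite -subr_eq0 -{1}[poly_eval g z]mul1r -mulrBl mulf_eq0 => /orP[|/eqP //].
  rewrite subr_eq0 => /eqP z1.
  have := Hc k; rewrite -{1}(subnK (ltnW kc)) exprD -z1 mul1r => /(_ erefl).
  by rewrite leqNgt kc.
by exists q => z; rewrite Hg Hq exprSr mulrA.
Qed.
End LinearFactors.

(** * Relative invariants of reflection groups *)

Section ReflectionGroups.
Variables (R : realType) (n : nat) (gT : finGroupType) (G : {group gT}).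
Variable rG : mx_representation R[i] G n.
Local Notation V := 'cV[R[i]]_n.
Implicit Types (z v u : V) (p q : mpoly n R[i]) (L : 'rV[R[i]]_n) (g h s : gT).

Lemma act1 z : rG 1%g *m z = z.
Proof. by rewrite repr_mx1 mul1mx. Qed.

Lemma actM g h z : g \in G -> h \in G -> rG (g * h)%g *m z = rG g *m (rG h *m z).
Proof. by move=> gG hG; rewrite repr_mxM // mulmxA. Qed.

Lemma actVK g z : g \in G -> rG g^-1%g *m (rG g *m z) = z.
Proof. by move=> gG; rewrite -actM ?groupV // mulVg act1. Qed.

Lemma actKV g z : g \in G -> rG g *m (rG g^-1%g *m z) = z.
Proof. by move=> gG; rewrite -actM ?groupV // mulgV act1. Qed.

Lemma hyperplaneE L z : hyperplane L z <-> lin L z = 0.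
Proof.
rewrite /hyperplane /lin /=; split=> [->|H]; first by rewrite mxE.
by apply/matrixP => i j; rewrite !ord1 H mxE.
Qed.

Lemma det_actM g h : g \in G -> h \in G -> \det (rG (g * h)%g) = \det (rG g) * \det (rG h).
Proof. by move=> gG hG; rewrite repr_mxM // det_mulmx. Qed.

Lemma det_act_neq0 g : g \in G -> \det (rG g) != 0.
Proof. by move=> /(repr_mx_unit rG); rewrite unitmxE unitfE. Qed.

Lemma det_actX g k : g \in G -> \det (rG (g ^+ k)%g) = \det (rG g) ^+ k.
Proof.
move=> gG; elim: k => [|k IH]; first by rewrite expg0 expr0 repr_mx1 det1.
by rewrite expgS det_actM ?groupX // IH exprS.
Qed.

Lemma det_actJ g h : g \in G -> h \in G -> \det (rG (g ^ h)%g) = \det (rG g).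
Proof.
move=> gG hG; rewrite conjgE !det_actM ?groupM ?groupV // mulrCA -det_actM ?groupV //.
by rewrite mulVg repr_mx1 det1 mulr1.
Qed.

Variable rho : mx_representation R[i] G 1.

Lemma chi1 : chi rho 1%g = 1.
Proof. by rewrite /chi repr_mx1 mxtrace1. Qed.

Lemma chiM g h : g \in G -> h \in G -> chi rho (g * h)%g = chi rho g * chi rho h.
Proof.
by move=> gG hG; rewrite /chi repr_mxM // /mxtrace !big_ord1 mxE big_ord1.
Qed.

Lemma chiX g k : g \in G -> chi rho (g ^+ k)%g = chi rho g ^+ k.
Proof.
move=> gG; elim: k => [|k IH]; first by rewrite expg0 expr0 chi1.
by rewrite expgS chiM ?groupX // IH exprS.
Qed.

Lemma chiV g : g \in G -> chi rho g^-1%g * chi rho g = 1.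
Proof. by move=> gG; rewrite -chiM ?groupV // mulVg chi1. Qed.

Lemma chi_neq0 g : g \in G -> chi rho g != 0.
Proof.
move=> gG; apply: contraTneq (oner_neq0 R[i]) => c0.
by rewrite -(chiV gG) c0 mulr0 eqxx.
Qed.

Lemma chiJ g h : g \in G -> h \in G -> chi rho (g ^ h)%g = chi rho g.
Proof.
move=> gG hG; rewrite conjgE !chiM ?groupM ?groupV // mulrCA -chiM ?groupV //.
by rewrite mulVg chi1 mulr1.
Qed.

Variables (t : nat) (ell : 'I_t -> 'rV[R[i]]_n) (a : 'I_t -> gT).
Hypothesis hell : reflecting_hyperplanes rG ell a.

Lemma complex_reflectionJ s g : s \in G -> g \in G ->
  complex_reflection (rG s) -> complex_reflection (rG (s ^ g)%g).
Proof.
move=> sG gG [[m m0 sm] rk].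
have gJ : (s ^ g)%g \in G by rewrite groupJ.
have iterE x k : x \in G -> rG (x ^+ k)%g = rG x ^+ k.
  move=> xG; elim: k => [|k IH]; first by rewrite expg0 expr0 repr_mx1.
  by rewrite expgS repr_mxM ?groupX // IH exprS.
split; first by exists #[(s ^ g)%g]%g; rewrite ?order_gt0 // -iterE // expg_order repr_mx1.
have -> : 1%:M - rG (s ^ g)%g = rG g^-1%g *m (1%:M - rG s) *m rG g.
  rewrite mulmxBr mulmxBl mulmx1 -!repr_mxM ?groupM ?groupV // mulVg repr_mx1.
  by rewrite conjgE mulgA.
rewrite mxrankMfree ?repr_mx_free // -rk.
by rewrite (eqmxMfull (1%:M - rG s) (_ : row_full _)) // row_full_unit repr_mx_unit ?groupV.
Qed.

Lemma ell_normal i : exists v, lin (ell i) v = 1.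
Proof.
have [s [sG [_ rk] hs]] := rh_reflecting hell i.
have [v Lv] : exists v, lin (ell i) v != 0.
  apply: contrapT => nv; suff s1 : rG s = 1%:M.
    by move: rk; rewrite s1 subrr mxrank0.
  apply/matrixP => k l.
  have : hyperplane (ell i) (en R l).
    by apply/hyperplaneE; apply: contrapT => /eqP h; apply: nv; exists (en R l).
  rewrite hs /= => /(congr1 (fun y : V => y k 0)); rewrite /en -colE !mxE => ->.
  by rewrite andbT.
by exists ((lin (ell i) v)^-1 *: v); rewrite linZ mulVf.
Qed.

Lemma gen_in i : a i \in G.
Proof. by have [/(_ (cycle_id _)) []] := rh_generator hell i (a i). Qed.

Lemma gen_fix i z : lin (ell i) z = 0 -> rG (a i) *m z = z.
Proof.
have [/(_ (cycle_id _)) [_ H] _] := rh_generator hell i (a i).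
by move/hyperplaneE => Hz; exact: H.
Qed.

(** Otherwise the two forms would be proportional and the mirrors equal. *)
Lemma ell_generic i j : j != i -> exists2 v, lin (ell i) v = 0 & lin (ell j) v != 0.
Proof.
move=> ji; apply: contrapT => nv.
have [vi Hi] := ell_normal i; have [vj Hj] := ell_normal j.
have sub z : lin (ell i) z = 0 -> lin (ell j) z = 0.
  by move=> iz; apply: contrapT => /eqP jz; apply: nv; exists z.
have dec z : lin (ell j) z = lin (ell i) z * lin (ell j) vi.
  apply/eqP; rewrite -subr_eq0; apply/eqP.
  have : lin (ell j) (z - lin (ell i) z *: vi) = 0.
    by apply: sub; rewrite -scaleN1r linD !linZ Hi; by ring.
  by rewrite -scaleN1r linD !linZ => <-; by ring.
have n0 : lin (ell j) vi != 0.
  by apply: contra_eq_neq (dec vj) => ->; rewrite Hj mulr0 oner_eq0.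
case/eqP: ji; apply: (rh_distinct hell); apply/seteqP; split=> z /hyperplaneE Hz; apply/hyperplaneE.
  by have /eqP := dec z; rewrite Hz eq_sym mulf_eq0 (negbTE n0) orbF => /eqP.
by rewrite dec Hz mul0r.
Qed.

(** Conjugates of reflections are reflections, so a group element permutes the
    mirrors and rescales their equations. *)
Lemma mirror_perm g : g \in G -> exists pi : 'I_t -> 'I_t,
  [/\ injective pi,
      forall j z, lin (ell (pi j)) z = 0 <-> lin (ell j) (rG g *m z) = 0 &
      exists kap : 'I_t -> R[i], forall j z, lin (ell j) (rG g *m z) = kap j * lin (ell (pi j)) z].
Proof.
move=> gG.
have /choice[pi Hpi] : forall j, exists k,
    forall z, lin (ell k) z = 0 <-> lin (ell j) (rG g *m z) = 0.
  move=> j; have [s [sG sr hs]] := rh_reflecting hell j.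
  have sgG : (s ^ g)%g \in G by rewrite groupJ.
  have [k Hk] := rh_all hell sgG (complex_reflectionJ sG gG sr).
  exists k => z; rewrite -!hyperplaneE Hk hs /=.
  have -> : rG (s ^ g)%g *m z = rG g^-1%g *m (rG s *m (rG g *m z)).
    by rewrite conjgE -!actM ?groupM ?groupV // mulgA.
  split=> [E|->]; last by rewrite actVK.
  by rewrite -[in RHS]E actKV.
exists pi; split=> //.
  move=> j k jk; apply: (rh_distinct hell); apply/seteqP; split=> z /hyperplaneE Hz;
    apply/hyperplaneE; rewrite -(actKV z gG); apply/(Hpi _ _).1.
    by rewrite -jk; apply/Hpi; rewrite actKV.
  by rewrite jk; apply/Hpi; rewrite actKV.
have /choice[v Hv] : forall j, exists v, lin (ell (pi j)) v = 1 by move=> j; exact: ell_normal.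
exists (fun j => lin (ell j) (rG g *m v j)) => j z.
have /(Hpi _ _).1 : lin (ell (pi j)) (z - lin (ell (pi j)) z *: v j) = 0.
  by rewrite -scaleN1r linD !linZ Hv; by ring.
rewrite -scaleN1r mulmxDr -!scalemxAr linD !linZ => /eqP.
by rewrite mulN1r subr_eq0 => /eqP ->; rewrite mulrC.
Qed.

Variable c : 'I_t -> nat.
Hypothesis hc : forall i, least_exponent rG rho (a i) (c i).

(** The conjugate of [a k] fixes the mirror of [a j], so it is a power of [a
    j]; characters and determinants do not see the conjugation. *)
Lemma exponent_le g j k : g \in G ->
  (forall z, lin (ell k) z = 0 <-> lin (ell j) (rG g *m z) = 0) -> (c k <= c j)%N.
Proof.
move=> gG H; have [_ +] := hc k; apply.
have akG := gen_in k.
have : (a k ^ g^-1)%g \in <[a j]>%g.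
  apply/(rh_generator hell j); split=> [|z /hyperplaneE Hz]; first by rewrite groupJ ?groupV.
  have -> : rG (a k ^ g^-1)%g *m z = rG g *m (rG (a k) *m (rG g^-1%g *m z)).
    by rewrite conjgE invgK -!actM ?groupM ?groupV // mulgA.
  by rewrite gen_fix ?actKV //; apply/H; rewrite actKV.
move=> /cycleP[m Hm].
have E1 : chi rho (a k) = chi rho (a j ^+ m)%g by rewrite -Hm chiJ ?groupV.
have E2 : \det (rG (a k)) = \det (rG (a j ^+ m)%g) by rewrite -Hm det_actJ ?groupV.
have [Hj _] := hc j.
by rewrite E1 E2 chiX ?gen_in // det_actX ?gen_in // Hj -!exprM mulnC.
Qed.

Lemma exponent_eq g j k : g \in G ->
  (forall z, lin (ell k) z = 0 <-> lin (ell j) (rG g *m z) = 0) -> c k = c j.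
Proof.
move=> gG H; apply/eqP; rewrite eqn_leq (exponent_le gG H) /=.
apply: (@exponent_le g^-1%g); rewrite ?groupV // => z.
by have := H (rG g^-1%g *m z); rewrite actKV // => <-.
Qed.

Lemma ell_prodE z : ell_prod ell c z = \prod_(i < t) lin (ell i) z ^+ c i.
Proof. by []. Qed.

Lemma ell_prod_semi g : g \in G -> exists K, forall z, ell_prod ell c (rG g *m z) = K * ell_prod ell c z.
Proof.
move=> gG; have [pi [pinj Hpi [kap Hk]]] := mirror_perm gG.
exists (\prod_j kap j ^+ c j) => z; rewrite !ell_prodE.
rewrite [X in _ = _ * X](reindex_inj pinj) /= -big_split /=; apply: eq_bigr => j _.
by rewrite Hk exprMn (exponent_eq gG (Hpi j)).
Qed.

Lemma gen_form i : exists u, [/\ forall z, rG (a i) *m z = z + lin (ell i) z *: u,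
  \det (rG (a i)) = 1 + lin (ell i) u &
  forall z, lin (ell i) (rG (a i) *m z) = \det (rG (a i)) * lin (ell i) z].
Proof.
have [v Hv] := ell_normal i.
have [u [E Hu]] := rank1_form Hv (@gen_fix i).
have D : \det (rG (a i)) = 1 + lin (ell i) u by rewrite E det_rank1.
exists u; split=> // z; rewrite Hu linD linZ D; by ring.
Qed.

(** A generator multiplies the product by a constant and its own form by the
    determinant. It fixes its mirror pointwise, and the product of the other
    forms does not vanish identically there; so it multiplies that product by
    [1], which determines the constant. *)
Lemma ell_prod_gen i z : ell_prod ell c (rG (a i) *m z) = chi rho (a i) * ell_prod ell c z.
Proof.
have [K HK] := ell_prod_semi (gen_in i); rewrite HK; congr (_ * _).
have [v Hv] := ell_normal i; have [u [Hu _ LA]] := gen_form i.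
pose M (y : V) := \prod_(j < t | j != i) lin (ell j) y ^+ c j.
have split_ell y : ell_prod ell c y = lin (ell i) y ^+ c i * M y.
  by rewrite ell_prodE (bigD1 i).
pose MA := \prod_(j < t | j != i) linp (ell j *m rG (a i)) ^+ c j.
pose MP := \prod_(j < t | j != i) linp (ell j) ^+ c j.
have MAE y : poly_eval MA y = M (rG (a i) *m y).
  rewrite poly_eval_prod; apply: eq_bigr => j _; rewrite poly_evalXn linpE.
  by rewrite /lin mulmxA.
have MPE y : poly_eval MP y = M y.
  by rewrite poly_eval_prod; apply: eq_bigr => j _; rewrite poly_evalXn linpE.
set ze := \det (rG (a i)) in LA.
have [Hci _] := hc i; rewrite Hci -/ze.
have E y : ze ^+ c i * M (rG (a i) *m y) = K * M y.
  apply/eqP; rewrite -subr_eq0; apply/eqP.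
  have PE x : poly_eval (ze ^+ c i *: MA - K *: MP) x = ze ^+ c i * M (rG (a i) *m x) - K * M x.
    by rewrite poly_evalD poly_evalN !poly_evalZ MAE MPE.
  rewrite -PE; apply: (@lin_exp_cancel R n (fun=> True) (ell i) v _ (c i)) => //.
    by rewrite Hv oner_eq0.
  move=> x _; rewrite PE; have := HK x; rewrite !split_ell LA exprMn => H.
  transitivity (ze ^+ c i * lin (ell i) x ^+ c i * M (rG (a i) *m x)
     - K * (lin (ell i) x ^+ c i * M x)); first by ring.
  by rewrite H subrr.
have [y Ly My] : exists2 y, lin (ell i) y = 0 & M y != 0.
  apply: contrapT => nex; have /eqP := oner_neq0 R[i]; apply.
  have := @prod_cancel R n (fun y => lin (ell i) y = 0) _ [seq j <- index_enum 'I_t | j != i]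
    ell c (mpolyC n 1) (@subspace_ker _ _ _) _ _ 0 (lin0 _).
  rewrite poly_evalC; apply=> [j|y Ly]; first by rewrite mem_filter => /andP[ji _]; exact: ell_generic.
  rewrite poly_evalC mulr1 big_filter; apply: contrapT => /eqP My; apply: nex.
  by exists y.
by have := E y; rewrite gen_fix // => /(mulIf My).
Qed.

(** Stanley: it suffices to check the generators of the pointwise stabilizers
    of the mirrors, which together generate the group. *)
Lemma ell_prod_chi (hG : reflection_group rG) g z : g \in G ->
  ell_prod ell c (rG g *m z) = chi rho g * ell_prod ell c z.
Proof.
pose P g := `[< forall z, ell_prod ell c (rG g *m z) = chi rho g * ell_prod ell c z >].
pose H := [set g in G | P g].
have gH : group_set H.
  apply/group_setP; split=> [|x y].
    rewrite inE group1 /=; apply/asboolP => y; by rewrite act1 chi1 mul1r.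
  rewrite !inE => /andP[xG /asboolP Hx] /andP[yG /asboolP Hy]; rewrite groupM //=.
  by apply/asboolP => w; rewrite actM // Hx Hy chiM // mulrA.
have [_ gen] := hG; move=> gG.
have /fintype.subsetP /(_ g gG) : G \subset Group gH.
  apply: gen => s sG sr; have [i Hi] := rh_all hell sG sr.
  have : s \in <[a i]>%g.
    apply/(rh_generator hell i); split=> // w; rewrite Hi; exact.
  move=> /cycleP[m ->]; have agH : a i \in Group gH.
    by rewrite inE gen_in /=; apply/asboolP => w; exact: ell_prod_gen.
  by rewrite groupX.
by rewrite inE => /andP[_ /asboolP].
Qed.

Lemma ell_prod_cancel p : (forall z, ell_prod ell c z * poly_eval p z = 0) ->
  forall z, poly_eval p z = 0.
Proof.
move=> H z; apply: (@prod_cancel R n (fun=> True) _ (index_enum 'I_t) ell c) => //.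
- by move=> i _; have [v Hv] := ell_normal i; exists v => //; rewrite Hv oner_eq0.
- by move=> y _; exact: H.
Qed.

(** Each form divides to the required order, by the minimality of its
    exponent, and the forms of distinct mirrors are coprime. *)
Lemma ell_prod_div p : (forall g z, g \in G -> poly_eval p (rG g *m z) = chi rho g * poly_eval p z) ->
  exists q, forall z, poly_eval p z = ell_prod ell c z * poly_eval q z.
Proof.
move=> Hp.
suff gen (s : seq 'I_t) : uniq s -> exists q, forall z,
    poly_eval p z = (\prod_(i <- s) lin (ell i) z ^+ c i) * poly_eval q z.
  by have [|q Hq] := gen (index_enum 'I_t); [exact: index_enum_uniq|exists q].
elim: s => [_|i s IH /= /andP[si us]]; first by exists p => z; rewrite big_nil mul1r.
have [g Hg] := IH us.
have [v Hv] := ell_normal i; have [u [Hu D LA]] := gen_form i.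
have [Hci Hmin] := hc i.
have [e He] : exists e, forall z, poly_eval p z = lin (ell i) z ^+ c i * poly_eval e z.
  apply: (reflection_div (A := rG (a i)) (u := u) Hv) => //; rewrite -D.
  - by move=> z; rewrite Hp ?gen_in // Hci.
  - exact: det_act_neq0 (gen_in i).
  - by move=> m Em; apply: Hmin; rewrite Hci.
pose A := \prod_(j <- s) linp (ell j) ^+ c j.
have AE y : poly_eval A y = \prod_(j <- s) lin (ell j) y ^+ c j.
  by rewrite poly_eval_prod; apply: eq_bigr => j _; rewrite poly_evalXn linpE.
have [f Hf z Lz||q Hq] := @coprime_div R n A g e (ell i) v (c i) Hv.
- apply: (@prod_cancel R n (fun y => lin (ell i) y = 0) _ s ell c f (@subspace_ker _ _ _)) Lz.
    move=> j js; apply: ell_generic; by apply: contraNneq si => <-.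
  by move=> y Ly; rewrite -AE Hf.
- by move=> z; rewrite AE -Hg He.
by exists q => z; rewrite big_cons Hg Hq mulrA [X in X * _ = _]mulrC.
Qed.

(** The quotient by [ell_prod] is invariant because [ell_prod] transforms by
    the same character and can be cancelled. *)
Lemma relative_invariant_factor (hG : reflection_group rG) p :
  (forall g z, g \in G -> poly_eval p (rG g *m z) = chi rho g * poly_eval p z) ->
  exists2 q, invariant_poly rG q & forall z, poly_eval p z = ell_prod ell c z * poly_eval q z.
Proof.
move=> Hp; have [q Hq] := ell_prod_div Hp; exists q => // g gG z.
have [r Hr] := poly_comp_mx q (rG g).
apply/eqP; rewrite -subr_eq0 -Hr; apply/eqP.
have E y : poly_eval (r - q) y = poly_eval r y - poly_eval q y by rewrite poly_evalD poly_evalN.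
rewrite -E; apply: ell_prod_cancel => {}z; rewrite E Hr.
apply: (mulfI (chi_neq0 gG)); rewrite mulr0.
transitivity (chi rho g * ell_prod ell c z * poly_eval q (rG g *m z)
  - chi rho g * (ell_prod ell c z * poly_eval q z)); first by ring.
by rewrite -ell_prod_chi // -!Hq Hp // subrr.
Qed.
End ReflectionGroups.

(** * Surjectivity of the basic map *)

Lemma subM_split (A : comNzRingType) (a b c d : A) :
  b * (a - c) + c * (b - d) = a * b - c * d.
Proof. by ring. Qed.

Lemma horner_prod_root (A : comNzRingType) (I : finType) (Q : pred I) (F : I -> A) i :
  Q i -> (\prod_(k | Q k) ('X - (F k)%:P)).[F i] = 0.
Proof. by move=> Qi; rewrite horner_prod (bigD1 i) //= hornerXsubC subrr mul0r. Qed.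

Lemma map_split_poly (K : fieldType) (A : comNzRingType) (f : {rmorphism K -> A})
    (P : {poly K}) (s : seq K) (d : nat) (x : A) : P != 0 -> (size P <= d)%N ->
  P = lead_coef P *: \prod_(z <- s) ('X - z%:P) ->
  f (lead_coef P)^-1 * \sum_(k < d) f P`_k * x ^+ k = \prod_(z <- s) (x - f z).
Proof.
move=> P0 sP HP.
have -> : \sum_(k < d) f P`_k * x ^+ k = (map_poly f P).[x].
  rewrite (@horner_coef_wide _ d) ?size_map_poly //.
  by apply: eq_bigr => k _; rewrite coef_map.
rewrite [in X in _ * X]HP map_polyZ hornerZ mulrA -rmorphM mulVf ?lead_coef_eq0 // rmorph1 mul1r.
rewrite rmorph_prod horner_prod; apply: eq_bigr => z _.
by rewrite rmorphB /= map_polyX map_polyC hornerXsubC.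
Qed.

Section BasicMap.
Variables (R : realType) (n : nat) (gT : finGroupType) (G : {group gT}).
Variable rG : mx_representation R[i] G n.
Variable theta : n.-tuple (mpoly n R[i]).
Hypothesis htheta : basic_polynomials rG theta.
Local Notation V := 'cV[R[i]]_n.
Local Notation C := R[i].
Implicit Types (z w y : V) (p q b : mpoly n R[i]).

Lemma comp_basic q z : poly_eval (comp_mpoly theta q) z = poly_eval q (basic_map theta z).
Proof.
by rewrite /poly_eval comp_mpoly_meval; apply: meval_eq => j; rewrite mxE.
Qed.

Lemma basic_map_inv g z : g \in G -> basic_map theta (rG g *m z) = basic_map theta z.
Proof.
move=> gG; apply/colP => j; rewrite !mxE.
have inv : invariant_poly rG (tnth theta j).
  apply/(bp_generate htheta); exists (mpolyX R[i] (mnm1 j)).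
  by rewrite comp_mpolyXU (tnth_nth 0).
exact: inv.
Qed.

Lemma act_reindex (F : gT -> C) h : h \in G -> \sum_(g in G) F (g * h)%g = \sum_(g in G) F g.
Proof.
move=> hG; rewrite [RHS](reindex_inj (mulIg h)) /=.
by apply: eq_bigl => g; rewrite groupMr.
Qed.

Lemma average_basic p : exists q, forall z,
  poly_eval q (basic_map theta z) = #|G|%:R^-1 * \sum_(g in G) poly_eval p (rG g *m z).
Proof.
have /choice[pg Hpg] : forall g, exists q, forall z, poly_eval q z = poly_eval p (rG g *m z).
  by move=> g; exact: poly_comp_mx.
pose m : mpoly n C := #|G|%:R^-1 *: \sum_(g in G) pg g.
have mE z : poly_eval m z = #|G|%:R^-1 * \sum_(g in G) poly_eval p (rG g *m z).
  by rewrite poly_evalZ poly_eval_sum; congr (_ * _); apply: eq_bigr.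
have inv : invariant_poly rG m.
  move=> h hG z; rewrite !mE; congr (_ * _).
  rewrite -[RHS](act_reindex (fun g => poly_eval p (rG g *m z)) hG).
  by apply: eq_bigr => g gG; rewrite -actM.
have [q Hq] := (bp_generate htheta m).1 inv.
by exists q => z; rewrite -comp_basic -Hq mE.
Qed.

Definition is_ideal (I : mpoly n C -> Prop) : Prop :=
  [/\ I 0, forall p q, I p -> I q -> I (p + q) & forall p q, I p -> I (q * p)].

(** If all the ideals generated by [I] and one [X_j - x] were improper,
    multiplying the resulting relations would put [1] into [I]. *)
Lemma ideal_extend I j (s : seq C) : is_ideal I -> ~ I 1 ->
  I (\prod_(x <- s) (mpolyX C (mnm1 j) - mpolyC n x)) ->
  exists x I', [/\ is_ideal I', ~ I' 1, forall p, I p -> I' p &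
    I' (mpolyX C (mnm1 j) - mpolyC n x)].
Proof.
move=> [I0 ID IM] I1 Is; set X := mpolyX C (mnm1 j) in Is *.
apply: contrapT => nex.
have all1 x : exists b, I (1 - b * (X - mpolyC n x)).
  apply: contrapT => nb; apply: nex.
  exists x, (fun p => exists b, I (p - b * (X - mpolyC n x))); split.
  - split; first by exists 0; rewrite mul0r subr0.
      move=> p q [b Hb] [b' Hb']; exists (b + b').
      by have := ID _ _ Hb Hb'; congr I; by ring.
    by move=> p q [b Hb]; exists (q * b); have := IM _ q Hb; congr I; by ring.
  - by move=> [b Hb]; apply: nb; exists b.
  - by move=> p Ip; exists 0; rewrite mul0r subr0.
  - by exists 1; rewrite mul1r subrr.
have [b Hb] : exists b, I (1 - b * \prod_(x <- s) (X - mpolyC n x)).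
  elim: s {Is} => [|x s [b Hb]]; first by exists 1; rewrite big_nil mulr1 subrr.
  have [b' Hb'] := all1 x; exists (b * b'); rewrite big_cons.
  set Pi := \prod_(y <- s) _ in Hb *.
  by have := ID _ _ Hb (IM _ (b * Pi) Hb'); congr I; by ring.
by apply: I1; have := ID _ _ Hb (IM _ b Is); congr I; by ring.
Qed.

Section Fiber.
Variable w : V.

Definition fiber_ideal p : Prop :=
  exists b : 'I_n -> mpoly n C, p = \sum_i b i * (tnth theta i - mpolyC n (w i 0)).

Lemma fiber_is_ideal : is_ideal fiber_ideal.
Proof.
split.
- by exists (fun=> 0); rewrite big1 // => i _; rewrite mul0r.
- move=> p q [b ->] [b' ->]; exists (fun i => b i + b' i).
  by rewrite -big_split; apply: eq_bigr => i _; rewrite mulrDl.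
- move=> p q [b ->]; exists (fun i => q * b i).
  by rewrite mulr_sumr; apply: eq_bigr => i _; rewrite mulrA.
Qed.

(** Averaging a relation [1 = \sum b_i (theta_i - w_i)] over the group makes the
    coefficients polynomials in [theta]; algebraic independence then allows
    the substitution of [w] for [theta]. *)
Lemma fiber_proper : ~ fiber_ideal 1.
Proof.
move=> [b Hb].
have /choice[q Hq] : forall i, exists q, forall z,
  poly_eval q (basic_map theta z) = #|G|%:R^-1 * \sum_(g in G) poly_eval (b i) (rG g *m z).
  by move=> i; exact: average_basic.
pose Q : mpoly n C := \sum_i q i * (mpolyX C (mnm1 i) - mpolyC n (w i 0)) - 1.
have Gn0 : #|G|%:R != 0 :> C by rewrite pnatr_eq0 -lt0n cardG_gt0.
have e1 (z : V) : poly_eval 1 z = 1 :> C by exact: meval1.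
have QE y : poly_eval Q y = \sum_i poly_eval (q i) y * (y i 0 - w i 0) - 1.
  rewrite poly_evalD poly_evalN e1 poly_eval_sum; congr (_ - _); apply: eq_bigr => i _.
  by rewrite poly_evalM poly_evalD poly_evalN poly_evalX poly_evalC.
have Q0 : comp_mpoly theta Q = 0.
  apply: poly_eval_inj => z; rewrite comp_basic QE; apply/eqP; rewrite subr_eq0; apply/eqP.
  have rel g : g \in G -> 1 = \sum_i poly_eval (b i) (rG g *m z) * (basic_map theta z i 0 - w i 0).
    move=> gG; rewrite -(e1 (rG g *m z)) Hb poly_eval_sum; apply: eq_bigr => i _.
    by rewrite poly_evalM poly_evalD poly_evalN poly_evalC -(basic_map_inv z gG) [in RHS]mxE.
  have -> : (1 : C) = #|G|%:R^-1 * \sum_(g in G) 1.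
    by rewrite sumr_const mulVf.
  rewrite (eq_bigr _ rel) exchange_big mulr_sumr; apply: eq_bigr => i _.
  by rewrite Hq -mulrA mulr_suml.
have := bp_independent htheta Q0 => /(congr1 (fun p => poly_eval p w)).
rewrite QE big1 => [|i _]; last by rewrite subrr mulr0.
by rewrite sub0r -(mpolyC0 n C) poly_evalC => /eqP; rewrite oppr_eq0 oner_eq0.
Qed.

Lemma fiber_comp q : fiber_ideal (comp_mpoly theta q - mpolyC n (poly_eval q w)).
Proof.
have [I0 ID IM] := fiber_is_ideal.
elim/mpoly_ring_ind: q => [c|j|p q Hp Hq|p q Hp Hq].
- by rewrite comp_mpolyC poly_evalC subrr.
- rewrite comp_mpolyXU poly_evalX.
  exists (fun i => (i == j)%:R); rewrite (bigD1 j) //= eqxx mul1r big1 ?addr0 ?(tnth_nth 0) //.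
  by move=> i ij; rewrite (negbTE ij) mul0r.
- by rewrite comp_mpolyD poly_evalD mpolyCD opprD addrACA; exact: ID.
- rewrite [comp_mpoly theta (p * q)]rmorphM poly_evalM mpolyCM -subM_split.
  by apply: (ID); apply: (IM).
Qed.

(** A coordinate is a root of the monic polynomial whose roots are its
    conjugates under the group. The coefficients are invariant, hence
    polynomials in [theta], which are constant modulo the fiber ideal; so the
    polynomial splits. *)
Lemma fiber_coord j : exists s : seq C,
  fiber_ideal (\prod_(x <- s) (mpolyX C (mnm1 j) - mpolyC n x)).
Proof.
have [I0 ID IM] := fiber_is_ideal.
set X := mpolyX C (mnm1 j).
pose yg (g : gT) : mpoly n C := linp (row j (rG g)).
have ygE g z : poly_eval (yg g) z = (rG g *m z) j 0.
  by rewrite linpE /lin -row_mul mxE.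
pose P : {poly mpoly n C} := \prod_(g in G) ('X - (yg g)%:P).
have Pmon : P \is monic by apply: monic_prod => g _; exact: monicXsubC.
have /choice[q Hq] : forall k, exists q, P`_k = comp_mpoly theta q.
  move=> k; apply/(bp_generate htheta) => h hG z.
  have evE (y : V) : poly_eval P`_k y = (\prod_(g in G) ('X - ((rG g *m y) j 0)%:P))`_k.
    have -> : \prod_(g in G) ('X - ((rG g *m y) j 0)%:P) = map_poly (meval (fun i => y i 0)) P.
      rewrite rmorph_prod; apply: eq_bigr => g _.
      by rewrite rmorphB /= map_polyX map_polyC /= -ygE.
    by rewrite coef_map.
  rewrite !evE.
  suff -> : \prod_(g in G) ('X - ((rG g *m (rG h *m z)) j 0)%:P) =
            \prod_(g in G) ('X - ((rG g *m z) j 0)%:P) :> {poly C} by [].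
  rewrite [RHS](reindex_inj (mulIg h)) /=.
  by apply: eq_big => [g|g gG]; rewrite ?groupMr // actM.
have PX : P.[X] = 0.
  suff <- : yg 1%g = X by exact: (horner_prod_root yg (group1 G)).
  by apply/eqP; rewrite -subr_eq0; apply/eqP/poly_eval_inj => z;
     rewrite poly_evalD poly_evalN ygE act1 poly_evalX subrr.
pose d := (size P).-1.
have dP : size P = d.+1 by rewrite prednK // size_poly_gt0 monic_neq0.
pose Pw : {poly C} := \poly_(k < d.+1) poly_eval (q k) w.
have Pw1 : Pw`_d = 1.
  rewrite coef_poly ltnSn.
  have : comp_mpoly theta (q d - 1) = 0.
    rewrite comp_mpolyB comp_mpoly1 -Hq; have := monicP Pmon.
    by rewrite lead_coefE -/d => ->; rewrite subrr.
  by move/(bp_independent htheta)/eqP; rewrite subr_eq0 => /eqP ->; exact: meval1.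
have Pw0 : Pw != 0 by apply: contra_eq_neq Pw1 => ->; rewrite coef0 eq_sym oner_eq0.
have [s Hs] := closed_field_poly_normal Pw.
exists s.
have key : fiber_ideal (\sum_(k < d.+1) mpolyC n (poly_eval (q k) w) * X ^+ k).
  have : fiber_ideal (\sum_(k < d.+1) (mpolyC n (poly_eval (q k) w) - comp_mpoly theta (q k)) * X ^+ k).
    apply: big_ind => // k _; rewrite mulrC; apply: (IM).
    by rewrite -opprB -mulN1r; apply: (IM); exact: fiber_comp.
  have PXs : \sum_(k < d.+1) comp_mpoly theta (q k) * X ^+ k = 0.
    transitivity P.[X]; last exact: PX.
    rewrite (@horner_coef_wide _ d.+1) ?dP //.
    by apply: eq_bigr => k _; rewrite Hq.
  rewrite (eq_bigr (fun k : 'I_d.+1 => mpolyC n (poly_eval (q k) w) * X ^+ k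
    - comp_mpoly theta (q k) * X ^+ k)); last by move=> k _; rewrite mulrBl.
  by rewrite sumrB PXs subr0.
have := IM _ (mpolyC n (lead_coef Pw)^-1) key; congr fiber_ideal.
rewrite -(map_split_poly (@mpolyC n C) X Pw0 (size_poly _ _) Hs); congr (_ * _).
by apply: eq_bigr => k _; rewrite coef_poly ltn_ord.
Qed.

(** Enlarging the fiber ideal one coordinate at a time leads to the ideal of a
    point. *)
Lemma basic_map_surj : exists z, basic_map theta z = w.
Proof.
have gen (s : seq 'I_n) : exists I, [/\ is_ideal I, ~ I 1, forall p, fiber_ideal p -> I p &
    forall j, j \in s -> exists x, I (mpolyX C (mnm1 j) - mpolyC n x)].
  elim: s => [|j s [I [Iid I1 Isub Is]]].
    by exists fiber_ideal; split=> //; [exact: fiber_is_ideal|exact: fiber_proper].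
  have [r Hr] := fiber_coord j.
  have [x [I' [I'id I'1 I'sub I'x]]] := ideal_extend Iid I1 (Isub _ Hr).
  exists I'; split=> // [p /Isub|i]; first exact: I'sub.
  rewrite inE => /orP[/eqP ->|/Is [y Hy]]; first by exists x.
  by exists y; exact: I'sub.
have [I [[I0 ID IM] I1 Isub Is]] := gen (enum 'I_n).
have /choice[x Hx] : forall j, exists x, I (mpolyX C (mnm1 j) - mpolyC n x).
  by move=> j; apply: Is; rewrite mem_enum.
pose z : V := \col_j x j.
have evI p : I (p - mpolyC n (poly_eval p z)).
  elim/mpoly_ring_ind: p => [c|j|p q Hp Hq|p q Hp Hq].
  - by rewrite poly_evalC subrr.
  - by rewrite poly_evalX mxE; exact: Hx.
  - by rewrite poly_evalD mpolyCD opprD addrACA; exact: ID.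
  - by rewrite poly_evalM mpolyCM -subM_split; apply: (ID); apply: (IM).
exists z; apply/colP => i; apply: contrapT => ne.
have ne0 : basic_map theta z i 0 - w i 0 != 0 by rewrite subr_eq0; apply/eqP.
have h1 : I (tnth theta i - mpolyC n (w i 0)).
  apply: Isub; exists (fun k => (k == i)%:R); rewrite (bigD1 i) //= eqxx mul1r big1 ?addr0 //.
  by move=> k ki; rewrite (negbTE ki) mul0r.
have h2 := ID _ _ h1 (IM _ (-1) (evI (tnth theta i))).
apply: I1; have := IM _ (mpolyC n (basic_map theta z i 0 - w i 0)^-1) h2.
congr I; rewrite mxE.
have -> : tnth theta i - mpolyC n (w i 0) + -1 * (tnth theta i - mpolyC n (poly_eval (tnth theta i) z))
  = mpolyC n (poly_eval (tnth theta i) z - w i 0) by rewrite mpolyCB; by ring.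
by rewrite -mpolyCM mulVf ?mpolyC1 //; move: ne0; rewrite mxE.
Qed.
End Fiber.
End BasicMap.

(** * Openness of the basic map *)

Section LocalOpenness.
Variables (R : realType) (n : nat) (gT : finGroupType) (G : {group gT}).
Variable rG : mx_representation R[i] G n.
Variable theta : n.-tuple (mpoly n R[i]).
Hypothesis htheta : basic_polynomials rG theta.
Local Notation V := 'cV[R[i]]_n.
Local Notation C := R[i].
Implicit Types (z w y : V).

(** Points of the moment curve: any [n] distinct ones form a basis of the
    linear forms. *)
Definition moment (k : nat) : 'rV[C]_n := \row_j k%:R ^+ j.

(** Vandermonde matrices are invertible; summing over all choices of [n]
    points makes the constant uniform. *)
Lemma moment_small (K : nat) (e : R) : 0 < e -> exists2 eta : R, 0 < eta &
  forall y (S : {set 'I_K}), (n <= #|S|)%N ->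
    (forall k, k \in S -> nc (lin (moment k) y) <= eta) -> vn y < e.
Proof.
move=> e0.
pose M (f : {ffun 'I_n -> 'I_K}) : 'M[C]_n := \matrix_(i, j) (f i)%:R ^+ j.
pose B := \sum_(f : {ffun 'I_n -> 'I_K}) \sum_i \sum_j nc (invmx (M f) i j).
have B0 : 0 <= B by do 3!apply: sumr_ge0 => ? _; exact: nc_ge0.
have B1 : 0 < B + 1 by lra.
exists (e / 2 / (B + 1)) => [|y S nS HS]; first by rewrite !divr_gt0.
set eta := e / 2 / (B + 1) in HS.
have eta0 : 0 <= eta by rewrite !divr_ge0 // ltW.
pose f : {ffun 'I_n -> 'I_K} := [ffun i => enum_val (widen_ord nS i)].
have fS i : f i \in S by rewrite ffunE enum_valP.
have finj : injective f.
  by move=> i j; rewrite !ffunE => /enum_val_inj /(congr1 val) /= /val_inj.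
have Mu : M f \in unitmx.
  have -> : M f = (Vandermonde n (\row_i (f i)%:R))^T.
    by apply/matrixP => i j; rewrite !mxE.
  rewrite unitmx_tr unitmxE unitfE det_Vandermonde.
  apply/prodf_neq0 => i _; apply/prodf_neq0 => j ij.
  rewrite !mxE subr_eq0 eqr_nat; apply: contraTneq ij => /val_inj/finj ->.
  by rewrite ltnn.
have yE : y = invmx (M f) *m (M f *m y) by rewrite mulKmx.
have hM i : nc ((M f *m y) i 0) <= eta.
  have -> : (M f *m y) i 0 = lin (moment (f i)) y.
    by rewrite linE mxE; apply: eq_bigr => j _; rewrite !mxE.
  exact: HS.
apply: le_lt_trans (_ : B * eta < e); last first.
  rewrite /eta mulrA ltr_pdivrMr //.
  have : 0 < e / 2 by lra.
  nra.
apply: le_trans (_ : \sum_i \sum_j nc (invmx (M f) i j) * eta <= _).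
  rewrite /vn; apply: ler_sum => i _; rewrite {1}yE mxE.
  apply: le_trans (nc_sum _ _ _) _; apply: ler_sum => j _.
  by rewrite ncM ler_wpM2l ?nc_ge0.
rewrite /B mulr_suml (bigD1 f) //=; apply: ler_wpDr.
  apply: sumr_ge0 => g _; rewrite mulr_ge0 //; do 2!apply: sumr_ge0 => ? _; exact: nc_ge0.
by rewrite mulr_suml; apply: ler_sum => i _; rewrite mulr_suml.
Qed.

(** The invariants [z |-> \prod_g lin (moment k) (g z - z0)] vanish at [z0],
    so if [theta z] is near [theta z0] then, for each [k], some factor is
    small; by the pigeonhole principle one group element serves for [n] values
    of [k]. *)
Lemma basic_map_open z0 (e : R) : 0 < e -> exists2 d : R, 0 < d &
  forall w, vn (w - basic_map theta z0) < d ->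
    exists2 z, vn (z - z0) < e & basic_map theta z = w.
Proof.
move=> e0; pose K := (n * #|G|).+1.
have [eta eta0 Heta] := moment_small K e0.
have /choice[q Hq] : forall k : nat, exists q, forall z, poly_eval q (basic_map theta z) =
    \prod_(g in G) lin (moment k) (rG g *m z - z0).
  move=> k.
  pose p : mpoly n C := \prod_(g in G) (linp (moment k *m rG g) - mpolyC n (lin (moment k) z0)).
  have pE z : poly_eval p z = \prod_(g in G) lin (moment k) (rG g *m z - z0).
    rewrite poly_eval_prod; apply: eq_bigr => g _.
    by rewrite poly_evalD poly_evalN poly_evalC linpE -[- z0]scaleN1r linD linZ mulN1r /lin mulmxA.
  have inv : invariant_poly rG p.
    move=> h hG z; rewrite !pE [RHS](reindex_inj (mulIg h)) /=.
    by apply: eq_big => [g|g gG]; rewrite ?groupMr // actM.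
  have [q Hq] := (bp_generate htheta p).1 inv.
  by exists q => z; rewrite -comp_basic -Hq pE.
have q0 k : poly_eval (q k) (basic_map theta z0) = 0.
  by rewrite Hq (bigD1 1%g) //= act1 subrr lin0 mul0r.
have [d d0 Hd] : exists2 d : R, 0 < d & forall w, vn (w - basic_map theta z0) < d ->
    forall k, (k < K)%N -> nc (poly_eval (q k) w) <= eta ^+ #|G|.
  elim: {Heta}K => [|k [d d0 Hd]]; first by exists 1.
  have [d' d'0 Hd'] := hol_cont (hol_poly (q k) (basic_map theta z0)) (exprn_gt0 #|G| eta0).
  exists (Num.min d d') => [|w]; first by rewrite lt_min d0.
  rewrite lt_min => /andP[/Hd h1 /Hd' h2] j; rewrite ltnS leq_eqVlt => /orP[/eqP ->|/h1 //].
  by move: h2; rewrite q0 subr0.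
exists d => // w /Hd {}Hd; have [z Hz] := basic_map_surj htheta w.
have /choice[f Hf] : forall k : 'I_K, exists g, g \in G /\
    nc (lin (moment k) (rG g *m z - z0)) <= eta.
  move=> k; apply: contrapT => nex.
  have := Hd k (ltn_ord k); rewrite -Hz Hq nc_prod leNgt => /negP; apply.
  rewrite -prodr_const; apply: ltr_prod; first by apply/hasP; exists 1%g; rewrite ?mem_index_enum.
  move=> g gG; rewrite (ltW eta0) ltNge; apply/negP => le; apply: nex; by exists g.
have [g gG ng] : exists2 g, g \in G & (n <= #|[set k | f k == g]%SET|)%N.
  apply: contrapT => nex.
  have : (K <= n * #|G|)%N; last by rewrite ltnn.
  apply: leq_trans (_ : (\sum_(k < K) 1 <= _)%N); first by rewrite sum1_card card_ord.
  rewrite (partition_big f (mem G)) /=; last by move=> k _; exact: (Hf k).1.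
  rewrite mulnC -sum_nat_const; apply: leq_sum => g gG.
  rewrite sum1_card leqNgt; apply/negP => lt; apply: nex; exists g => //.
  by apply: leq_trans (ltnW lt) _; apply: subset_leq_card; apply/fintype.subsetP => k; rewrite !inE.
exists (rG g *m z); last by rewrite (basic_map_inv htheta).
apply: (Heta _ _ ng) => k; rewrite inE => /eqP <-; exact: (Hf k).2.
Qed.
End LocalOpenness.

(** * Descent of relative invariants to the orbit space *)

Section Descent.
Variables (R : realType) (n : nat).
Local Notation V := 'cV[R[i]]_n.
Local Notation C := R[i].
Implicit Types (z w y v : V) (p q A B : mpoly n R[i]).

Lemma geometric_series (u : nat -> C) (b s : R) : 0 <= s -> s < 1 ->
  (forall k, nc (u k) <= b * s ^+ k) ->
  exists l, forall K, nc (\sum_(k < K) u k - l) <= b * s ^+ K / (1 - s).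
Proof.
move=> s0 s1 Hu; have s1' : 0 < 1 - s by lra.
have b0 : 0 <= b by have := Hu 0%N; rewrite expr0 mulr1; apply: le_trans; exact: nc_ge0.
have tail K j : nc (\sum_(k < K) u k - \sum_(k < K + j) u k) <= b * s ^+ K / (1 - s).
  rewrite -!(big_mkord predT u) (@big_cat_nat _ _ _ K 0 (K + j)) ?leq_addr //=.
  rewrite opprD addrA subrr add0r ncN; apply: le_trans (nc_sum _ _ _) _.
  apply: le_trans (_ : _ <= \sum_(K <= k < K + j) b * s ^+ k) _; first exact: ler_sum.
  by rewrite -mulr_sumr -mulrA ler_wpM2l // geom_tail.
have bnd K : b * s ^+ K / (1 - s) = (b / (1 - s)) * s ^+ K by rewrite mulrAC.
have [l Hl] : exists l, climit (fun K => \sum_(k < K) u k) l.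
  apply: C_cauchy => e e0.
  have c0 : 0 <= b / (1 - s) by rewrite divr_ge0 // ltW.
  have [N HN] := expr_small s0 s1 (e := e / 2 / (b / (1 - s) + 1))
    ltac:(by rewrite !divr_gt0 //; lra).
  have hN : b * s ^+ N / (1 - s) <= e / 2.
    rewrite bnd; have := HN N (leqnn N); rewrite ler_pdivlMr; last lra.
    move=> h; apply: le_trans h; rewrite mulrC ler_wpM2l ?exprn_ge0 //; lra.
  exists N => i j Ni Nj; apply: le_trans (nc_subD _ (\sum_(k < N) u k) _) _.
  rewrite (ncB (\sum_(k < i) u k)).
  have := tail N (i - N)%N; have := tail N (j - N)%N; rewrite !subnKC // => h1 h2.
  by apply: le_trans (lerD h2 h1) _; lra.
exists l => K; apply: (climit_le (climitB (climit_cst (\sum_(k < K) u k)) Hl)) => e e0.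
exists K => i Ki; have := tail K (i - K)%N; rewrite subnKC // => h.
by apply: le_trans h _; rewrite lerDl ltW.
Qed.

(** [A] can be divided out at a bounded cost, uniformly in the polynomial [q]. *)
Definition div_bounded A : Prop := forall z0 (d : R), 0 < d ->
  exists c d' : R, [/\ 0 <= c, 0 < d' & forall q (M : R),
    (forall z, vn (z - z0) < d -> nc (poly_eval A z * poly_eval q z) <= M) ->
    forall z, vn (z - z0) < d' -> nc (poly_eval q z) <= c * M].

Lemma div_boundedM A B : div_bounded A -> div_bounded B -> div_bounded (A * B).
Proof.
move=> HA HB z0 d d0; have [c [d1 [c0 d10 H1]]] := HA z0 d d0.
have [c' [d2 [c'0 d20 H2]]] := HB z0 d1 d10.
exists (c' * c), d2; split=> //; first exact: mulr_ge0.
move=> q M HM z zd; rewrite -mulrA; apply: H2 zd => y yd.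
rewrite -poly_evalM; apply: H1 yd => x xd.
by rewrite poly_evalM mulrA -poly_evalM; exact: HM.
Qed.

Lemma div_bounded1 : div_bounded 1.
Proof.
move=> z0 d d0; exists 1, d; split=> // q M HM z /HM.
by rewrite {1}/poly_eval meval1 !mul1r.
Qed.

(** Dividing by a linear form: where the form is small, the mean value property
    on a circle transversal to its zero set replaces the division. *)
Lemma div_bounded_lin L v : lin L v = 1 -> div_bounded (linp L).
Proof.
move=> Lv z0 d d0; have v1 : 0 < vn v + 1 by have := vn_ge0 v; lra.
pose r := d / 2 / (vn v + 1).
have r0 : 0 < r by rewrite !divr_gt0.
have rv : r * vn v <= d / 2.
  have : r * (vn v + 1) = d / 2 by rewrite divfK ?gt_eqF.
  have := vn_ge0 v; nra.
exists (2 / r), (d / 2); split=> [||q M HM z zd]; [by rewrite divr_ge0 // ltW|lra|].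
have near (w : C) : nc w <= r -> nc (lin L (z + w *: v)) * nc (poly_eval q (z + w *: v)) <= M.
  move=> wr; rewrite -ncM -linpE; apply: HM.
  have -> : z + w *: v - z0 = (z - z0) + w *: v by rewrite addrAC.
  apply: le_lt_trans (vnD _ _) _; rewrite vnZ.
  have : nc w * vn v <= r * vn v by rewrite ler_wpM2r ?vn_ge0.
  lra.
have big (w : C) : nc w <= r -> r / 2 <= nc (lin L (z + w *: v)) ->
    nc (poly_eval q (z + w *: v)) <= 2 / r * M.
  move=> /near h1 h2.
  have h3 : r / 2 * nc (poly_eval q (z + w *: v)) <= M.
    by apply: le_trans h1; rewrite ler_wpM2r ?nc_ge0.
  by rewrite -invf_div mulrC ler_pdivlMr ?divr_gt0 // mulrC.
have z0' : z + 0 *: v = z by rewrite scale0r addr0.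
case: (lerP (r / 2) (nc (lin L z))) => Lz.
  by have := big 0; rewrite z0' nc0; apply=> //; exact: ltW.
have [P HP] := poly_line q z v.
have := HP 0; rewrite z0' => ->; rewrite horner_coef0.
have := @poly_coef_bound _ P r (2 / r * M) 0%N r0; rewrite expr0 divr1; apply => w wr.
rewrite -HP; apply: big; rewrite ?wr // linD linZ Lv mulr1 addrC.
have := nc_lowerD w (lin L z); lra.
Qed.

Variable Om : V -> Prop.
Hypothesis Om_open : forall z, Om z -> exists2 d : R, 0 < d & forall h, vn h < d -> Om (z + h).
Hypothesis Om_star : forall (c : C) z, nc c <= 1 -> Om z -> Om (c *: z).
Hypothesis Om0 : Om 0.
Variables (gT : finGroupType) (G : {group gT}) (rG : mx_representation C G n).
Hypothesis hG : reflection_group rG.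
Hypothesis Om_act : forall g z, g \in G -> Om z -> Om (rG g *m z).
Variable theta : n.-tuple (mpoly n C).
Hypothesis htheta : basic_polynomials rG theta.
Variables (t : nat) (ell : 'I_t -> 'rV[C]_n) (a : 'I_t -> gT).
Hypothesis hell : reflecting_hyperplanes rG ell a.
Variable rho : mx_representation C G 1.
Variable c : 'I_t -> nat.
Hypothesis hc : forall i, least_exponent rG rho (a i) (c i).

Definition ellp : mpoly n C := \prod_(i < t) linp (ell i) ^+ c i.

Lemma ellpE z : poly_eval ellp z = ell_prod ell c z.
Proof.
by rewrite poly_eval_prod ell_prodE; apply: eq_bigr => i _; rewrite poly_evalXn linpE.
Qed.

Lemma div_bounded_ellp : div_bounded ellp.
Proof.
apply: big_ind => [||i _]; [exact: div_bounded1|exact: div_boundedM|].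
have [v Hv] := ell_normal hell i.
elim: (c i) => [|k IH]; first by rewrite expr0; exact: div_bounded1.
by rewrite exprS; apply: div_boundedM => //; exact: div_bounded_lin Hv.
Qed.

(** The homogeneous components of [F] are relative invariants and factor
    algebraically. The series of their quotients, read as polynomials in the
    invariants, converges locally uniformly on the orbit space: division by
    [ell_prod] costs a constant factor on a smaller ball, and the basic map is
    open. *)
Lemma holomorphic_descent (F : V -> C) : (forall z, Om z -> hol F z) ->
  (forall g z, g \in G -> Om z -> F (rG g *m z) = chi rho g * F z) ->
  exists h : V -> C, (forall z, Om z -> hol h (basic_map theta z)) /\
    forall z, Om z -> F z = ell_prod ell c z * h (basic_map theta z).
Proof.
move=> HF Fchi.
have [Fk [Fbnd Fsum Fmean]] := homogeneous_expansion Om_open Om_star Om0 HF.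
have Fkchi k g z : g \in G -> poly_eval (Fk k) (rG g *m z) = chi rho g * poly_eval (Fk k) z.
  move=> gG; have [q Hq] := poly_comp_mx (Fk k) (rG g).
  have E y : poly_eval (q - chi rho g *: Fk k) y =
      poly_eval (Fk k) (rG g *m y) - chi rho g * poly_eval (Fk k) y.
    by rewrite poly_evalD poly_evalN poly_evalZ Hq.
  apply/eqP; rewrite -subr_eq0 -E; apply/eqP.
  have [d d0 Hd] := Om_open Om0; apply: (poly_eval_near (z := 0) d0) => y yd; rewrite add0r.
  have Oy : Om y by rewrite -(add0r y); exact: Hd.
  rewrite E; apply/eqP; rewrite subr_eq0; apply/eqP.
  apply: climit_uniq (Fmean _ k (Om_act gG Oy)) _.
  move=> e /(climitZ (chi rho g) (Fmean y k Oy)) [N HN]; exists N => m /HN.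
  rewrite -meanZ; rewrite (@eq_mean _ m (fun w : C => F (w *: (rG g *m y)) * w ^- k)
    (fun w : C => chi rho g * (F (w *: y) * w ^- k))) // => w w1.
  by rewrite scalemxAr Fchi ?mulrA //; apply: Om_star; rewrite ?w1.
have /choice[q Hq] : forall k, exists q, forall z,
    poly_eval (Fk k) z = ell_prod ell c z * poly_eval q (basic_map theta z).
  move=> k; have [g ginv Hg] := relative_invariant_factor hell hc hG (fun g z => @Fkchi k g z).
  have [q Hq] := (bp_generate htheta g).1 ginv.
  by exists q => z; rewrite Hg Hq comp_basic.
have loc z0 : Om z0 -> exists B s : R, [/\ 0 <= s, s < 1 & exists2 d : R, 0 < d &
    forall w, vn (w - basic_map theta z0) < d ->
      forall k, nc (poly_eval (q k) w) <= B * s ^+ k].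
  move=> /Fbnd [M [s [M0 s0 s1 [d d0 Hd]]]].
  have [b [d' [b0 d'0 Hdiv]]] := div_bounded_ellp z0 d0.
  have [r r0 Hr] := basic_map_open htheta z0 d'0.
  exists (b * M), s; split=> //; exists r => // w /Hr [z zd <-] k.
  rewrite -comp_basic -mulrA; apply: Hdiv zd => y yd.
  by rewrite comp_basic ellpE -Hq; have [_] := Hd y yd; apply.
(* Outside the region of geometric convergence the value of [h] is arbitrary. *)
have /choice[h Hh] : forall w, exists l,
    forall B s : R, 0 <= s -> s < 1 -> (forall k, nc (poly_eval (q k) w) <= B * s ^+ k) ->
    forall K, nc (\sum_(k < K) poly_eval (q k) w - l) <= B * s ^+ K / (1 - s).
  move=> w.
  have [[B [s [s0 s1 HB]]]|nB] := pselect (exists B s : R,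
    [/\ 0 <= s, s < 1 & forall k, nc (poly_eval (q k) w) <= B * s ^+ k]); last first.
    by exists 0 => B s s0 s1 HB; case: nB; exists B, s.
  have lim (B' s' : R) l K0 : 0 <= s' -> s' < 1 -> 0 <= B' ->
      (forall K, (K0 <= K)%N -> nc (\sum_(k < K) poly_eval (q k) w - l) <= B' * s' ^+ K / (1 - s')) ->
      climit (fun K => \sum_(k < K) poly_eval (q k) w) l.
    move=> s'0 s'1 B'0 H; apply: (@climit_geom R _ _ (B' / (1 - s')) s' K0) => //.
      by rewrite divr_ge0 // subr_ge0 ltW.
    by move=> K KK; rewrite mulrAC; exact: H.
  have Bpos (B' s' : R) : (forall k, nc (poly_eval (q k) w) <= B' * s' ^+ k) -> 0 <= B'.
    by move=> H; have := H 0%N; rewrite expr0 mulr1; apply: le_trans; exact: nc_ge0.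
  have [l Hl] := geometric_series s0 s1 HB.
  exists l => B' s' s'0 s'1 HB'; have [l' Hl'] := geometric_series s'0 s'1 HB'.
  have -> // : l = l'.
  apply: climit_uniq (lim B s l 0%N s0 s1 (Bpos _ _ HB) (fun K _ => Hl K)) _.
  exact: (lim B' s' l' 0%N s'0 s'1 (Bpos _ _ HB') (fun K _ => Hl' K)).
exists h; split=> z Oz; have [B [s [s0 s1 [d d0 Hd]]]] := loc z Oz.
  apply: (@hol_unif_limit _ _ _ _ (d / 2)) => [|e e0]; first lra.
  have s1' : 0 < 1 - s by lra.
  have B0 : 0 <= B.
    have := Hd (basic_map theta z); rewrite subrr vn0 => /(_ d0 0%N).
    by rewrite expr0 mulr1; apply: le_trans; exact: nc_ge0.
  have [N HN] := expr_small s0 s1 (e := e * (1 - s) / (B + 1))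
    ltac:(by rewrite divr_gt0 ?mulr_gt0 //; lra).
  exists (fun w => \sum_(k < N) poly_eval (q k) w) => w wz; split.
    by apply: hol_sum => k; exact: hol_poly.
  rewrite ncB; apply: le_trans (Hh w B s s0 s1 (Hd w _) N) _; first lra.
  rewrite ler_pdivrMr //; have := HN N (leqnn N); rewrite ler_pdivlMr; last lra.
  move=> H; apply: le_trans H; rewrite mulrC ler_wpM2l ?exprn_ge0 //; lra.
apply: climit_uniq (Fsum z Oz) _.
have B0 : 0 <= B.
  have := Hd (basic_map theta z); rewrite subrr vn0 => /(_ d0 0%N).
  by rewrite expr0 mulr1; apply: le_trans; exact: nc_ge0.
have lim : climit (fun K => \sum_(k < K) poly_eval (q k) (basic_map theta z)) (h (basic_map theta z)).
  apply: (@climit_geom R _ _ (B / (1 - s)) s 0%N) => //.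
    by rewrite divr_ge0 // subr_ge0 ltW.
  move=> K _; rewrite mulrAC; apply: Hh => //; apply: Hd; by rewrite subrr vn0.
move=> e /(climitZ (ell_prod ell c z) lim) [N HN]; exists N => K /HN.
by rewrite mulr_sumr (eq_bigr (fun k : 'I_K => poly_eval (Fk k) z)).
Qed.
End Descent.

(** * Complex differentiability and coordinates *)

Section Differentiable.
Variables (K : numFieldType) (V W : normedModType K).
Implicit Types (F : V -> W) (z : V).

Lemma differentiable_near F (L : {linear V -> W}) z : continuous L ->
  (forall e : K, 0 < e -> \forall h \near 0, `|F (h + z) - F z - L h| <= e * `|h|) ->
  differentiable F z.
Proof.
move=> cont H; have E : F \o shift z = cst (F z) + L +o_ 0 id.
  apply/eqaddoP => e /H; apply: filterS => h.
  by rewrite -![(_ + _ : _ -> _) _]/(_ + _) -![(- _ : _ -> _) _]/(- _) /= /cst opprD addrA.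
by apply/diff_locallyP; rewrite (diff_unique cont E).
Qed.

Lemma near_differentiable F z : differentiable F z ->
  forall e : K, 0 < e -> \forall h \near 0, `|F (h + z) - F z - 'd F z h| <= e * `|h|.
Proof.
move=> /diff_locallyP [_ /eqaddoP H] e /H; apply: filterS => h.
by rewrite -![(_ + _ : _ -> _) _]/(_ + _) -![(- _ : _ -> _) _]/(- _) /= /cst opprD addrA.
Qed.
End Differentiable.

Section Bridge.
Variables (R : realType) (n : nat).
Local Notation V := (Cn R n).
Implicit Types (z h : V) (F : V -> R[i]).

Lemma norm_vn z : `|z| <= (vn z)%:C.
Proof.
have bnd i : `|z i.1 i.2| <= (vn z)%:C.
  by rewrite (ord1 i.2) nc_norm lecR vn_coord.
have v0 : 0 <= (vn z)%:C :> R[i] by rewrite ler0c vn_ge0.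
rewrite -[`|z|]/(mx_norm z) mx_normE.
move: (_%:C) v0 bnd => e /nonnegP[e'] bnd.
have e'0 : 0 <= e'%:num by [].
by rewrite num_le; apply/bigmax_leP; split=> [|i _]; [exact: e'0|exact: bnd].
Qed.

Lemma vn_norm z : (vn z)%:C <= n%:R * `|z|.
Proof.
rewrite /vn rmorph_sum /= mulr_natl -[X in _ *+ X]card_ord -sumr_const.
apply: ler_sum => j _; rewrite -nc_norm.
rewrite -[`|z|]/(mx_norm z) mx_normE -[leLHS]nngE num_le.
exact: (le_bigmax _ _ (j, 0)).
Qed.

Lemma ltC_Re (e : R[i]) : 0 < e -> exists2 d : R, 0 < d & e = d%:C.
Proof.
by case: e => a b; rewrite ltcE /= => /andP[/eqP -> a0]; exists a.
Qed.

(** The maximum norm, which defines the topology, and the l1-norm are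
    equivalent. *)
Lemma nbhs_vn z (U : set V) : nbhs z U <->
  exists2 d : R, 0 < d & forall h, vn h < d -> U (z + h).
Proof.
split=> [/nbhs_ballP [e /= /ltC_Re[d d0 ->] Hd]|[d d0 Hd]].
  exists d => // h hd; apply: Hd; rewrite -ball_normE /= opprD addrA subrr add0r normrN.
  by apply: le_lt_trans (norm_vn h) _; rewrite ltcR.
have n0 : 0 < n%:R + 1 :> R by rewrite ltr_wpDl.
apply/nbhs_ballP; exists (d / (n%:R + 1))%:C => /=; first by rewrite ltcR divr_gt0.
move=> y; rewrite -ball_normE /= => yz.
rewrite -[y](subrK z) addrC; apply: Hd; rewrite -ltcR vnB.
apply: le_lt_trans (vn_norm _) _.
apply: le_lt_trans (_ : n%:R * (d / (n%:R + 1))%:C < _).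
  by rewrite ler_wpM2l // ltW.
have -> : (n%:R : R[i]) = (n%:R : R)%:C by rewrite rmorph_nat.
rewrite -rmorphM ltcR mulrA ltr_pdivrMr // mulrC ltr_pM2l //; lra.
Qed.

Lemma open_vn (U : set V) : open U <->
  forall z, U z -> exists2 d : R, 0 < d & forall h, vn h < d -> U (z + h).
Proof.
rewrite openE; split=> H z Uz; first exact/nbhs_vn/H.
exact/nbhs_vn/H.
Qed.

Lemma lin_linear L : linear (@lin R n L).
Proof. by move=> c x y; rewrite linD linZ. Qed.

HB.instance Definition _ L :=
  GRing.isLinear.Build R[i] V R[i] _ (@lin R n L) (lin_linear L).

Lemma lin_continuous L : continuous (lin L : V -> R[i]).
Proof.
move=> x U /nbhs_ballP[e /= /ltC_Re[d d0 ->]] HU.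
apply/nbhs_vn; exists (d / (rn L + 1)).
  by rewrite divr_gt0 //; have := rn_ge0 L; lra.
move=> h; rewrite ltr_pdivlMr; last by have := rn_ge0 L; lra.
move=> hd; apply: HU; rewrite -ball_normE /= linD opprD addrA subrr add0r normrN nc_norm ltcR.
by apply: le_lt_trans (lin_bound L h) _; have := vn_ge0 h; lra.
Qed.

(** A continuous linear functional on column vectors is a row vector. *)
Lemma holomorphic_onE (D : set V) F :
  holomorphic_on D F <-> forall z, D z -> hol F z.
Proof.
split=> H z Dz.
  have {}H := near_differentiable (H z Dz).
  move: ('d F z) H => L0 H.
  pose L : 'rV[R[i]]_n := \row_j L0 (en R j).
  have dL h : L0 h = lin L h.
    rewrite linE; have {1}-> : h = \sum_j h j 0 *: en R j.
      apply/colP => i; rewrite summxE (bigD1 i) //= !mxE !eqxx mulr1 big1 ?addr0 // => j ji.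
      by rewrite !mxE eq_sym (negbTE ji) mulr0.
    by rewrite linear_sum; apply: eq_bigr => j _; rewrite linearZ !mxE /= mulrC.
  exists L => e e0; have [|d d0 Hd] := (nbhs_vn 0 _).1 (H e%:C _); first by rewrite ltcR.
  exists d => // h /Hd; rewrite add0r /= dL [h + z]addrC.
  rewrite nc_norm => k; rewrite -lecR; apply: le_trans k _.
  by rewrite rmorphM /= ler_wpM2l ?ler0c ?(ltW e0) ?norm_vn.
have [L HL] := H z Dz.
apply: (@differentiable_near _ _ _ F (lin L) z (@lin_continuous L)) => e /ltC_Re[d d0 ->].
have n0 : 0 < n%:R + 1 :> R by rewrite ltr_wpDl.
have [|r r0 Hr] := HL (d / (n%:R + 1)); first by rewrite divr_gt0.
apply/nbhs_vn; exists r => // h hr; rewrite add0r [h + z]addrC.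
rewrite nc_norm; apply: le_trans (_ : (d / (n%:R + 1) * vn h)%:C <= _).
  by rewrite lecR; exact: Hr.
rewrite !rmorphM /= -mulrA ler_wpM2l ?ler0c ?(ltW d0) //.
apply: le_trans (ler_wpM2l _ (vn_norm h)) _; first by rewrite ler0c invr_ge0 ltW.
rewrite mulrA ler_piMl // -(rmorph_nat (@real_complex R)) -rmorphM lecR mulrC ler_pdivrMr // mul1r; lra.
Qed.
End Bridge.

(** * Composition, and the domain *)

Section Composition.
Variables (R : realType) (n : nat).
Local Notation V := (Cn R n).
Implicit Types (z k : V) (F : V -> R[i]) (T : V -> V).

Lemma hol_comp F T z : hol F (T z) -> (forall j, hol (fun y => T y j 0) z) ->
  hol (fun y => F (T y)) z.
Proof.
move=> [L HL] /choice[M HM].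
pose A : 'M[R[i]]_n := \matrix_(j, l) M j 0 l.
have AE k j : (A *m k) j 0 = lin (M j) k.
  by rewrite linE mxE; apply: eq_bigr => l _; rewrite mxE.
have near_all e : 0 < e -> exists2 d : R, 0 < d & forall k, vn k < d ->
    vn (T (z + k) - T z - A *m k) <= n%:R * e * vn k.
  move=> e0.
  have : \forall k \near (0 : V), forall j : 'I_n,
      nc (T (z + k) j 0 - T z j 0 - lin (M j) k) <= e * vn k.
    apply: (@filter_forall _ _ _ _ (nbhs_filter (0 : V))) => j; apply/nbhs_vn; have [d d0 Hd] := HM j e e0.
    by exists d => // k kd; rewrite add0r; exact: Hd.
  move=> /nbhs_vn[d d0 Hd]; exists d => // k /Hd; rewrite add0r => Hk.
  rewrite -mulrA mulr_natl -[X in _ *+ X]card_ord -sumr_const; apply: ler_sum => j _.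
  by have := Hk j; rewrite -AE !mxE.
exists (L *m A) => e e0.
have K0 : 0 <= \sum_j rn (M j) by apply: sumr_ge0 => j _; exact: rn_ge0.
set K := \sum_j _ in K0.
have n0 : 0 <= n%:R :> R by [].
have rL := rn_ge0 L.
pose e1 := e / (2 * (K + n%:R + 1)).
have e10 : 0 < e1 by rewrite divr_gt0 //; lra.
pose e2 := Num.min 1 (e / (2 * (n%:R + 1) * (rn L + 1))).
have e20 : 0 < e2.
  by rewrite lt_min ltr01 divr_gt0 // !mulr_gt0 //; lra.
have [d1 d10 H1] := HL _ e10.
have [d2 d20 H2] := near_all _ e20.
exists (Num.min d2 (d1 / (K + n%:R + 1))).
  by rewrite lt_min d20 divr_gt0 //; lra.
move=> k; rewrite lt_min => /andP[kd2 kd1].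
have k0 := vn_ge0 k.
pose u := T (z + k) - T z.
have uA := H2 k kd2; rewrite -/u in uA.
have Ak : vn (A *m k) <= K * vn k.
  by rewrite /K mulr_suml; apply: ler_sum => j _; rewrite AE lin_bound.
have e2n : n%:R * e2 <= n%:R by rewrite ler_piMr // ge_min lexx.
have uk : vn u <= (K + n%:R) * vn k.
  rewrite -[u](subrK (A *m k)); apply: le_trans (vnD _ _) _.
  rewrite mulrDl addrC; apply: lerD => //; apply: le_trans uA _.
  by rewrite ler_wpM2r.
have ud : vn u < d1.
  apply: le_lt_trans uk _; move: kd1; rewrite ltr_pdivlMr; last lra.
  apply: le_lt_trans; rewrite mulrC ler_wpM2l //; lra.
have := H1 u ud; rewrite [T z + u]addrC subrK => B1.
have -> : F (T (z + k)) - F (T z) - lin (L *m A) k =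
   (F (T (z + k)) - F (T z) - lin L u) + lin L (u - A *m k).
  have -> : lin (L *m A) k = lin L (A *m k) by rewrite /lin mulmxA.
  have -> : lin L (u - A *m k) = lin L u - lin L (A *m k).
    by rewrite linD -scaleN1r linZ mulN1r.
  by ring.
apply: le_trans (ncD _ _) _.
have B2 := lin_bound L (u - A *m k).
have C1 : e1 * vn u <= e / 2 * vn k.
  apply: (@le_trans _ _ (e1 * ((K + n%:R + 1) * vn k))).
    rewrite ler_wpM2l ?(ltW e10) //; apply: le_trans uk _; rewrite ler_wpM2r //; lra.
  rewrite /e1 mulrA; apply: ler_wpM2r => //.
  have -> // : e / (2 * (K + n%:R + 1)) * (K + n%:R + 1) = e / 2.
  by field; apply/eqP; lra.
have C2 : rn L * (n%:R * e2 * vn k) <= e / 2 * vn k.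
  rewrite mulrA; apply: ler_wpM2r => //.
  apply: (@le_trans _ _ ((rn L + 1) * ((n%:R + 1) * (e / (2 * (n%:R + 1) * (rn L + 1)))))).
    apply: ler_pM => //; first by rewrite mulr_ge0 // ltW.
      lra.
    apply: ler_pM => //; first by rewrite ltW.
      lra.
    by rewrite ge_min lexx orbT.
  have -> // : (rn L + 1) * ((n%:R + 1) * (e / (2 * (n%:R + 1) * (rn L + 1)))) = e / 2.
  by field; rewrite !gt_eqF //; lra.
have C3 : rn L * vn (u - A *m k) <= rn L * (n%:R * e2 * vn k) by rewrite ler_wpM2l.
by lra.
Qed.

Lemma hol_basic_map (theta : n.-tuple (mpoly n R[i])) F z :
  hol F (basic_map theta z) -> hol (fun y => F (basic_map theta y)) z.
Proof.
move=> HF; apply: hol_comp => // j.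
apply: (hol_near (hol_poly (tnth theta j) z)); exists 1 => // h _.
by rewrite mxE.
Qed.

Lemma hol_act (A : 'M[R[i]]_n) F z :
  hol F (A *m z) -> hol (fun y => F (A *m y)) z.
Proof.
move=> HF; apply: hol_comp => // j.
apply: (hol_near (hol_lin (row j A) z)); exists 1 => // h _.
by rewrite /lin -row_mul mxE.
Qed.
End Composition.

Section Domain.
Variables (R : realType) (n : nat).
Local Notation V := (Cn R n).
Variables (Omega : set V).
Hypothesis hOmega : bounded_symmetric_domain Omega.
Hypothesis hcirc : circular_realization Omega.

Lemma domain_open z : Omega z ->
  exists2 d : R, 0 < d & forall h, vn h < d -> Omega (z + h).
Proof. by move: z; apply/open_vn; exact: bsd_open hOmega. Qed.

(** A modulus-one factor is absorbed by circularity, a modulus below one by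
    starlikeness. *)
Lemma domain_disc (c : R[i]) z : nc c <= 1 -> Omega z -> Omega (c *: z).
Proof.
move=> c1 Oz; have [->|c0] := eqVneq c 0.
  by rewrite scale0r; exact: cr_origin hcirc.
have nc0 : (nc c)%:C != 0 :> R[i].
  by rewrite -nc_norm normr_eq0.
have u1 : `|c / (nc c)%:C| = 1 :> R[i].
  by rewrite normf_div -!nc_norm normr_id divff // nc_norm.
have Ou := cr_circular hcirc u1 Oz.
have E : c *: z = (nc c)%:C *: (c / (nc c)%:C *: z).
  by rewrite scalerA mulrCA divff // mulr1.
have [c1'|c1'] := ltP (nc c) 1.
  rewrite E; apply: (cr_starlike hcirc) => //; first exact: nc_ge0.
  exact: subset_closure.
have -> // : c *: z = c / (nc c)%:C *: z.
by rewrite (_ : nc c = 1) ?divr1 //; apply/eqP; rewrite eq_le c1.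
Qed.

Lemma domain_bounded : exists M : R, forall z, Omega z -> vn z <= M.
Proof.
have [M [Mr HM]] := bsd_bounded hOmega.
have {}HM z : Omega z -> `|z| <= M + 1 by move/(HM (M + 1) (ltr_pwDr ltr01 (lexx M))).
have : 0 <= M + 1 by apply: le_trans (HM 0 (cr_origin hcirc)).
move: (M + 1) HM => [m m'] {M Mr} HM; rewrite lecE /= => /andP[/eqP m'0 m0].
exists (n%:R * m) => z /HM zm; rewrite -lecR; apply: le_trans (vn_norm z) _.
by rewrite rmorphM rmorph_nat ler_wpM2l //; move: zm; rewrite m'0.
Qed.
End Domain.

(** * Borel measurability and invariance of integrals *)

Section BorelMeasure.
Variables (R : realType) (n : nat).
Local Notation V := (Cn R n).
Local Notation B := (borelCn R n).
Implicit Types (z t h : V) (F : V -> R[i]) (U : set V).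

Lemma measurable_open U : open U -> measurable (U : set B).
Proof. by move=> oU; exact: sub_sigma_algebra. Qed.

Lemma measurable_closed U : closed U -> measurable (U : set B).
Proof.
by move=> cU; rewrite -[U]setCK; apply: measurableC; apply: measurable_open; exact: closed_openC.
Qed.

Lemma measurable_superlevel (g : B -> R) : (forall t, 0 <= g t) ->
  (forall x, 0 <= x -> open [set t : V | x < g t]) -> measurable_fun setT g.
Proof.
move=> g0 Hg mD; apply: (measurability _ (RGenOInfty.measurableE R)) => //.
move=> /= _ [_ [x ->] <-]; apply: measurableI => //.
rewrite (_ : g @^-1` _ = [set t : V | x < g t]); last first.
  by apply/seteqP; split=> t /=; rewrite in_itv /= andbT.
have [x0|x0] := leP 0 x; first by apply: measurable_open; exact: Hg.
rewrite (_ : [set t | _] = setT); first exact: measurableT.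
by apply/seteqP; split=> // t _ /=; apply: lt_le_trans (g0 t).
Qed.

(** Extension by zero may destroy the continuity of [F] at the boundary of
    [D], but the squared modulus stays lower semicontinuous, which is enough
    for measurability. *)
Lemma superlevel_open (D : set V) F (r x : R) : (forall z, D z -> hol F z) ->
  function_on D F -> 0 <= x -> open [set t : V | x < nc (F (r%:C *: t)) ^+ 2].
Proof.
move=> HF F0 x0; apply/open_vn => t /=; set m := nc _ => xm.
have m0 : 0 <= m by exact: nc_ge0.
have [Dt|Dt] := pselect (D (r%:C *: t)); last first.
  by move: xm; rewrite /m F0 // nc0 expr0n /= => /(le_lt_trans x0); rewrite ltxx.
pose e := (m ^+ 2 - x) / (2 * m + 1).
have e0 : 0 < e by rewrite divr_gt0 //; [rewrite subr_gt0|lra].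
have em : e * (2 * m + 1) = m ^+ 2 - x by rewrite divfK // gt_eqF //; lra.
have [d d0 Hd] := hol_cont (HF _ Dt) e0.
have r0 : 0 < `|r| + 1 by rewrite ltr_wpDl.
exists (d / (`|r| + 1)); first by rewrite divr_gt0.
move=> h; rewrite ltr_pdivlMr // => hd /=; rewrite scalerDr.
have /Hd : vn (r%:C *: t + r%:C *: h - r%:C *: t) < d.
  rewrite [X in X - _]addrC addrK vnZ nc_real; apply: le_lt_trans hd; rewrite mulrC ler_wpM2l ?vn_ge0 //; lra.
set y := F (_ + _) => ye.
have := nc_lowerD (F (r%:C *: t)) (y - F (r%:C *: t)); rewrite [_ + (y - _)]addrC subrK -/m.
move=> yl; have my : m - e <= nc y by lra.
have me : 0 <= m - e by rewrite leNgt; apply/negP => me; nra.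
apply: (@lt_le_trans _ _ ((m - e) ^+ 2)); last by rewrite lerXn2r ?nnegrE ?nc_ge0.
rewrite expr2; nra.
Qed.

Lemma measurable_hardy (D : set V) F (r : R) : (forall z, D z -> hol F z) ->
  function_on D F -> measurable_fun setT (fun t : B => nc (F (r%:C *: (t : V))) ^+ 2).
Proof.
move=> HF F0; apply: measurable_superlevel => [t|x x0]; first exact: sqr_ge0.
exact: superlevel_open HF F0 x0.
Qed.

Lemma mulmx_bound (A : 'M[R[i]]_n) :
  exists2 K : R, 0 < K & forall h, vn (A *m h) <= K * vn h.
Proof.
exists (\sum_j rn (row j A) + 1).
  by rewrite ltr_wpDl // sumr_ge0 // => j _; exact: rn_ge0.
move=> h; apply: (@le_trans _ _ ((\sum_j rn (row j A)) * vn h)).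
  rewrite mulr_suml; apply: ler_sum => j _.
  by have := lin_bound (row j A) h; rewrite /lin -row_mul mxE.
by rewrite ler_wpM2r ?vn_ge0 //; lra.
Qed.

Lemma mulmx_continuous (A : 'M[R[i]]_n) : continuous (fun z : V => A *m z).
Proof.
have [K K0 HK] := mulmx_bound A.
move=> z U /nbhs_vn[d d0 Hd]; apply/nbhs_vn; exists (d / K); first by rewrite divr_gt0.
move=> h; rewrite ltr_pdivlMr // => hd /=; rewrite mulmxDr; apply: Hd.
by apply: le_lt_trans (HK h) _; rewrite mulrC.
Qed.

Lemma measurable_continuous (phi : V -> V) : continuous phi ->
  measurable_fun setT (phi : B -> B).
Proof.
move=> /continuousP cphi; apply: (@measurability _ _ B B setT phi (@open V)) => // _ [U oU <-].
by rewrite setTI; apply: measurable_open; exact: cphi.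
Qed.

Variables (Omega Sh : set V) (mu : probability B R).
Hypothesis Sh_closed : closed Sh.
Hypothesis hmu : invariant_measure Omega Sh mu.

Lemma measurable_Sh : measurable (Sh : set B).
Proof. exact: measurable_closed. Qed.

Lemma mu_ShC : mu (~` Sh) = 0%E.
Proof.
have -> : mu (~` Sh) = (1 - mu (Sh : set B))%E by apply: probability_setC; exact: measurable_Sh.
by rewrite (_ : mu (Sh : set B) = 1%E) ?subee //; exact: hmu.1.
Qed.

Lemma mu_ShI (A : set B) : measurable A -> mu (Sh `&` A) = mu A.
Proof.
move=> mA; rewrite -[in RHS](setUIDK A Sh) measureU; last 3 first.
- by apply: measurableI => //; exact: measurable_Sh.
- by apply: measurableD => //; exact: measurable_Sh.
- by apply/seteqP; split=> // x [[_ Sx] [_ /(_ Sx)]].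
rewrite [X in (_ + X)%E](_ : _ = 0%E) ?adde0 1?setIC //.
apply: (subset_measure0 _ _ _ mu_ShC); first by apply: measurableD => //; exact: measurable_Sh.
  by apply: measurableC; exact: measurable_Sh.
by move=> x [].
Qed.

Lemma integral_Sh (k : B -> R) : measurable_fun setT k -> (forall t, 0 <= k t) ->
  (\int[mu]_(t in Sh) (k t)%:E = \int[mu]_t (k t)%:E)%E.
Proof.
move=> mk k0; rewrite [RHS](@ge0_negligible_integral _ _ _ mu setT (~` Sh)) //.
- by rewrite setTD setCK.
- by apply: measurableC; exact: measurable_Sh.
- exact/measurable_EFinP.
- by move=> x _; rewrite lee_fin.
- exact: mu_ShC.
Qed.

(** The measure is carried by [Sh] and invariant there, so it is its own
    image. *)
Lemma integral_isotropy (phi : V -> V) (k : B -> R) :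
  isotropy0 Omega phi -> continuous phi ->
  measurable_fun setT k -> (forall t, 0 <= k t) ->
  (\int[mu]_(t in Sh) (k (phi t))%:E = \int[mu]_(t in Sh) (k t)%:E)%E.
Proof.
move=> iphi cphi mk k0; have mphi := measurable_continuous cphi.
have mkphi : measurable_fun setT (k \o (phi : B -> B)) by exact: measurableT_comp.
rewrite (integral_Sh mk k0) (integral_Sh mkphi (fun t => k0 (phi t))).
rewrite -[RHS](@eq_measure_integral _ _ _ setT mu (pushforward mu (phi : B -> B))).
  rewrite (ge0_integral_pushforward mphi) //; first exact/measurable_EFinP.
  by move=> x _; rewrite lee_fin.
move=> A mA _.
have mpA : measurable (phi @^-1` A : set B) by rewrite -[_ @^-1` _]setTI; exact: mphi.
exact: etrans (esym (mu_ShI mpA)) (etrans (hmu.2 _ iphi A mA) (mu_ShI mA)).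
Qed.
End BorelMeasure.

(** * Null sets of the invariant measure *)

Section ShilovMeasure.
Variables (R : realType) (n : nat).
Local Notation V := (Cn R n).
Local Notation B := (borelCn R n).
Implicit Types (z t h : V) (F : V -> R[i]) (U : set V).

Lemma ball_open z (d : R) : open [set y : V | vn (y - z) < d].
Proof.
apply/open_vn => y /= yd; exists (d - vn (y - z)); first by rewrite subr_gt0.
move=> h hd; rewrite /= -addrA [h - z]addrC addrA.
by apply: le_lt_trans (vnD _ _) _; lra.
Qed.

Lemma measurable_ball z (d : R) : measurable ([set y : V | vn (y - z) < d] : set B).
Proof. by apply: measurable_open; exact: ball_open. Qed.

Definition rational_point (q : 'cV[rat * rat]_n) : V :=
  \col_j (ratr (q j 0).1 +i* ratr (q j 0).2).

Lemma rational_dense z (e : R) : 0 < e -> exists q, vn (z - rational_point q) < e.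
Proof.
move=> e0; pose e' := e / (2 * (n%:R + 1)).
have n0 : 0 < n%:R + 1 :> R by rewrite ltr_wpDl.
have e'0 : 0 < e' by rewrite divr_gt0 // mulr_gt0.
have /choice[q Hq] j : exists q : rat * rat,
    nc (z j 0 - (ratr q.1 +i* ratr q.2)) <= 2 * e'.
  have app x : exists q, `|x - ratr q| <= e'.
    have xe : x - e' < x + e' by lra.
    have [q] := rat_in_itvoo xe; rewrite in_itv /= => /andP[q1 q2]; exists q.
    by rewrite ler_norml; apply/andP; split; lra.
  have [p Hp] := app (complex.Re (z j 0)); have [q Hq] := app (complex.Im (z j 0)).
  exists (p, q); apply: le_trans (nc_ReIm _) _.
  by move: Hp Hq; case: (z j 0) => a b /=; lra.
exists (\col_j q j).
apply: (@le_lt_trans _ _ (n%:R * (2 * e'))).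
  rewrite mulr_natl -[X in _ *+ X]card_ord -sumr_const; apply: ler_sum => j _.
  by rewrite !mxE; exact: Hq.
have E : (n%:R + 1) * (2 * e') = e.
  by rewrite /e'; field; rewrite gt_eqF.
lra.
Qed.

Variables (Omega Sh : set V) (mu : probability B R).
Hypothesis hSh : is_shilov_boundary Omega Sh.
Hypothesis htrans : isotropy_transitive Omega Sh.
Hypothesis hmu : invariant_measure Omega Sh mu.

Let Sh_closed : closed Sh. Proof. by have [[]] := hSh. Qed.

Lemma null_sub (A A' : set V) : A `<=` A' -> measurable (A : set B) ->
  measurable (A' : set B) -> mu A' = 0%E -> mu A = 0%E.
Proof. by move=> sub mA mA' A'0; apply: (@subset_measure0 _ _ _ mu A A'). Qed.

(** Countably many balls with rational centers and null trace would cover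
    [Sh]. *)
Lemma not_locally_null :
  ~ forall t, Sh t -> exists2 d : R, 0 < d & mu (Sh `&` [set y | vn (y - t) < d]) = 0%E.
Proof.
move=> H.
pose U (x : 'cV[rat * rat]_n * nat) : set V :=
  [set y | vn (y - rational_point x.1) < (x.2.+1%:R)^-1].
pose F k : set B := if unpickle k is Some x then
  if mu (Sh `&` U x) == 0%E then Sh `&` U x else set0 else set0.
have F0 k : mu.-negligible (F k).
  rewrite /F; case: (unpickle k) => [x|]; last exact: negligible_set0.
  case: eqP => [E|_]; last exact: negligible_set0.
  apply/negligibleP => //; apply: measurableI; first exact: measurable_closed.
  exact: measurable_ball.
have /negligibleP : mu.-negligible (Sh : set B).
  apply: negligibleS (negligible_bigcup F0) => t St.
  have [d d0 Hd] := H t St.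
  have d2 : 0 < d / 2 by lra.
  have [m Hm] := inv_nat_small d2.
  have m0 : 0 < (m.+1%:R : R)^-1 by rewrite invr_gt0.
  have [q Hq] := rational_dense t m0.
  exists (pickle (q, m)) => //.
  have Ux : mu (Sh `&` U (q, m)) = 0%E.
    have sub : Sh `&` U (q, m) `<=` Sh `&` [set y | vn (y - t) < d].
      move=> y [Sy /= Uy]; split=> //=.
      apply: le_lt_trans (vn_subD _ (rational_point q) _) _.
      have mm := Hm m (leqnn m); rewrite /U /= in Uy; rewrite vnB in Hq.
      by apply: lt_le_trans (ltrD Uy Hq) _; rewrite [leRHS]splitr lerD.
    apply: (null_sub sub) => //; apply: measurableI;
      by [exact: measurable_closed | exact: measurable_ball].
  by rewrite /F pickleK Ux eqxx; split=> //=; rewrite vnB -vnB.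
move=> /(_ (measurable_closed Sh_closed)) mu0.
by have := hmu.1; rewrite mu0 => /eqP; rewrite eqe eq_sym oner_eq0.
Qed.

(** Isotropy maps carry a null neighbourhood of one point of [Sh] to null
    neighbourhoods of all the others. *)
Lemma null_open_disjoint U s : open U -> mu (Sh `&` U) = 0%E -> Sh s -> ~ U s.
Proof.
move=> oU U0 Ss Us; apply: not_locally_null => t St.
have [phi iphi phits] := htrans St Ss.
have [_ _ /subspace_continuousP cphi] := iphi.
have Sh_sub : Sh `<=` closure Omega by have [[]] := hSh.
have loc y : Sh y -> U (phi y) -> exists2 d : R, 0 < d &
    forall x, Sh x -> vn (x - y) < d -> U (phi x).
  move=> Sy Uy; have /nbhs_vn[d d0 Hd] := cphi y (Sh_sub y Sy) U (open_nbhs_nbhs (conj oU Uy)).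
  exists d => // x Sx xy; have := Hd _ xy; rewrite addrC subrK; apply; exact: Sh_sub.
(* The preimage of [U] is open only relatively to the closed domain; [W] is an
   open set with the same trace on [Sh]. *)
pose W : set V := [set y | exists p, exists2 d : R, vn (y - p) < d &
    forall x, Sh x -> vn (x - p) < d -> U (phi x)].
have oW : open W.
  apply/open_vn => y [p [d yp Hd]].
  have /open_vn/(_ y yp)[d' d'0 Hd'] := @ball_open p d.
  by exists d' => // h /Hd' hp; exists p, d.
have SW : Sh `&` W = Sh `&` phi @^-1` U.
  apply/seteqP; split=> y [Sy Wy]; split=> //; first by case: Wy => p [d yp]; apply.
  by have [d d0 Hd] := loc y Sy Wy; exists y, d; rewrite // subrr vn0.
have W0 : mu (Sh `&` W) = 0%E.
  by rewrite SW; apply: etrans U0; apply: hmu.2 => //; exact: measurable_open.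
have [|d d0 Hd] := loc t St; first by rewrite phits.
exists d => //; have sub : Sh `&` [set y | vn (y - t) < d] `<=` Sh `&` W.
  by move=> y [Sy yt]; split=> //; exists t, d.
apply: (null_sub sub) => //; apply: measurableI;
  by [exact: measurable_closed | exact: measurable_open | exact: measurable_ball].
Qed.
End ShilovMeasure.

(** * The Hardy space *)

Section HardySpace.
Variables (R : realType) (n : nat).
Local Notation V := (Cn R n).
Local Notation B := (borelCn R n).
Variables (Omega Sh : set V) (mu : probability B R).
Hypothesis hcirc : circular_realization Omega.
Hypothesis hSh : is_shilov_boundary Omega Sh.
Hypothesis hmu : invariant_measure Omega Sh mu.
Implicit Types (z : V) (F H : V -> R[i]) (r : R) (D : set V).

Let Sh_closed : closed Sh. Proof. by have [[]] := hSh. Qed.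
Let Sh_sub : Sh `<=` closure Omega. Proof. by have [[]] := hSh. Qed.
Let mSh : measurable (Sh : set B). Proof. exact: measurable_closed. Qed.

Lemma shilov_inner r t : 0 < r < 1 -> Sh t -> Omega (r%:C *: t).
Proof.
by move=> /andP[r0 r1] /Sh_sub; apply: (cr_starlike hcirc) => //; exact: ltW.
Qed.

Definition hol_ext D F := (forall z, D z -> hol F z) /\ function_on D F.

Lemma hol_ext_measurable D F r : hol_ext D F ->
  measurable_fun (Sh : set B) (fun t : B => (nc (F (r%:C *: (t : V))) ^+ 2)%:E).
Proof.
move=> [HF F0]; apply/measurable_EFinP; apply: (@measurable_funS _ _ _ _ setT) => //.
exact: measurable_hardy HF F0.
Qed.

Lemma hardy_mean_ge0 F r : (0 <= hardy_mean Sh mu F r)%E.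
Proof. by apply: integral_ge0 => t _; rewrite lee_fin sqr_ge0. Qed.

Lemma hardy_mean_le F r : 0 < r < 1 -> (hardy_mean Sh mu F r <= hardy_normsq Sh mu F)%E.
Proof. by move=> r01; apply: ereal_sup_ubound; exists r. Qed.

Lemma hardy_normsq_ge0 F : (0 <= hardy_normsq Sh mu F)%E.
Proof.
apply: (@le_trans _ _ (hardy_mean Sh mu F (1 / 2))); first exact: hardy_mean_ge0.
by apply: hardy_mean_le; apply/andP; split; lra.
Qed.

Lemma hardy_meanZ D F k r : hol_ext D F ->
  hardy_mean Sh mu (fun z => k * F z) r = ((nc k ^+ 2)%:E * hardy_mean Sh mu F r)%E.
Proof.
move=> HF; rewrite /hardy_mean -ge0_integralZl_EFin ?sqr_ge0 //.
- by apply: eq_integral => t _; rewrite ncM exprMn EFinM.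
- by move=> t _; rewrite lee_fin sqr_ge0.
- exact: hol_ext_measurable HF.
Qed.

Lemma hardy_normsqZ D F k : hol_ext D F ->
  hardy_normsq Sh mu (fun z => k * F z) = ((nc k ^+ 2)%:E * hardy_normsq Sh mu F)%E.
Proof.
move=> HF; rewrite /hardy_normsq -ereal_supZl ?sqr_ge0 //; last first.
  by apply/set0P; exists (hardy_mean Sh mu F (1 / 2)), (1 / 2) => //=; apply/andP; split; lra.
congr ereal_sup; apply/seteqP; split=> [x [r r01 <-]|x [y [r r01 <-] <-]].
  by exists (hardy_mean Sh mu F r); [exists r|rewrite (hardy_meanZ _ _ HF)].
by exists r => //; rewrite (hardy_meanZ _ _ HF).
Qed.

Lemma hol_ext_comb D F H k : hol_ext D F -> hol_ext D H -> hol_ext D (k *: F + H).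
Proof.
move=> [HF F0] [HH H0]; split=> z Dz.
  exact: (hol_comb k (HF z Dz) (HH z Dz)).
by rewrite -[LHS]/(k * F z + H z) F0 // H0 // mulr0 addr0.
Qed.

(** This crude form of the triangle inequality is enough for the Hardy space
    to be linear. *)
Lemma hardy_mean_comb D F H k r : hol_ext D F -> hol_ext D H ->
  (hardy_mean Sh mu (k *: F + H)%R r <=
   (2 * nc k ^+ 2)%:E * hardy_mean Sh mu F r + 2%:E * hardy_mean Sh mu H r)%E.
Proof.
move=> HF HH; have mF := hol_ext_measurable r HF; have mH := hol_ext_measurable r HH.
have sq0 (L : V -> R[i]) : forall t : B, Sh t -> (0 <= (nc (L (r%:C *: (t : V))) ^+ 2)%:E)%E.
  by move=> t _; rewrite lee_fin sqr_ge0.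
have K0 : 0 <= 2 * nc k ^+ 2 by rewrite mulr_ge0 // sqr_ge0.
rewrite /hardy_mean -!ge0_integralZl_EFin //; try exact: sq0.
rewrite -ge0_integralD //.
- apply: ge0_le_integral => //.
  + exact: sq0.
  + exact: hol_ext_measurable (hol_ext_comb k HF HH).
  + by apply: emeasurable_funD; exact: measurable_funeM.
  + move=> t _; rewrite -!EFinM -EFinD lee_fin.
    have := ncD (k * F (r%:C *: (t : V))) (H (r%:C *: (t : V))).
    rewrite ncM; move: (nc k) (nc_ge0 k) => x x0.
    set a := F _; set b := H _; rewrite -[(k *: F + H) _]/(k * a + b).
    move=> uvw; apply: (@le_trans _ _ ((x * nc a + nc b) ^+ 2)).
      by rewrite lerXn2r ?nnegrE ?addr_ge0 ?mulr_ge0 ?nc_ge0.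
    by have := sqr_ge0 (x * nc a - nc b); rewrite !expr2; lra.
- by move=> t _; rewrite mule_ge0 // lee_fin sqr_ge0.
- exact: measurable_funeM.
- by move=> t _; rewrite mule_ge0 // lee_fin sqr_ge0.
- exact: measurable_funeM.
Qed.

Lemma hardy_spaceE F : hardy_space Omega Sh mu F <->
  hol_ext Omega F /\ (hardy_normsq Sh mu F < +oo)%E.
Proof.
split=> [[F0 /holomorphic_onE HF Fn]|[[HF F0] Fn]] //.
by split=> //; apply/holomorphic_onE.
Qed.

Lemma hardy_subspace : linear_subspace (hardy_space Omega Sh mu).
Proof.
split=> [|k F H /hardy_spaceE[HF Fn] /hardy_spaceE[HH Hn]]; apply/hardy_spaceE.
  have h0 : hol_ext Omega 0 by split=> // z _; exact: hol_cst.
  split=> //; rewrite (_ : hardy_normsq _ _ _ = 0%E) ?ltry //.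
  apply/eqP; rewrite eq_le hardy_normsq_ge0 andbT; apply: ge_ereal_sup => x [r r01 <-].
  rewrite /hardy_mean integral0_eq // => t _.
  by rewrite [X in nc X](_ : _ = 0) // nc0 expr0n.
split; first exact: hol_ext_comb.
have nn (L : V -> R[i]) : (hardy_normsq Sh mu L < +oo)%E -> exists x : R, hardy_normsq Sh mu L = x%:E.
  move=> Ln; exists (fine (hardy_normsq Sh mu L)); rewrite fineK // ge0_fin_numE //.
  exact: hardy_normsq_ge0.
have [x Fx] := nn _ Fn; have [y Hy] := nn _ Hn.
apply: (@le_lt_trans _ _ (2 * nc k ^+ 2 * x + 2 * y)%:E); last exact: ltry.
apply: ge_ereal_sup => _ [r r01 <-].
apply: le_trans (hardy_mean_comb k r HF HH) _.
have -> : (2 * nc k ^+ 2 * x + 2 * y)%:E = ((2 * nc k ^+ 2)%:E * x%:E + 2%:E * y%:E)%E by [].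
apply: leeD; rewrite lee_wpmul2l ?lee_fin ?mulr_ge0 ?nc_ge0 //.
  by rewrite -Fx; exact: hardy_mean_le.
by rewrite -Hy; exact: hardy_mean_le.
Qed.
End HardySpace.

(** * The isotypic projection *)

Section Subspaces.
Variables (R : realType) (n : nat).

Lemma subspace_sum (I : eqType) (s : seq I) (A : set (Cn R n -> R[i])) (c : I -> R[i]) (F : I -> Cn R n -> R[i]) :
  linear_subspace A -> (forall i, i \in s -> A (F i)) ->
  A (fun z => \sum_(i <- s) c i * F i z).
Proof.
move=> [A0 Acomb]; elim: s => [|i s IH] Hs.
  by rewrite (_ : (fun _ => _) = 0) //; apply/funext => z; rewrite big_nil.
rewrite (_ : (fun _ => _) = c i *: F i + (fun z => \sum_(i <- s) c i * F i z)); last first.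
  by apply/funext => z; rewrite big_cons.
apply: Acomb; first by apply: Hs; rewrite mem_head.
by apply: IH => j js; apply: Hs; rewrite inE js orbT.
Qed.

Lemma subspace_scale (A : set (Cn R n -> R[i])) (k : R[i]) (F : Cn R n -> R[i]) :
  linear_subspace A -> A F -> A (fun z => k * F z).
Proof.
move=> [A0 Acomb] AF; rewrite (_ : (fun _ => _) = k *: F + 0); first exact: Acomb.
by rewrite addr0.
Qed.
End Subspaces.

Section Projection.
Variables (R : realType) (n : nat).
Local Notation V := (Cn R n).
Variables (Omega Sh : set V) (mu : probability (borelCn R n) R).
Hypothesis hSh : is_shilov_boundary Omega Sh.
Hypothesis hmu : invariant_measure Omega Sh mu.
Variables (gT : finGroupType) (G : {group gT}) (rG : mx_representation R[i] G n).
Hypothesis hact : acts_by_automorphisms rG Omega.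
Variable rho : mx_representation R[i] G 1.
Implicit Types (z : V) (F : V -> R[i]).
Local Notation P := (isotypic_proj rG rho).

Lemma domain_act g z : g \in G -> Omega z -> Omega (rG g *m z).
Proof. by move=> /hact[psi [_ _ [h _] _ _]]; exact: h. Qed.

Lemma domain_actN g z : g \in G -> ~ Omega z -> ~ Omega (rG g *m z).
Proof.
move=> gG nO O; apply: nO; rewrite -(actVK rG z gG).
by apply: domain_act; rewrite ?groupV.
Qed.

(** A group element is linear, so it commutes with dilations and belongs to
    the isotropy group of the origin. *)
Lemma hardy_mean_act F g r : hol_ext Omega F -> g \in G ->
  hardy_mean Sh mu (fun z => F (rG g *m z)) r = hardy_mean Sh mu F r.
Proof.
move=> [HF F0] gG; have Sh_closed : closed Sh by have [[]] := hSh.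
have iso : isotropy0 Omega (fun z => rG g *m z).
  by split; [exact: hact|exact: mulmx0|apply: continuous_subspaceT; exact: mulmx_continuous].
rewrite /hardy_mean -(integral_isotropy Sh_closed hmu iso (@mulmx_continuous _ _ _)
  (measurable_hardy r HF F0) (fun t => sqr_ge0 _)).
by apply: eq_integral => t _; rewrite scalemxAr.
Qed.

Lemma hardy_act F g : hardy_space Omega Sh mu F -> g \in G ->
  hardy_space Omega Sh mu (fun z => F (rG g *m z)).
Proof.
move=> /hardy_spaceE[[HF F0] Fn] gG; apply/hardy_spaceE; split.
  split=> z Oz; last by rewrite F0 //; exact: domain_actN.
  by apply: hol_act; apply: HF; exact: domain_act.
rewrite (_ : hardy_normsq _ _ _ = hardy_normsq Sh mu F) //.
by congr ereal_sup; apply/seteqP; split=> x [r r01 <-]; exists r => //; rewrite hardy_mean_act.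
Qed.

Lemma proj_hardy F : hardy_space Omega Sh mu F -> hardy_space Omega Sh mu (P F).
Proof.
move=> HF; apply: subspace_scale; first exact: hardy_subspace.
rewrite (_ : (fun _ => _) = fun z => \sum_(g <- enum G) chi rho g^-1%g * F (rG g *m z)).
  apply: (@subspace_sum R n _ _ _ _ (fun g z => F (rG g *m z))); first exact: hardy_subspace.
  by move=> g; rewrite mem_enum => gG; exact: hardy_act.
by apply/funext => z; rewrite big_enum.
Qed.

Lemma proj_chi F g z : g \in G -> P F (rG g *m z) = chi rho g * P F z.
Proof.
move=> gG; rewrite /isotypic_proj mulrCA; congr (_ * _).
rewrite [in RHS](reindex_inj (mulIg g)) /= mulr_sumr.
apply: eq_big => [h|h hG]; first by rewrite groupMr.
rewrite actM // mulrA; congr (_ * _).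
by rewrite invMg chiM ?groupV // mulrA [chi rho g * _]mulrC chiV // mul1r.
Qed.

Lemma proj_fixed F : (forall g z, g \in G -> F (rG g *m z) = chi rho g * F z) -> P F = F.
Proof.
move=> HF; apply/funext => z; rewrite /isotypic_proj.
rewrite (eq_bigr (fun=> F z)) => [|g gG]; last by rewrite HF // mulrA chiV // mul1r.
by rewrite sumr_const -[X in _ * X]mulr_natl mulrA mulVf ?mul1r // pnatr_eq0 -lt0n cardG_gt0.
Qed.

Lemma projE k F H : P (k *: F + H) = k *: P F + P H.
Proof.
apply/funext => z; rewrite -[RHS]/(k * P F z + P H z) /isotypic_proj.
rewrite [in RHS]mulrCA -mulrDr; congr (_ * _).
rewrite [in RHS]mulr_sumr -big_split /=; apply: eq_bigr => g _.
rewrite -[(k *: F + H) _]/(k * F _ + H _); ring.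
Qed.

Lemma proj_subspace : linear_subspace (P @` hardy_space Omega Sh mu).
Proof.
have [h0 hcomb] := hardy_subspace mu hSh.
split=> [|k _ _ [F HF <-] [H HH <-]].
  exists 0 => //; apply: proj_fixed => g z _.
  by rewrite [LHS](_ : _ = 0) // [X in _ * X](_ : _ = 0) ?mulr0.
by exists (k *: F + H); [exact: hcomb|rewrite projE].
Qed.
End Projection.

(** * The isometry *)

Section Isometry.
Variables (R : realType) (n : nat).
Local Notation V := (Cn R n).
Variables (Omega Sh : set V) (mu : probability (borelCn R n) R).
Hypothesis hOmega : bounded_symmetric_domain Omega.
Hypothesis hcirc : circular_realization Omega.
Hypothesis hSh : is_shilov_boundary Omega Sh.
Hypothesis htrans : isotropy_transitive Omega Sh.
Hypothesis hmu : invariant_measure Omega Sh mu.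
Variables (gT : finGroupType) (G : {group gT}) (rG : mx_representation R[i] G n).
Hypothesis hG : reflection_group rG.
Hypothesis hact : acts_by_automorphisms rG Omega.
Variable theta : n.-tuple (mpoly n R[i]).
Hypothesis htheta : basic_polynomials rG theta.
Variables (t : nat) (ell : 'I_t -> 'rV[R[i]]_n) (a : 'I_t -> gT).
Hypothesis hell : reflecting_hyperplanes rG ell a.
Variable rho : mx_representation R[i] G 1.
Variable c : 'I_t -> nat.
Hypothesis hc : forall i, least_exponent rG rho (a i) (c i).
Implicit Types (z w y : V) (F h : V -> R[i]).
Local Notation theta_map := (basic_map theta).
Local Notation l := (ell_prod ell c).
Local Notation P := (isotypic_proj rG rho).

Let Sh_closed : closed Sh. Proof. by have [[]] := hSh. Qed.
Let mSh : measurable (Sh : set (borelCn R n)). Proof. exact: measurable_closed. Qed.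

Lemma hol_ell z : hol l z.
Proof.
by apply: (hol_near (hol_poly (ellp ell c) z)); exists 1 => // h _; rewrite ellpE.
Qed.

Lemma hol_ext_ell : hol_ext setT l.
Proof. by split=> z; [move=> _; exact: hol_ell|case]. Qed.

Lemma ell_not_locally0 z (d : R) : 0 < d -> ~ (forall h : V, vn h < d -> l (z + h) = 0).
Proof.
move=> d0 H; have l0 : forall y, poly_eval (ellp ell c) y = 0.
  by apply: (poly_eval_near d0) => y yd; rewrite ellpE; exact: H.
have : poly_eval (mpolyC n (1 : R[i])) 0 = 0 :> R[i].
  by apply: (ell_prod_cancel hell (c := c)) => y; rewrite -ellpE l0 mul0r.
by rewrite poly_evalC => /eqP; rewrite oner_eq0.
Qed.

(** Polynomials are bounded on the bounded domain. *)
Lemma hardy_ell_finite : (hardy_normsq Sh mu l < +oo)%E.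
Proof.
have [M HM] := domain_bounded hOmega hcirc.
have [K HK] := poly_bounded (ellp ell c) M.
apply: (@le_lt_trans _ _ (K ^+ 2)%:E); last exact: ltry.
apply: ge_ereal_sup => _ [r r01 <-].
apply: (@le_trans _ _ (\int[mu]_(x in Sh) cst (K ^+ 2)%:E x)%E).
  apply: ge0_le_integral => //.
  - by move=> x _; rewrite lee_fin sqr_ge0.
  - exact: (hol_ext_measurable r hol_ext_ell).
  - move=> x Sx; rewrite lee_fin.
    have := HK _ (HM _ (shilov_inner hcirc hSh r01 Sx)); rewrite ellpE.
    by move=> lK; rewrite lerXn2r ?nnegrE ?nc_ge0 //; apply: le_trans lK; exact: nc_ge0.
by rewrite integral_cst // [X in (_ * X)%E](_ : _ = 1%E) ?mule1 //; exact: hmu.1.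
Qed.

(** If the means vanished, [ell_prod] would vanish at the dilated points of
    the Shilov boundary, hence near the origin by the maximum property of that
    boundary. *)
Lemma hardy_ell_neq0 : hardy_normsq Sh mu l != 0%E.
Proof.
apply/eqP => N0; have half : 0 < (1 / 2 : R) < 1 by apply/andP; split; lra.
have mean0 : hardy_mean Sh mu l (1 / 2) = 0%E.
  by apply/eqP; rewrite eq_le hardy_mean_ge0 -N0 hardy_mean_le.
pose U := [set z : V | 0 < nc (l ((1 / 2)%:C *: z)) ^+ 2].
have oU : open U by exact: (superlevel_open hol_ext_ell.1 hol_ext_ell.2).
have U0 : mu (Sh `&` U) = 0%E.
  have mf s := @hol_ext_measurable _ _ s _ _ (1 / 2) hol_ext_ell.
  have abs0 : (\int[mu]_(x in Sh) `|(nc (l ((1 / 2)%:C *: x)) ^+ 2)%:E|)%E = 0%E.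
    by rewrite -[RHS]mean0; apply: eq_integral => x _; rewrite gee0_abs // lee_fin sqr_ge0.
  have [/(_ abs0) ae0 _] := ae_eq_integral_abs mu mSh (mf Sh).
  apply/negligibleP; first by apply: measurableI => //; exact: measurable_open.
  apply: negligibleS ae0 => x [Sx /= Ux] /(_ Sx) [] /eqP; rewrite gt_eqF //.
have Sh0 s : Sh s -> l ((1 / 2)%:C *: s) = 0.
  move=> Ss; have := null_open_disjoint hSh htrans hmu oU U0 Ss; rewrite /U /=.
  have [-> //|l0] := eqVneq (l ((1 / 2)%:C *: s)) 0.
  by case; rewrite exprn_gt0 // nc_gt0.
have hl : holomorphic_on setT (fun z => l ((1 / 2)%:C *: z)).
  by apply/holomorphic_onE => z _; apply: hol_scale; exact: hol_ell.
have dl : disc_algebra Omega (fun z => l ((1 / 2)%:C *: z)).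
  split; last by move=> z _; exact: hl.
  by apply: continuous_subspaceT => z; apply: differentiable_continuous; exact: hl.
have O0 z : Omega z -> l ((1 / 2)%:C *: z) = 0.
  move=> Oz; have [[_ _ H] _] := hSh.
  have [s Ss] := H _ dl z (subset_closure Oz).
  by rewrite (Sh0 s Ss) normr0 normr_le0 => /eqP.
have [d d0 Hd] := domain_open hOmega (cr_origin hcirc).
apply: (@ell_not_locally0 0 (d / 2)) => [|y yd]; first by rewrite divr_gt0.
rewrite add0r -[y]scale1r.
have -> : (1 : R[i]) = (1 / 2)%:C * 2%:R.
  by rewrite -(rmorph_nat (@real_complex R)) -rmorphM mul1r mulVf ?rmorph1 // pnatr_eq0.
rewrite -scalerA; apply: O0; rewrite -[X in Omega X]add0r; apply: Hd.
by rewrite vnZ nc_natr; lra.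
Qed.

Let N : R := hardy_norm Sh mu l.

Lemma ell_norm_gt0 : 0 < N.
Proof.
rewrite sqrtr_gt0; apply: fine_gt0.
by rewrite hardy_ell_finite lt_neqAle eq_sym hardy_ell_neq0 hardy_normsq_ge0.
Qed.

(** The isometry without its normalizing constant. *)
Definition orbit_lift h : V -> R[i] := fun z => if z \in Omega then l z * h (theta_map z) else 0.

Lemma orbit_liftE h z : Omega z -> orbit_lift h z = l z * h (theta_map z).
Proof. by rewrite /orbit_lift => Oz; rewrite mem_set. Qed.

Lemma Gamma_lift h : Gamma_hardy Omega Sh mu theta_map l h = fun z => (N^-1)%:C * orbit_lift h z.
Proof. by apply/funext => z; rewrite /Gamma_hardy /orbit_lift; case: ifP => _; rewrite ?mulr0 ?mulrA. Qed.

Lemma orbit_lift_hol_ext h : holomorphic_on (theta_map @` Omega) h -> hol_ext Omega (orbit_lift h).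
Proof.
move=> /holomorphic_onE Hh; split=> z Oz; last by rewrite /orbit_lift memNset.
have Hz : hol (fun y => l y * h (theta_map y)) z.
  by apply: holM; [exact: hol_ell|apply: hol_basic_map; apply: Hh; exists z].
apply: (hol_near Hz); have [d d0 Hd] := domain_open hOmega Oz.
by exists d => // y /Hd Oy; rewrite orbit_liftE.
Qed.

Lemma orbit_normsqE h : holomorphic_on (theta_map @` Omega) h ->
  orbit_normsq Sh mu theta_map l h =
  hardy_normsq Sh mu (Gamma_hardy Omega Sh mu theta_map l h).
Proof.
move=> /orbit_lift_hol_ext Hh; rewrite Gamma_lift (hardy_normsqZ mu hSh _ Hh) /orbit_normsq.
congr (_%:E * _)%E.
  by rewrite -/N nc_real ger0_norm ?exprVn // invr_ge0 ltW // ell_norm_gt0.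
have mean r : 0 < r < 1 ->
    orbit_mean Sh mu theta_map l h r = hardy_mean Sh mu (orbit_lift h) r.
  move=> r01; apply: eq_integral => s /set_mem Ss.
  by rewrite orbit_liftE; [rewrite ncM exprMn mulrC|exact: (shilov_inner hcirc hSh)].
by congr ereal_sup; apply/seteqP; split=> x [r r01 <-]; exists r => //; rewrite mean.
Qed.

Lemma orbit_spaceE h : orbit_hardy_space Omega Sh mu theta_map l h <->
  [/\ function_on (theta_map @` Omega) h, holomorphic_on (theta_map @` Omega) h &
      hardy_space Omega Sh mu (Gamma_hardy Omega Sh mu theta_map l h)].
Proof.
split=> [[h0 hh hn]|[h0 hh /hardy_spaceE[_ hn]]]; split=> //; last by rewrite orbit_normsqE.
apply/hardy_spaceE; rewrite -orbit_normsqE //; split=> //.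
have [Hl l0] := orbit_lift_hol_ext hh; rewrite Gamma_lift; split=> z Oz.
  exact: holZ (Hl z Oz).
by rewrite l0 // mulr0.
Qed.

Local Notation Gamma := (Gamma_hardy Omega Sh mu theta_map l).

Lemma GammaE k u v : Gamma (k *: u + v) = k *: Gamma u + Gamma v.
Proof.
apply/funext => z; rewrite -[RHS]/(k * Gamma u z + Gamma v z) !Gamma_lift /orbit_lift.
case: ifP => _; last by ring.
by rewrite -[(k *: u + v) _]/(k * u _ + v _); ring.
Qed.

Lemma Gamma0 : Gamma 0 = 0.
Proof.
apply/funext => z; rewrite Gamma_lift /orbit_lift; case: ifP => _; rewrite ?mulr0 //.
Qed.

Lemma orbit_subspace : linear_subspace (orbit_hardy_space Omega Sh mu theta_map l).
Proof.
have [h0 hcomb] := hardy_subspace mu hSh.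
split=> [|k u v /orbit_spaceE[u0 /holomorphic_onE hu Hu] /orbit_spaceE[v0 /holomorphic_onE hv Hv]];
  apply/orbit_spaceE; split.
- by [].
- by apply/holomorphic_onE => z _; exact: hol_cst.
- by rewrite Gamma0.
- by move=> w Ow; rewrite -[LHS]/(k * u w + v w) u0 // v0 // mulr0 addr0.
- by apply/holomorphic_onE => w Ow; exact: hol_comb (hu w Ow) (hv w Ow).
- by rewrite GammaE; exact: hcomb.
Qed.

Lemma Gamma_chi h g z : g \in G -> Gamma h (rG g *m z) = chi rho g * Gamma h z.
Proof.
move=> gG; rewrite !Gamma_lift; have [Oz|Oz] := pselect (Omega z).
  rewrite !orbit_liftE //; last exact: (domain_act hact).
  by rewrite (ell_prod_chi hell hc hG) // (basic_map_inv htheta) //; ring.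
by rewrite /orbit_lift !memNset ?mulr0 //; exact: (domain_actN hact).
Qed.

(** [ell_prod] does not vanish identically on any ball, so a continuous factor
    can be recovered from the product. *)
Lemma Gamma_inj u v :
  orbit_hardy_space Omega Sh mu theta_map l u ->
  orbit_hardy_space Omega Sh mu theta_map l v ->
  Gamma u = Gamma v -> u = v.
Proof.
move=> /orbit_spaceE[u0 /holomorphic_onE hu _] /orbit_spaceE[v0 /holomorphic_onE hv _] E.
apply/funext => w; have [Ow|Ow] := pselect ((theta_map @` Omega) w); last by rewrite u0 ?v0.
have [z Oz zw] := Ow; rewrite -zw in Ow *.
pose e y := -1 * v (theta_map y) + u (theta_map y).
have ez : hol e z by apply: hol_comb; apply: hol_basic_map; [exact: hv|exact: hu].
have le y : Omega y -> l y * e y = 0.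
  move=> Oy; have := congr1 (fun F : V -> R[i] => F y) E; rewrite !Gamma_lift !orbit_liftE //.
  have N0 : (N^-1)%:C != 0 :> R[i].
    by rewrite -nc_gt0 nc_real normr_gt0 invr_neq0 // gt_eqF // ell_norm_gt0.
  by move=> /(mulfI N0) El; rewrite /e mulrDr El; ring.
suff e0 : e z = 0 by apply/eqP; rewrite -subr_eq0 addrC -mulN1r -/(e z) e0.
have [//|enz] := eqVneq (e z) 0.
have e0 : 0 < nc (e z) / 2 by rewrite divr_gt0 // nc_gt0.
have [d d0 Hd] := hol_cont ez e0; have [d' d'0 Hd'] := domain_open hOmega Oz.
have [] := @ell_not_locally0 z (Num.min d d'); first by rewrite lt_min d0.
move=> y; rewrite lt_min => /andP[yd yd'].
have /eqP := le _ (Hd' y yd'); rewrite mulf_eq0 => /orP[/eqP //|/eqP e0'].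
have := Hd (z + y); rewrite addrC addKr => /(_ yd); rewrite e0' sub0r ncN.
by move=> e1; exfalso; move: e0 e1; lra.
Qed.

(** Descent gives the quotient by [ell_prod] on the orbit space, which is
    open; so its extension by zero is holomorphic there. *)
Lemma Gamma_surj F : hardy_space Omega Sh mu F ->
  (forall g z, g \in G -> F (rG g *m z) = chi rho g * F z) ->
  exists2 h, orbit_hardy_space Omega Sh mu theta_map l h & Gamma h = F.
Proof.
move=> HF Fchi; have /hardy_spaceE[[Fh F0] _] := HF.
have [h0 [hh0 Fh0]] := holomorphic_descent (domain_open hOmega) (@domain_disc _ _ _ hcirc)
  (cr_origin hcirc) hG (fun g z => @domain_act _ _ _ _ _ _ hact g z) htheta hell hc Fh
  (fun g z gG _ => Fchi g z gG).
pose h w := if w \in theta_map @` Omega then N%:C * h0 w else 0.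
have hE z : Omega z -> h (theta_map z) = N%:C * h0 (theta_map z).
  by move=> Oz; rewrite /h mem_set //; exists z.
have GF : Gamma h = F.
  apply/funext => z; rewrite Gamma_lift; have [Oz|Oz] := pselect (Omega z).
    rewrite orbit_liftE // hE // mulrCA [(_^-1)%:C * _]mulrA -rmorphM mulVf ?rmorph1 ?mul1r -?Fh0 //.
    by rewrite gt_eqF // ell_norm_gt0.
  by rewrite F0 // /orbit_lift memNset // mulr0.
exists h => //; apply/orbit_spaceE; split; last by rewrite GF.
- by move=> w Ow; rewrite /h memNset.
apply/holomorphic_onE => _ [z Oz <-].
have := holZ N%:C (hh0 z Oz); move=> /hol_near; apply.
have [d d0 Hd] := domain_open hOmega Oz.
have [d' d'0 Hd'] := basic_map_open htheta z d0.
exists d' => // k kd; have [|y yz <-] := Hd' (theta_map z + k); first by rewrite addrC addKr.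
by rewrite hE //; have := Hd _ yz; rewrite addrC subrK.
Qed.
End Isometry.

Theorem proposition3p7 (R : realType) (n : nat) (hn : (0 < n)%N)
  (Omega : set (Cn R n))
  (hOmega : bounded_symmetric_domain Omega)
  (hcirc : circular_realization Omega)
  (Sh : set (Cn R n)) (hSh : is_shilov_boundary Omega Sh)
  (htrans : isotropy_transitive Omega Sh)
  (mu : probability (borelCn R n) R)
  (hmu : invariant_measure Omega Sh mu)
  (gT : finGroupType) (G : {group gT}) (rG : mx_representation R[i] G n)
  (hG : reflection_group rG) (hact : acts_by_automorphisms rG Omega)
  (theta : n.-tuple (mpoly n R[i])) (htheta : basic_polynomials rG theta)
  (t : nat) (ell : 'I_t -> 'rV[R[i]]_n) (a : 'I_t -> gT)
  (hell : reflecting_hyperplanes rG ell a)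
  (rho : mx_representation R[i] G 1)
  (c : 'I_t -> nat) (hc : forall i, least_exponent rG rho (a i) (c i)) :
  isometric_isomorphism
    (orbit_hardy_space Omega Sh mu (basic_map theta) (ell_prod ell c))
    (orbit_norm Sh mu (basic_map theta) (ell_prod ell c))
    (isotypic_proj rG rho @` hardy_space Omega Sh mu)
    (hardy_norm Sh mu)
    (Gamma_hardy Omega Sh mu (basic_map theta) (ell_prod ell c)).
Proof.
have orbE := orbit_spaceE hOmega hcirc hSh htrans hmu theta hell c.
split.
- split; first exact: (orbit_subspace hOmega hcirc hSh htrans hmu theta hell c).
  exact: proj_subspace.
- by move=> k u v _ _; exact: GammaE.
- split=> [u /orbE[_ _ Hu]|u v /set_mem Hu /set_mem Hv|F [H HH <-]].
  + exists (Gamma_hardy Omega Sh mu (basic_map theta) (ell_prod ell c) u) => //.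
    by apply: proj_fixed => g z gG; rewrite (Gamma_chi Sh mu hG hact htheta hell hc _ _ gG).
  + exact: (Gamma_inj hOmega hcirc hSh htrans hmu hell).
  + have HP := proj_hardy hSh hmu hact rho HH.
    have [h Hh <-] := Gamma_surj hOmega hcirc hSh htrans hmu hG hact htheta hell hc HP
      (fun g z gG => proj_chi rG rho H z gG).
    by exists h.
- by move=> u /orbE[_ Hu _]; rewrite /orbit_norm (orbit_normsqE hOmega hcirc hSh htrans hmu hell).
Qed.
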